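(* Let $k$ be an algebraically closed field and $\Lambda$ an indecomposable finite dimensional $k$-algebra with Jacobson radical $\mathfrak{r}$. Let $H$ be a graded subalgebra of the Hochschild cohomology ring $\mathrm{HH}^*(\Lambda)$ such that $H$ is a commutative Noetherian ring with $H^0=\mathrm{HH}^0(\Lambda)=Z(\Lambda)$, and suppose that $\mathrm{Ext}^*_\Lambda(\Lambda/\mathfrak{r},\Lambda/\mathfrak{r})$ is a finitely generated $H$-module. Then: (a) The algebra $\Lambda$ is Gorenstein, i.e. the injective dimensions of $\Lambda$ as a left and as a right module over itself are finite. (b) The following are equivalent for a finitely generated left $\Lambda$-module $M$: (i) the variety $V_H(M)$ is trivial; (ii) the projective dimension of $M$ is finite; (iii) the injective dimension of $M$ is finite. (c) $\dim V_H(M)=c_\Lambda(M)$ for every finitely generated left $\Lambda$-module $M$, where $c_\Lambda(M)$ is the complexity of $M$.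
   Context: $\mathrm{HH}^*(\Lambda)=\bigoplus_{i\ge 0}\mathrm{Ext}^i_{\Lambda^e}(\Lambda,\Lambda)$ with $\Lambda^e=\Lambda\otimes_k\Lambda^{\mathrm{op}}$. For finitely generated left $\Lambda$-modules $M,N$, $\mathrm{Ext}^*_\Lambda(M,N)=\bigoplus_{i\ge 0}\mathrm{Ext}^i_\Lambda(M,N)$ is a graded $\mathrm{HH}^*(\Lambda)$-module (hence an $H$-module) via the graded ring homomorphism $\mathrm{HH}^*(\Lambda)\to\mathrm{Ext}^*_\Lambda(M,M)$ induced by $-\otimes_\Lambda M$ followed by Yoneda product (equivalently, up to sign on homogeneous elements, via $-\otimes_\Lambda N$). $A_H(M,N)$ denotes the annihilator of $\mathrm{Ext}^*_\Lambda(M,N)$ in $H$. The variety of $M$ is $V_H(M)=\{\mathfrak{m}\in\mathrm{MaxSpec}\,H\mid A_H(M,\Lambda/\mathfrak{r})\subseteq\mathfrak{m}\}$ (the same set is obtained from $A_H(M,M)$ or $A_H(\Lambda/\mathfrak{r},M)$); its dimension is the Krull dimension of $H/A_H(M,\Lambda/\mathfrak{r})$ (taken to be $0$ when $M=0$). $\mathfrak{m}_{\mathrm{gr}}=\mathrm{rad}(H^0)\oplus H^{\ge 1}$ is the unique maximal graded ideal of $H$; a variety is called trivial if it contains no point other than $\mathfrak{m}_{\mathrm{gr}}$. The complexity is $c_\Lambda(M)=\min\{b\in\mathbb{N}_0\mid \exists a\in\mathbb{R}\text{ such that }\dim_k Q_n\le a n^{b-1}\ \forall n\geq 0\}$ (growth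 rate, to be read for $n\gg 0$), where $\cdots\to Q_1\to Q_0\to M\to 0$ is a minimal projective resolution. *)

(* Defs.v *)
From HB Require Import structures.
From mathcomp Require Import all_boot all_order all_algebra all_field.
From mathcomp Require Import ring_quotient.
From mathcomp Require Import boolp classical_sets functions reals.

Set Implicit Arguments.
Unset Strict Implicit.
Unset Printing Implicit Defensive.

Import Order.TTheory GRing.Theory Num.Theory.

Local Open Scope ring_scope.
Local Open Scope quotient_scope.

(* The opposite algebra as a finite dimensional algebra: its left modules are
   the right modules of A. *)
Section Opposite.
Variables (k : fieldType) (A : falgType k).

HB.instance Definition _ := GRing.Lmodule.copy (A^c)%type A.
HB.instance Definition _ := Vector.copy (A^c)%type A.

Fact opp_scalerAl (c : k) (x y : A^c) :
  c *: (x * y) = (c *: x : A^c) * y.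
Proof. exact: (@scalerAr k A c y x). Qed.
HB.instance Definition _ :=
  GRing.Lmodule_isLalgebra.Build k (A^c)%type opp_scalerAl.

Fact opp_scalerAr (c : k) (x y : A^c) :
  c *: (x * y) = x * (c *: y : A^c).
Proof. exact: (@scalerAl k A c y x). Qed.
HB.instance Definition _ :=
  GRing.Lalgebra_isAlgebra.Build k (A^c)%type opp_scalerAr.
End Opposite.

Fact leibniz_zmod (V : zmodType) (x1 x2 x3 x4 x5 x6 x7 x8 x9 y1 y2 : V) :
  (x1 + x2) - (x3 + x4) + (x5 + x6) - (x7 - x8 + x5 + (x9 + y1)) =
  x1 - y2 + (x2 - x4 + x6 - x9) + ((y2 - x3 + x8 - x7) - y1).
Proof.
apply/eqP; rewrite -subr_eq0 !opprD !opprK !addrA.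
rewrite [X in X == 0](ACl ((1*12)*(2*14)*(19*3)*(15*4)*(5*9)*(6*16)*(21*7)
  *(8*20)*(17*10)*(22*11)*(13*18))).
by rewrite /= !subrr !addr0.
Qed.

Section LinearFacts.
Variables (k : fieldType) (U V : lmodType k) (f : U -> V) (lf : linear f).

Lemma linear_addE x y : f (x + y) = f x + f y.
Proof. by rewrite -[x in LHS]scale1r lf scale1r. Qed.
Lemma linear_zeroE : f 0 = 0.
Proof. by apply: (addrI (f 0)); rewrite -linear_addE !addr0. Qed.
Lemma linear_scaleE c x : f (c *: x) = c *: f x.
Proof. by rewrite -[c *: x]addr0 lf linear_zeroE addr0. Qed.
End LinearFacts.

Section Cohomology.
Variables (k : fieldType) (A : falgType k).

Record bimod := Bimod {
  bimod_sort :> lmodType k;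
  lact : A -> bimod_sort -> bimod_sort;
  ract : bimod_sort -> A -> bimod_sort;
  lact_linl : forall m, linear (lact^~ m);
  lact_linr : forall a, linear (lact a);
  ract_linl : forall a, linear (ract^~ a);
  ract_linr : forall m, linear (ract m);
  lact1 : forall m, lact 1 m = m;
  lactM : forall a b m, lact (a * b) m = lact a (lact b m);
  ract1 : forall m, ract m 1 = m;
  ractM : forall a b m, ract m (a * b) = ract (ract m a) b;
  lract : forall a b m, ract (lact a m) b = lact a (ract m b)
}.

Section Complex.
Variable B : bimod.

Lemma lactD a (x y : B) : lact a (x + y) = lact a x + lact a y.
Proof. exact: (linear_addE (lact_linr a)). Qed.
Lemma lactZ a c (x : B) : lact a (c *: x) = c *: lact a x.
Proof. exact: (linear_scaleE (lact_linr a)). Qed.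
Lemma ractD a (x y : B) : ract (x + y) a = ract x a + ract y a.
Proof. exact: (linear_addE (ract_linl a) x y). Qed.
Lemma ractZ a c (x : B) : ract (c *: x) a = c *: ract x a.
Proof. exact: (linear_scaleE (ract_linl a) c x). Qed.

(* The elements of Hom_k(A^{(x) n}, B) are encoded as k-multilinear functions
   of lists of length n, and those of the direct sum over all n >= 0 as
   functions of lists of any length that vanish on all long enough lists. *)
Definition multilinear (f : seq A -> B) :=
  forall s1 s2, linear (fun a => f (s1 ++ a :: s2)).
Definition bounded (f : seq A -> B) :=
  exists N, forall s, (N <= size s)%N -> f s = 0.
Definition is_cochain f := multilinear f /\ bounded f.

Definition merge (i : nat) (s : seq A) : seq A :=
  take i s ++ (s`_i * s`_i.+1) :: drop i.+2 s.

(* (df)(a_0,...,a_n) = a_0 f(a_1,...,a_n)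
     + \sum_(i < n) (-1)^(i+1) f(a_0,...,a_i a_(i+1),...,a_n)
     + (-1)^(n+1) f(a_0,...,a_(n-1)) a_n,
   i.e. the differential of Hom_{A^e}(Bar(A), B), where Bar(A) is the bar
   resolution of A over A^e, Bar_n(A) = A (x) A^{(x) n} (x) A. *)
Definition diff (f : seq A -> B) (s : seq A) : B :=
  if s is a :: t then
    lact a (f t)
    + \sum_(i < size t) (-1) ^+ i.+1 *: f (merge i s)
    + (-1) ^+ (size s) *: ract (f (belast a t)) (last a t)
  else 0.

Lemma lincombE c (f g : seq A -> B) s : (c *: f + g) s = c *: f s + g s.
Proof. by []. Qed.

Lemma diff_linear : linear diff.
Proof.
move=> c f g; apply/funext => -[|a t] /=.
  by rewrite lincombE /= scaler0 addr0.
rewrite lincombE /= !lincombE lactD lactZ ractD ractZ !scalerDr.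
have -> : \sum_(i < size t) (-1) ^+ i.+1 *: (c *: f + g) (merge i (a :: t)) =
  c *: (\sum_(i < size t) (-1) ^+ i.+1 *: f (merge i (a :: t)))
  + \sum_(i < size t) (-1) ^+ i.+1 *: g (merge i (a :: t)).
  rewrite scaler_sumr -big_split; apply: eq_bigr => i _ /=.
  by rewrite lincombE scalerDr !scalerA (mulrC c).
rewrite [in LHS]scalerA [in LHS](mulrC _ c) -[in LHS]scalerA.
by rewrite [LHS](AC ((2*2)*2) ((1*3*5)*(2*4*6))).
Qed.

Lemma diffD f g : diff (f + g) = diff f + diff g.
Proof. by have := diff_linear 1 f g; rewrite !scale1r. Qed.
Lemma diff0 : diff 0 = 0.
Proof. by apply: (addrI (diff 0)); rewrite -diffD !addr0. Qed.
Lemma diffZ c f : diff (c *: f) = c *: diff f.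
Proof. by have := diff_linear c f 0; rewrite diff0 !addr0. Qed.

Lemma is_cochain_submod c f g :
  is_cochain f -> is_cochain g -> is_cochain (c *: f + g).
Proof.
case=> mf [N1 b1] [mg [N2 b2]]; split.
  move=> s1 s2 e x y; rewrite !lincombE (mf s1 s2) (mg s1 s2).
  rewrite !scalerDr !scalerA (mulrC c) -!addrA; congr (_ + _).
  by rewrite addrCA.
exists (maxn N1 N2) => s; rewrite geq_max => /andP[h1 h2].
by rewrite lincombE b1 // b2 // scaler0 addr0.
Qed.
Lemma is_cochain0 : is_cochain 0.
Proof.
split; last by exists 0%N.
by move=> s1 s2 c x y; rewrite [RHS]addr0 [RHS]scaler0.
Qed.

Definition cocycle : {pred (seq A -> B)} :=
  fun f => `[< is_cochain f /\ diff f = 0 >].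

Fact cocycle_submod : submod_closed cocycle.
Proof.
split; first by apply/asboolP; split; [exact: is_cochain0|exact: diff0].
move=> c f g /asboolP[cf df] /asboolP[cg dg]; apply/asboolP; split.
  exact: is_cochain_submod.
by rewrite diff_linear df dg scaler0 addr0.
Qed.
HB.instance Definition _ :=
  GRing.isSubmodClosed.Build k (seq A -> B) cocycle cocycle_submod.

Record Zcoc := MkZcoc { zval :> seq A -> B; zvalP : zval \in cocycle }.
HB.instance Definition _ := [isSub for zval].
HB.instance Definition _ := [Choice of Zcoc by <:].
HB.instance Definition _ := [SubChoice_isSubLmodule of Zcoc by <:].

Definition coboundary : {pred Zcoc} :=
  fun z => `[< exists2 u, is_cochain u & zval z = diff u >].

Fact coboundary_submod : submod_closed coboundary.
Proof.
split.
  apply/asboolP; exists 0; first exact: is_cochain0.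
  by rewrite diff0.
move=> c x y /asboolP[u cu du] /asboolP[v cv dv]; apply/asboolP.
exists (c *: u + v); first exact: is_cochain_submod.
by rewrite diff_linear -du -dv.
Qed.
HB.instance Definition _ :=
  GRing.isSubmodClosed.Build k Zcoc coboundary coboundary_submod.

(* The direct sum of the H^n(Hom_{A^e}(Bar(A), B)) over all n >= 0. *)
Definition coh := Quotient.quot coboundary.
HB.instance Definition _ := Choice.on coh.
HB.instance Definition _ := GRing.Zmodule.on coh.
HB.instance Definition _ := EqQuotient.on coh.

Definition cls (z : Zcoc) : coh := \pi_coh z.

Lemma clsE (x y : Zcoc) : (cls x = cls y) <-> (x - y \in coboundary).
Proof.
by split=> [/eqP|h]; [|apply/eqP]; rewrite /cls -(Quotient.idealrBE coboundary).
Qed.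

Lemma clsK (x : coh) : cls (repr x) = x.
Proof. exact: reprK. Qed.

Lemma clsD x y : cls (x + y) = cls x + cls y.
Proof. exact: (Quotient.pi_add coboundary x y). Qed.

Lemma cls0 : cls 0 = 0.
Proof. by apply: (addrI (cls 0)); rewrite -clsD !addr0. Qed.

Lemma repr_cls (z : Zcoc) : repr (cls z) - z \in coboundary.
Proof. by apply/clsE; rewrite clsK. Qed.

Definition coh_scale (c : k) (x : coh) : coh := cls (c *: repr x).

Lemma clsZ c z : cls (c *: z) = coh_scale c (cls z).
Proof.
apply/esym/clsE; rewrite -scalerBr; apply: rpredZ; exact: repr_cls.
Qed.

Fact coh_scaleA a b x : coh_scale a (coh_scale b x) = coh_scale (a * b) x.
Proof. by rewrite -(clsK x) -!clsZ scalerA. Qed.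
Fact coh_scale1 : left_id 1 coh_scale.
Proof. by move=> x; rewrite -(clsK x) -clsZ scale1r. Qed.
Fact coh_scaleDr : right_distributive coh_scale +%R.
Proof. by move=> c x y; rewrite -(clsK x) -(clsK y) -clsD -!clsZ scalerDr clsD. Qed.
Fact coh_scaleDl x : {morph coh_scale^~ x : a b / a + b}.
Proof. by move=> a b /=; rewrite -(clsK x) -!clsZ scalerDl clsD. Qed.
HB.instance Definition _ := GRing.Zmodule_isLmodule.Build k coh
  coh_scaleA coh_scale1 coh_scaleDr coh_scaleDl.

Definition in_degree (n : nat) (x : coh) :=
  exists2 z : Zcoc, (forall s, size s != n -> z s = 0) & x = cls z.
End Complex.

(* Bilinear, A-balanced bimodule maps B1 x B2 -> B3. *)
Record pairing (B1 B2 B3 : bimod) := Pairing {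
  pair_fun :> B1 -> B2 -> B3;
  pair_linl : forall y, linear (pair_fun^~ y);
  pair_linr : forall x, linear (pair_fun x);
  pair_lact : forall a x y, pair_fun (lact a x) y = lact a (pair_fun x y);
  pair_mid : forall a x y, pair_fun (ract x a) y = pair_fun x (lact a y);
  pair_ract : forall a x y, pair_fun x (ract y a) = ract (pair_fun x y) a
}.

Section Cup.
Variables (B1 B2 B3 : bimod) (p : pairing B1 B2 B3).
Implicit Types (f : seq A -> B1) (g : seq A -> B2).

Lemma pairDl x x' y : p (x + x') y = p x y + p x' y.
Proof. exact: (linear_addE (pair_linl p y)). Qed.
Lemma pairZl c x y : p (c *: x) y = c *: p x y.
Proof. exact: (linear_scaleE (pair_linl p y)). Qed.
Lemma pair0l y : p 0 y = 0.
Proof. exact: (linear_zeroE (pair_linl p y)). Qed.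
Lemma pairDr x y y' : p x (y + y') = p x y + p x y'.
Proof. exact: (linear_addE (pair_linr p x)). Qed.
Lemma pairZr c x y : p x (c *: y) = c *: p x y.
Proof. exact: (linear_scaleE (pair_linr p x)). Qed.
Lemma pair0r x : p x 0 = 0.
Proof. exact: (linear_zeroE (pair_linr p x)). Qed.

(* (f g)(a_1,...,a_(m+n)) = p (f(a_1,...,a_m)) (g(a_(m+1),...,a_(m+n)))
   for f of degree m and g of degree n, extended bilinearly. *)
Definition cup f g (s : seq A) : B3 :=
  \sum_(i < (size s).+1) p (f (take i s)) (g (drop i s)).

Lemma cup_nil f g : cup f g [::] = p (f [::]) (g [::]).
Proof. by rewrite /cup big_ord1. Qed.
Lemma cup_cons f g a t :
  cup f g (a :: t) = p (f [::]) (g (a :: t)) + cup (fun s => f (a :: s)) g t.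
Proof. by rewrite /cup big_ord_recl. Qed.

Lemma cup_lincombl c f f' g : cup (c *: f + f') g = c *: cup f g + cup f' g.
Proof.
apply/funext => s; rewrite lincombE /cup scaler_sumr -big_split.
by apply: eq_bigr => i _ /=; rewrite lincombE pairDl pairZl.
Qed.
Lemma cup_lincombr c f g g' : cup f (c *: g + g') = c *: cup f g + cup f g'.
Proof.
apply/funext => s; rewrite lincombE /cup scaler_sumr -big_split.
by apply: eq_bigr => i _ /=; rewrite lincombE pairDr pairZr.
Qed.
Lemma cup0l g : cup 0 g = 0.
Proof. by apply/funext => s; rewrite /cup big1 // => i _; rewrite pair0l. Qed.
Lemma cup0r f : cup f 0 = 0.
Proof. by apply/funext => s; rewrite /cup big1 // => i _; rewrite pair0r. Qed.

Lemma cupDl f f' g : cup (f + f') g = cup f g + cup f' g.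
Proof. by have := cup_lincombl 1 f f' g; rewrite !scale1r. Qed.
Lemma cupNl f g : cup (- f) g = - cup f g.
Proof.
by have := cup_lincombl (-1) f 0 g; rewrite cup0l !addr0 !scaleN1r.
Qed.
Lemma cup_lact a f g :
  cup (fun s => lact a (f s)) g = (fun s => lact a (cup f g s)).
Proof.
apply/funext => s; rewrite /cup.
rewrite (big_morph (lact a) (lactD a) (linear_zeroE (lact_linr a))).
by apply: eq_bigr => i _; rewrite pair_lact.
Qed.

Definition twist (B : bimod) (f : seq A -> B) (s : seq A) : B :=
  (-1) ^+ size s *: f s.

Lemma diff_cons2 (B : bimod) (f : seq A -> B) a b t :
  diff f (a :: b :: t) =
    lact a (f (b :: t)) - f (a * b :: t) + lact b (f (a :: t))
    - diff (fun s => f (a :: s)) (b :: t).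
Proof.
rewrite /= big_ord_recl /= /merge /= drop0 expr1 scaleN1r.
rewrite !opprD -!addrA; congr (_ + (_ + _)); rewrite [RHS]addNKr.
congr (_ + _); last by rewrite exprS mulN1r scaleNr.
rewrite -sumrN; apply: eq_bigr => i _.
by rewrite add0n /bump leq0n add1n exprS mulN1r scaleNr.
Qed.

Lemma diff_sing (B : bimod) (f : seq A -> B) a :
  diff f [:: a] = lact a (f [::]) - ract (f [::]) a.
Proof. by rewrite /= big_ord0 addr0 expr1 scaleN1r. Qed.

Lemma diff_pairr x (h : seq A -> B2) b t :
  diff (fun s => p x (h s)) (b :: t) =
    p x (diff h (b :: t)) - p x (lact b (h t)) + lact b (p x (h t)).
Proof.
rewrite /= !pairDr pairZr pair_ract.
rewrite (big_morph (p x) (pairDr x) (pair0r x)).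
under [in RHS]eq_bigr => i _ do rewrite pairZr.
by rewrite -[X in X - _]addrA [X in X - _]addrC addrK [RHS]addrC addrA.
Qed.

Lemma leibniz f g : diff (cup f g) = cup (diff f) g + cup (twist f) (diff g).
Proof.
apply/funext => s; elim: s f => [|a [|b t] IH] f.
- by rewrite [RHS](_ : _ = cup (diff f) g [::] + cup (twist f) (diff g) [::]) //
     !cup_nil /= pair0l pair0r addr0.
- rewrite [RHS](_ : _ = cup (diff f) g [:: a] + cup (twist f) (diff g) [:: a]) //.
  rewrite diff_sing !cup_cons !cup_nil !diff_sing /= pair0l pair0r addr0 add0r.
  rewrite /twist expr0 scale1r -!scaleN1r !pairDl !pairDr !pairZl !pairZr.
  rewrite pair_lact pair_mid pair_ract !scaleN1r.
  by rewrite -addrA [_ + (_ - _)]addrA addNr add0r.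
rewrite diff_cons2.
have -> : (fun s => cup f g (a :: s)) =
    (fun s => p (f [::]) (g (a :: s))) + cup (fun s => f (a :: s)) g.
  by apply/funext => s; rewrite cup_cons.
rewrite diffD [X in _ - X](_ : _ = diff (fun s => p (f [::]) (g (a :: s))) (b :: t)
   + diff (cup (fun s => f (a :: s)) g) (b :: t)) // IH diff_pairr.
rewrite [X in _ - (_ + X)](_ : _ = cup (diff (fun s => f (a :: s))) g (b :: t)
   + cup (twist (fun s => f (a :: s))) (diff g) (b :: t)) //.
rewrite [RHS](_ : _ = cup (diff f) g (a :: b :: t)
   + cup (twist f) (diff g) (a :: b :: t)) //.
rewrite ![cup _ _ (a :: _)]cup_cons ![cup _ g (b :: t)]cup_cons.
rewrite [cup _ g (a * b :: t)]cup_cons.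
have -> : (fun s => diff f [:: a, b & s]) =
    (fun s => lact a (f (b :: s))) - (fun s => f (a * b :: s))
    + (fun s => lact b (f (a :: s))) - (fun s => diff (fun s => f (a :: s)) (b :: s)).
  by apply/funext => s; rewrite diff_cons2.
have -> : (fun s => twist f (a :: s)) = - twist (fun s => f (a :: s)).
  by apply/funext => s; rewrite /twist /= exprS mulN1r scaleNr.
have -> : diff f [::] = 0 by [].
have -> : diff (fun s => f (a :: s)) [::] = 0 by [].
have -> : twist f [::] = f [::] by rewrite /twist expr0 scale1r.
rewrite diff_sing !pair0l [diff g _]diff_cons2.
move: (fun s => diff (fun s => f (a :: s)) (b :: s)) => D.
move: (diff (fun s => g (a :: s)) (b :: t)) => e.
rewrite !cupDl !cupNl !cup_lact !lactD.
rewrite -!scaleN1r !pairDl !pairDr !pairZl !pairZr !scaleN1r.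
rewrite pair_lact pair_mid !add0r.
exact: leibniz_zmod.
Qed.

Lemma is_cochain_cup f g : is_cochain f -> is_cochain g -> is_cochain (cup f g).
Proof.
case=> mf [N1 b1] [mg [N2 b2]]; split.
  move=> s1 s2 c x y; rewrite /cup !size_cat /= scaler_sumr -big_split.
  apply: eq_bigr => i _ /=; rewrite !take_cat !drop_cat.
  case: ltnP => [_|le_s1i]; first by rewrite (mg (drop i s1) s2) pairDr pairZr.
  case: (i - size s1)%N => [|j] /=.
    by rewrite (mg [::] s2) pairDr pairZr.
  by rewrite (mf s1 (take j s2)) pairDl pairZl.
exists (N1 + N2)%N => s le_s; rewrite /cup big1 // => i _.
have le_i : (i <= size s)%N by rewrite -ltnS.
have [le1|lt1] := leqP N1 i; first by rewrite b1 ?pair0l // size_takel.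
rewrite b2 ?pair0r // size_drop leq_subRL //.
by apply: leq_trans le_s; rewrite leq_add2r ltnW.
Qed.

Lemma is_cochain_twist (B : bimod) (f : seq A -> B) :
  is_cochain f -> is_cochain (twist f).
Proof.
case=> mf [N bf]; split; last by exists N => s /bf sN; rewrite /twist sN scaler0.
move=> s1 s2 c x y; rewrite /twist !size_cat /= (mf s1 s2) scalerDr !scalerA.
by rewrite (mulrC c).
Qed.

Lemma cocycleP (B : bimod) (z : Zcoc B) : is_cochain z /\ diff z = 0.
Proof. by apply/asboolP; exact: zvalP. Qed.

Fact cup_cocycle (x : Zcoc B1) (y : Zcoc B2) : cup x y \in @cocycle B3.
Proof.
have [cx dx] := cocycleP x; have [cy dy] := cocycleP y.
apply/asboolP; split; first exact: is_cochain_cup.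
by rewrite leibniz dx dy cup0l cup0r addr0.
Qed.
Definition zcup (x : Zcoc B1) (y : Zcoc B2) : Zcoc B3 :=
  MkZcoc (cup_cocycle x y).

Lemma twistK (B : bimod) (f : seq A -> B) : twist (twist f) = f.
Proof. by apply/funext => s; rewrite /twist scalerA -expr2 sqrr_sign scale1r. Qed.

Lemma diff_twist (B : bimod) (f : seq A -> B) : diff f = 0 -> diff (twist f) = 0.
Proof.
move=> df; apply/funext => -[|a t] //.
transitivity ((-1) ^+ size t *: diff f (a :: t)); last by rewrite df [LHS]scaler0.
rewrite /= !scalerDr; congr (_ + _ + _).
- by rewrite lactZ.
- rewrite scaler_sumr; apply: eq_bigr => i _; rewrite /twist.
  rewrite [RHS]scalerA mulrC -scalerA; congr (_ *: (_ *: _)); congr (_ ^+ _).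
  have lti := ltn_ord i.
  rewrite /merge size_cat /= size_drop size_takel /=; last exact: leqW (ltnW _).
  by rewrite -subSn // subSS subnKC // ltnW.
by rewrite /twist size_belast ractZ !scalerA mulrC.
Qed.

Definition hcup (x : coh B1) (y : coh B2) : coh B3 :=
  cls (zcup (repr x) (repr y)).

Lemma hcup_cls x y : hcup (cls x) (cls y) = cls (zcup x y).
Proof.
set x' := repr (cls x); set y' := repr (cls y).
have /asboolP[u cu du] := repr_cls x; have /asboolP[v cv dv] := repr_cls y.
have [cx' dx'] := cocycleP x'; have [cy dy] := cocycleP y.
apply/clsE; apply/asboolP; exists (cup u y + cup (twist x') v).
  rewrite -[cup u y]scale1r; apply: is_cochain_submod.
    exact: is_cochain_cup.
  by apply: is_cochain_cup => //; exact: is_cochain_twist.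
rewrite diffD !leibniz dy diff_twist // cup0r cup0l add0r addr0 twistK -du -dv.
rewrite [RHS](_ : _ = cup (zval x' - zval x) y + cup x' (zval y' - zval y)) //.
rewrite [LHS](_ : _ = cup x' y' - cup x y) //.
have -> : zval y' - zval y = -1 *: zval y + zval y' by rewrite addrC scaleN1r.
rewrite cupDl cupNl cup_lincombr scaleN1r.
by rewrite -addrA [- cup x y + _]addrC addrA [cup x' y + _]addrA subrr add0r.
Qed.

Lemma hcupDl x x' y : hcup (x + x') y = hcup x y + hcup x' y.
Proof.
rewrite -(clsK x) -(clsK x') -(clsK y) -clsD !hcup_cls -clsD; congr cls.
apply: val_inj; exact: cupDl.
Qed.
Lemma hcupDr x y y' : hcup x (y + y') = hcup x y + hcup x y'.
Proof.
rewrite -(clsK x) -(clsK y) -(clsK y') -clsD !hcup_cls -clsD; congr cls.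
apply: val_inj; have := cup_lincombr 1 (repr x) (repr y) (repr y').
by rewrite !scale1r.
Qed.
Lemma hcupZl c x y : hcup (c *: x) y = c *: hcup x y.
Proof.
rewrite -(clsK x) -(clsK y) -[c *: cls _]clsZ !hcup_cls -[c *: cls _]clsZ.
congr cls; apply: val_inj; have := cup_lincombl c (repr x) 0 (repr y).
by rewrite cup0l !addr0.
Qed.
Lemma hcupZr c x y : hcup x (c *: y) = c *: hcup x y.
Proof.
rewrite -(clsK x) -(clsK y) -[c *: cls _]clsZ !hcup_cls -[c *: cls _]clsZ.
congr cls; apply: val_inj; have := cup_lincombr c (repr x) (repr y) 0.
by rewrite cup0r !addr0.
Qed.
End Cup.

Section CupAssoc.
Variables (B1 B2 B3 B12 B23 B : bimod).
Variables (p12 : pairing B1 B2 B12) (p23 : pairing B2 B3 B23).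
Variables (pl : pairing B12 B3 B) (pr : pairing B1 B23 B).
Hypothesis pA : forall x y z, pr x (p23 y z) = pl (p12 x y) z.

Lemma cupA f g h : cup pr f (cup p23 g h) = cup pl (cup p12 f g) h.
Proof.
apply/funext => s; elim: s f => [|a t IH] f; first by rewrite !cup_nil pA.
rewrite cup_cons IH [in RHS]cup_cons cup_nil.
have -> : (fun s => cup p12 f g (a :: s)) =
    (fun s => p12 (f [::]) (g (a :: s))) + cup p12 (fun s => f (a :: s)) g.
  by apply/funext => s; rewrite cup_cons.
rewrite cupDl cup_cons pairDr pA -addrA; congr (_ + (_ + _)).
rewrite /cup (big_morph (pr _) (pairDr pr _) (pair0r pr _)).
by apply: eq_bigr => i _; rewrite pA.
Qed.

Lemma hcupA x y z : hcup pr x (hcup p23 y z) = hcup pl (hcup p12 x y) z.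
Proof.
rewrite -(clsK x) -(clsK y) -(clsK z) !hcup_cls.
congr cls; apply: val_inj; exact: cupA.
Qed.
End CupAssoc.

(* Ext_{A^e}(A, A), with the cup product. *)
Definition regular_bimod : bimod.
Proof.
refine (@Bimod A (fun a m => a * m) (fun m a => m * a) _ _ _ _ _ _ _ _ _).
- by move=> m c x y; rewrite mulrDl scalerAl.
- by move=> a c x y; rewrite mulrDr scalerAr.
- by move=> a c x y; rewrite mulrDl scalerAl.
- by move=> m c x y; rewrite mulrDr scalerAr.
- exact: mul1r.
- by move=> *; rewrite mulrA.
- exact: mulr1.
- by move=> *; rewrite mulrA.
- by move=> *; rewrite mulrA.
Defined.

Definition mul_pairing : pairing regular_bimod regular_bimod regular_bimod.
Proof.
refine (@Pairing regular_bimod regular_bimod regular_bimod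
  (fun x y : A => x * y) _ _ _ _ _).
- by move=> m c x y; rewrite mulrDl scalerAl.
- by move=> a c x y; rewrite mulrDr scalerAr.
- by move=> *; rewrite /= mulrA.
- by move=> *; rewrite /= mulrA.
- by move=> *; rewrite /= mulrA.
Defined.

Definition HH := coh regular_bimod.
HB.instance Definition _ := GRing.Lmodule.on HH.

Definition one_cochain (s : seq A) : regular_bimod := if s is [::] then 1 else 0.

Fact one_cocycle : one_cochain \in @cocycle regular_bimod.
Proof.
apply/asboolP; split.
  split; last by exists 1%N => -[].
  by move=> [|? ?] s2 c x y; rewrite /= scaler0 addr0.
apply/funext => -[|a [|b t]] //.
  by rewrite diff_sing /= mulr1 mul1r subrr.
rewrite diff_cons2 /= !mulr0 mul0r scaler0 subr0 !addr0 add0r.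
by rewrite big1 ?addr0 ?oppr0 // => i _; rewrite scaler0.
Qed.

Definition HH_one : HH := cls (MkZcoc one_cocycle).
Definition HH_mul : HH -> HH -> HH := hcup mul_pairing.

Fact cup_mul1l (f : seq A -> regular_bimod) : cup mul_pairing one_cochain f = f.
Proof.
apply/funext => -[|a t]; first by rewrite cup_nil /= mul1r.
rewrite cup_cons /= mul1r -[RHS]addr0; congr (_ + _).
by have := cup0l mul_pairing f => /(congr1 (fun h => h t)).
Qed.
Fact cup_mul1r (f : seq A -> regular_bimod) : cup mul_pairing f one_cochain = f.
Proof.
apply/funext => s; elim: s f => [|a t IH] f; first by rewrite cup_nil /= mulr1.
by rewrite cup_cons IH /= mulr0 add0r.
Qed.

Fact HH_mulA : associative HH_mul.
Proof. by move=> x y z; apply: hcupA => u v w; exact: mulrA. Qed.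
Fact HH_mul1l : left_id HH_one HH_mul.
Proof.
move=> x; rewrite -(clsK x) /HH_mul hcup_cls.
congr cls; apply: val_inj; exact: cup_mul1l.
Qed.
Fact HH_mul1r : right_id HH_one HH_mul.
Proof.
move=> x; rewrite -(clsK x) /HH_mul hcup_cls.
congr cls; apply: val_inj; exact: cup_mul1r.
Qed.
Fact HH_mulDl : left_distributive HH_mul +%R.
Proof. by move=> x y z; exact: hcupDl. Qed.
Fact HH_mulDr : right_distributive HH_mul +%R.
Proof. by move=> x y z; exact: hcupDr. Qed.
Fact HH_one_neq0 : HH_one != 0.
Proof.
apply/negP => /eqP h; have /clsE/asboolP[u _] : HH_one = cls 0 by rewrite cls0.
move=> /(congr1 (fun f => f [::])) /eqP.
by rewrite (_ : _ == _ = (1 - 0 == 0 :> A)) // subr0 oner_eq0.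
Qed.
HB.instance Definition _ := GRing.Zmodule_isNzRing.Build HH
  HH_mulA HH_mul1l HH_mul1r HH_mulDl HH_mulDr HH_one_neq0.

Fact HH_scalerAl (c : k) (x y : HH) : c *: (x * y) = c *: x * y.
Proof. exact/esym/hcupZl. Qed.
HB.instance Definition _ := GRing.Lmodule_isLalgebra.Build k HH HH_scalerAl.
Fact HH_scalerAr (c : k) (x y : HH) : c *: (x * y) = x * (c *: y).
Proof. exact/esym/hcupZr. Qed.
HB.instance Definition _ := GRing.Lalgebra_isAlgebra.Build k HH HH_scalerAr.

(* Finitely generated left A-modules, i.e. finite dimensional vector spaces
   with a left A-action. *)
Record fgMod := FgMod {
  fgMod_sort :> vectType k;
  act : A -> 'End(fgMod_sort);
  act_linear : linear act;
  act1 : act 1 = \1%VF;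
  actM : forall a b, act (a * b) = (act a \o act b)%VF
}.

Definition is_hom (M N : fgMod) (f : 'Hom(M, N)) :=
  forall a m, f (act M a m) = act N a (f m).

Definition is_submod (M : fgMod) (U : {vspace M}) :=
  forall a m, m \in U -> act M a m \in U.

Definition regular_mod : fgMod :=
  @FgMod A (@amull k A) (@amull_is_linear k A) (@amull1 k A) (@amullM k A).

(* Hom_{A^e}(Bar(A), Hom_k(M, N)) = Hom_A(Bar(A) (x)_A M, N), and
   Bar(A) (x)_A M is the bar resolution of M by free A-modules; hence the
   cohomology of this complex is Ext_A(M, N). *)
Definition hom_bimod (M N : fgMod) : bimod.
Proof.
refine (@Bimod 'Hom(M, N) (fun a f => act N a \o f)%VF
  (fun f a => f \o act M a)%VF _ _ _ _ _ _ _ _ _).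
- by move=> f c x y; rewrite act_linear comp_lfunDl comp_lfunZl.
- by move=> a c x y; rewrite comp_lfunDr comp_lfunZr.
- by move=> a c x y; rewrite comp_lfunDl comp_lfunZl.
- by move=> f c x y; rewrite act_linear comp_lfunDr comp_lfunZr.
- by move=> f; rewrite act1 comp_lfun1l.
- by move=> a b f; rewrite actM comp_lfunA.
- by move=> f; rewrite act1 comp_lfun1r.
- by move=> a b f; rewrite actM comp_lfunA.
- by move=> a b f; rewrite comp_lfunA.
Defined.

Definition Ext (M N : fgMod) := coh (hom_bimod M N).
HB.instance Definition _ M N := GRing.Lmodule.on (Ext M N).

Definition comp_pairing (L M N : fgMod) :
  pairing (hom_bimod M N) (hom_bimod L M) (hom_bimod L N).
Proof.
refine (@Pairing (hom_bimod M N) (hom_bimod L M) (hom_bimod L N)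
  (fun (f : 'Hom(M, N)) (g : 'Hom(L, M)) => f \o g)%VF _ _ _ _ _).
- by move=> f c x y; rewrite comp_lfunDl comp_lfunZl.
- by move=> f c x y; rewrite comp_lfunDr comp_lfunZr.
- by move=> *; rewrite /= comp_lfunA.
- by move=> *; rewrite /= comp_lfunA.
- by move=> *; rewrite /= comp_lfunA.
Defined.

(* The Yoneda product, which on bar cochains is given by
   (a_1,...,a_(m+n)) |-> f(a_1,...,a_m) \o g(a_(m+1),...,a_(m+n)). *)
Definition yoneda (L M N : fgMod) : Ext M N -> Ext L M -> Ext L N :=
  hcup (comp_pairing L M N).

Section Tensor.
Variable M : fgMod.

Definition tensor_cochain (f : seq A -> regular_bimod) (s : seq A) :
  hom_bimod M M := act M (f s).

Lemma tensor_lincomb c f g :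
  tensor_cochain (c *: f + g) = c *: tensor_cochain f + tensor_cochain g.
Proof. by apply/funext => s; exact: act_linear. Qed.

Lemma is_cochain_tensor f : is_cochain f -> is_cochain (tensor_cochain f).
Proof.
case=> mf [N bf]; split.
  move=> s1 s2 c x y; rewrite /tensor_cochain (mf s1 s2).
  exact: (@act_linear M).
exists N => s /bf sN; rewrite /tensor_cochain sN.
exact: (linear_zeroE (@act_linear M)).
Qed.

Lemma diff_tensor f : diff (tensor_cochain f) = tensor_cochain (diff f).
Proof.
apply/funext => -[|a t].
  exact/esym/(linear_zeroE (@act_linear M)).
have actD := linear_addE (@act_linear M).
rewrite /tensor_cochain /= !actD (linear_scaleE (@act_linear M)) !actM.
congr (_ + _ + _).
rewrite (big_morph _ actD (linear_zeroE (@act_linear M))).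
by apply: eq_bigr => i _; rewrite (linear_scaleE (@act_linear M)).
Qed.

Fact tensor_cocycle (z : Zcoc regular_bimod) :
  tensor_cochain z \in @cocycle (hom_bimod M M).
Proof.
have [cz dz] := cocycleP z; apply/asboolP; split; first exact: is_cochain_tensor.
rewrite diff_tensor dz; apply/funext => s.
exact: (linear_zeroE (@act_linear M)).
Qed.
Definition ztensor z := MkZcoc (tensor_cocycle z).

(* The ring homomorphism HH -> Ext(M, M) induced by - (x)_A M: under the
   identification above, f (x)_A M sends (a_1,...,a_n) to m |-> f(a_1,...,a_n) m. *)
Definition tensor (x : HH) : Ext M M := cls (ztensor (repr x)).

Lemma tensor_cls z : tensor (cls z : HH) = cls (ztensor z).
Proof.
have /asboolP[u cu du] := repr_cls z; apply/clsE/asboolP.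
exists (tensor_cochain u); first exact: is_cochain_tensor.
rewrite diff_tensor -du; apply/funext => s.
have actZ := linear_scaleE (@act_linear M); have actD := linear_addE (@act_linear M).
rewrite /tensor_cochain (_ : (zval (_ - _)) s = zval (repr (cls z)) s + -1 *: z s).
  by rewrite actD actZ scaleN1r.
by rewrite scaleN1r.
Qed.

Lemma tensorM x y : tensor (x * y) = yoneda (tensor x) (tensor y).
Proof.
rewrite -(clsK x) -(clsK y) [_ * _](hcup_cls mul_pairing) !tensor_cls.
rewrite [RHS]hcup_cls; congr cls; apply: val_inj; apply/funext => s.
rewrite /= /tensor_cochain /cup.
rewrite (big_morph _ (linear_addE (@act_linear M)) (linear_zeroE (@act_linear M))).
by apply: eq_bigr => i _; rewrite actM.
Qed.
End Tensor.

(* For non-commuting x and y this is a right action, see Ext_actM. *)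
Definition Ext_act (M N : fgMod) (x : HH) (e : Ext M N) : Ext M N :=
  yoneda e (tensor M x).

Lemma Ext_actM M N (x y : HH) (e : Ext M N) :
  Ext_act (x * y) e = Ext_act y (Ext_act x e).
Proof.
rewrite /Ext_act tensorM; apply: hcupA => u v w; exact: comp_lfunA.
Qed.
End Cohomology.

Local Open Scope classical_set_scope.

(* Ideals of a subring S of a ring R, as subsets of R. *)
Section Ideals.
Variable R : nzRingType.
Implicit Types S I : set R.

Definition left_ideal S I :=
  [/\ I `<=` S, I 0, (forall x y, I x -> I y -> I (x + y)) &
      (forall a x, S a -> I x -> I (a * x))].

Definition maximal_left_ideal S I :=
  [/\ left_ideal S I, I <> S &
      forall J, left_ideal S J -> I `<=` J -> J = I \/ J = S].

Definition jacobson_radical S : set R :=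
  [set x | S x /\ forall I, maximal_left_ideal S I -> I x].

Definition commutative_on S := forall x y, S x -> S y -> x * y = y * x.

(* For commutative S. *)
Definition noetherian S := forall I, left_ideal S I ->
  exists s : seq R, [set` s] `<=` I /\
    forall x, I x -> exists2 c : nat -> R, (forall i, S (c i)) &
      x = \sum_(i < size s) c i * s`_i.

Definition prime_ideal S (p : set R) :=
  [/\ left_ideal S p, p <> S &
      forall x y, S x -> S y -> p (x * y) -> p x \/ p y].

(* S/I has Krull dimension d; the prime ideals of S/I are the p/I for p a
   prime ideal of S containing I. *)
Definition prime_chain S I (n : nat) (p : nat -> set R) :=
  (forall i, (i <= n)%N -> prime_ideal S (p i) /\ I `<=` p i) /\
  (forall i, (i < n)%N -> p i `<=` p i.+1 /\ p i <> p i.+1).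
Definition krull_dim_quotient S I (d : nat) :=
  (exists p, prime_chain S I d p) /\
  (forall n p, prime_chain S I n p -> (n <= d)%N).
End Ideals.

Section Submodules.
Variables (k : fieldType) (V : vectType k).

Lemma linear_set_vspace (P : set V) :
  P 0 -> (forall c x y, P x -> P y -> P (c *: x + y)) ->
  exists U : {vspace V}, forall v, v \in U <-> P v.
Proof.
move=> P0 Plin.
pose Q n := `[< exists U : {vspace V},
                 (forall v, v \in U -> P v) /\ \dim U = n >].
have exQ : exists n, Q n.
  exists 0%N; apply/asboolP; exists 0%VS; split; last exact: dimv0.
  by move=> v; rewrite memv0 => /eqP->.
have leQ n : Q n -> (n <= dim V)%N.
  by move=> /asboolP[U [_ <-]]; rewrite -dimvf dimvS ?subvf.
have [n /asboolP[U [UP dU]] maxn] := ex_maxnP exQ leQ.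
exists U => v; split; first exact: UP.
move=> Pv; have /maxn : Q (\dim (U + <[v]>)%VS).
  apply/asboolP; exists (U + <[v]>)%VS; split=> // w /memv_addP[u Uu [x]].
  case/vlineP=> c -> ->; rewrite addrC; apply: Plin => //; exact: UP.
rewrite -dU => le_dim; have /eqP-> : U == (U + <[v]>)%VS.
  by rewrite eqEdim addvSl le_dim.
exact: (subvP (addvSr U <[v]>) _ (memv_line v)).
Qed.
End Submodules.

Section Quotient.
Variables (k : fieldType) (A : falgType k) (M : fgMod A) (U : {vspace M}).
Hypothesis subU : is_submod U.

(* M/U, carried by the complement U^C of U. *)
Definition quo_proj : 'Hom(M, subvs_of U^C%VS) :=
  (linfun (vsproj U^C) \o daddv_pi U^C U)%VF.
Definition quo_lift : 'Hom(subvs_of U^C%VS, M) := linfun vsval.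
Definition quo_act (a : A) : 'End(subvs_of U^C%VS) :=
  (quo_proj \o act M a \o quo_lift)%VF.

Lemma capCv : (U^C :&: U)%VS = 0%VS.
Proof. by rewrite capvC capv_compl. Qed.
Lemma quo_proj_val m : vsval (quo_proj m) = daddv_pi U^C U m.
Proof. by rewrite comp_lfunE lfunE /= vsprojK // memv_pi. Qed.
Lemma quo_projK : (quo_proj \o quo_lift)%VF = \1%VF.
Proof.
apply/lfunP => x; rewrite comp_lfunE id_lfunE; apply: val_inj.
by rewrite [LHS]quo_proj_val lfunE /= daddv_pi_id ?capCv ?subvsP.
Qed.
Lemma quo_proj_eq0 m : m \in U -> quo_proj m = 0.
Proof.
move=> Um; apply: val_inj; rewrite [LHS]quo_proj_val; apply/eqP.
rewrite -[_ == _]memv0 -capCv memv_cap memv_pi /=.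
have {1}-> : daddv_pi U^C U m = m - daddv_pi U U^C m.
  rewrite -{2}[m](@daddv_pi_add _ _ U^C U m) ?addrK ?capCv //.
  by rewrite addvC addv_complf memvf.
by rewrite rpredB // memv_pi.
Qed.
Lemma quo_liftK m : m - quo_lift (quo_proj m) \in U.
Proof.
rewrite [quo_lift _]lfunE /= quo_proj_val.
rewrite -{1}[m](@daddv_pi_add _ _ U^C U m) ?capCv //; last first.
  by rewrite addvC addv_complf memvf.
by rewrite addrC addKr memv_pi.
Qed.

Fact quo_act_linear : linear quo_act.
Proof.
move=> c a b; apply/lfunP => x; rewrite /quo_act act_linear.
by rewrite comp_lfunDr comp_lfunDl comp_lfunZl comp_lfunZr.
Qed.
Fact quo_act1 : quo_act 1 = \1%VF.
Proof. by rewrite /quo_act act1 comp_lfun1r quo_projK. Qed.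
Fact quo_actM a b : quo_act (a * b) = (quo_act a \o quo_act b)%VF.
Proof.
apply/lfunP => x; rewrite /quo_act actM 4!comp_lfunE [RHS]comp_lfunE.
rewrite [quo_act b x]comp_lfunE comp_lfunE.
set m := act M b _; apply/eqP; rewrite -subr_eq0 -!linearB /=; apply/eqP.
by rewrite [X in quo_lift X]comp_lfunE; apply/quo_proj_eq0/subU/quo_liftK.
Qed.
Definition quo_mod : fgMod A := FgMod quo_act_linear quo_act1 quo_actM.
End Quotient.

Section Algebra.
Variables (k : fieldType) (A : falgType k).

Definition indecomposable_algebra :=
  forall I J : {vspace A},
    (fullv * I <= I)%VS -> (I * fullv <= I)%VS ->
    (fullv * J <= J)%VS -> (J * fullv <= J)%VS ->
    (I + J = fullv)%VS -> (I :&: J = 0)%VS -> I = 0%VS \/ J = 0%VS.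

Fact jacobson_linear c (x y : A) :
  jacobson_radical setT x -> jacobson_radical setT y ->
  jacobson_radical setT (c *: x + y).
Proof.
move=> [_ Jx] [_ Jy]; split=> // I maxI; have [[_ _ ID IM] _ _] := maxI.
apply: ID; last exact: Jy.
by rewrite -[x]mul1r scalerAl; apply: IM => //; exact: Jx.
Qed.
Fact jacobson0 : jacobson_radical setT (0 : A).
Proof. by split=> // I [[]]. Qed.

(* The Jacobson radical of A as a subspace, see mem_radA. *)
Definition radA : {vspace A} :=
  projT1 (cid (linear_set_vspace jacobson0 jacobson_linear)).
Lemma mem_radA a : a \in radA <-> jacobson_radical setT a.
Proof. exact: (projT2 (cid (linear_set_vspace jacobson0 jacobson_linear))). Qed.

Fact radA_submod : is_submod (radA : {vspace regular_mod A}).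
Proof.
move=> a m /mem_radA [_ Jm]; apply/mem_radA; rewrite lfunE /=; split=> // I maxI.
by have [[_ _ _ IM] _ _] := maxI; apply: IM => //; exact: Jm.
Qed.

Definition top_mod : fgMod A := quo_mod radA_submod.

(* Projectivity and injectivity in the category of finitely generated modules. *)
Definition projective (P : fgMod A) :=
  forall (X Y : fgMod A) (g : 'Hom(X, Y)) (f : 'Hom(P, Y)),
    is_hom g -> limg g = fullv -> is_hom f ->
    exists2 h : 'Hom(P, X), is_hom h & (g \o h)%VF = f.
Definition injective_mod (E : fgMod A) :=
  forall (X Y : fgMod A) (g : 'Hom(X, Y)) (f : 'Hom(X, E)),
    is_hom g -> lker g = 0%VS -> is_hom f ->
    exists2 h : 'Hom(Y, E), is_hom h & (h \o g)%VF = f.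

Definition projective_resolution (M : fgMod A) (P : nat -> fgMod A)
    (d : forall n, 'Hom(P n.+1, P n)) (e : 'Hom(P 0%N, M)) :=
  [/\ forall n, projective (P n), is_hom e, forall n, is_hom (d n),
      limg e = fullv & limg (d 0%N) = lker e /\
      forall n, limg (d n.+1) = lker (d n)].

Definition injective_resolution (M : fgMod A) (E : nat -> fgMod A)
    (d : forall n, 'Hom(E n, E n.+1)) (e : 'Hom(M, E 0%N)) :=
  [/\ forall n, injective_mod (E n), is_hom e, forall n, is_hom (d n),
      lker e = 0%VS & limg e = lker (d 0%N) /\
      forall n, limg (d n) = lker (d n.+1)].

Definition finite_projective_dimension (M : fgMod A) :=
  exists P d e, @projective_resolution M P d e /\
    exists n, forall i, (n < i)%N -> dim (P i) = 0%N.
Definition finite_injective_dimension (M : fgMod A) :=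
  exists E d e, @injective_resolution M E d e /\
    exists n, forall i, (n < i)%N -> dim (E i) = 0%N.

Definition superfluous (P : fgMod A) (K : {vspace P}) :=
  forall U : {vspace P}, is_submod U -> (U + K)%VS = fullv -> U = fullv.

Definition minimal_projective_resolution (M : fgMod A) (Q : nat -> fgMod A)
    (d : forall n, 'Hom(Q n.+1, Q n)) (e : 'Hom(Q 0%N, M)) :=
  [/\ projective_resolution d e, superfluous (lker e) &
      forall n, superfluous (lker (d n))].

(* u n <= a n^(b-1) for some real a and all large n; for b = 0 this forces the
   integers u n to vanish eventually. *)
Definition growth_le (R : realType) (u : nat -> nat) (b : nat) :=
  exists (a : R) (N : nat), forall n, (N <= n)%N ->
    (u n)%:R <= a * n%:R ^ (b%:Z - 1).

Definition complexity_eq (R : realType) (M : fgMod A) (c : nat) :=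
  exists Q d e, @minimal_projective_resolution M Q d e /\
    growth_le R (fun n => dim (Q n)) c /\
    forall b, growth_le R (fun n => dim (Q n)) b -> (c <= b)%N.

End Algebra.

(* The second conjunct is about A as a right module over itself. *)
Definition gorenstein (k : fieldType) (A : falgType k) :=
  finite_injective_dimension (regular_mod A) /\
  finite_injective_dimension (regular_mod (A^c)%type).

Section Varieties.
Variables (k : fieldType) (A : falgType k) (H : set (HH A)).

Definition graded_subalgebra :=
  [/\ H 1, forall (c : k) x y, H x -> H y -> H (c *: x + y),
      forall x y, H x -> H y -> H (x * y) &
      forall x, H x -> exists (n : nat) (y : nat -> HH A),
        (forall i, H (y i) /\ in_degree i (y i)) /\ x = \sum_(i < n) y i].

Definition Ext_finitely_generated (M N : fgMod A) :=
  exists s : seq (Ext M N), forall e, exists2 c : nat -> HH A,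
    (forall i, H (c i)) & e = \sum_(i < size s) Ext_act (c i) s`_i.

Definition annihilator (M N : fgMod A) : set (HH A) :=
  [set h | H h /\ forall e : Ext M N, Ext_act h e = 0].

(* H is assumed commutative, so its left ideals are its ideals. *)
Definition variety (M : fgMod A) : set (set (HH A)) :=
  [set m | maximal_left_ideal H m /\ annihilator M (top_mod A) `<=` m].

Definition variety_dim_eq (M : fgMod A) (d : nat) :=
  if dim M == 0%N then d = 0%N
  else krull_dim_quotient H (annihilator M (top_mod A)) d.

Definition H_deg0 : set (HH A) := [set x | H x /\ in_degree 0 x].
Definition H_pos : set (HH A) :=
  [set x | exists (n : nat) (y : nat -> HH A),
    (forall i, H (y i) /\ in_degree i.+1 (y i)) /\ x = \sum_(i < n) y i].

Definition m_gr : set (HH A) :=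
  [set x | exists y z, [/\ jacobson_radical H_deg0 y, H_pos z & x = y + z]].

Definition trivial_variety (M : fgMod A) := variety M `<=` [set m_gr].
End Varieties.

(* Main.v *)
(** Cohomology is computed on homogeneous bar cochains, and dimensions are only
    ever bounded by counting generators modulo a subspace, or independent
    elements modulo a subspace.

    By induction on the length, Ext(M, N) is a finitely generated H-module for
    all M and N. Let I be the annihilator of Ext(M, A/r) in H. Noetherian
    induction on graded ideals containing I produces an integer d, a chain of
    primes of length d above I, and a bound of order n^(d-1) on the dimension of
    the degree n part of H/I, hence of Ext^n(M, A/r), hence (Nakayama) of the
    n-th term of a minimal projective resolution of M. Conversely a chain of m
    not necessarily homogeneous primes forces the part of H/I of degree at most
    n to grow like n^m, because multiplication by an element of the next prime
    embeds H/p in itself; H/I embeds in a power of Ext(M, A/r), which gives (c).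

    Ext is a module over H from both sides and the two actions agree up to a
    unit on homogeneous elements. If M has finite projective or finite injective
    dimension then Ext^n(M, M) = 0 for large n, so the elements of large degree
    of H kill Ext(M, -) and Ext(-, M), which are finitely generated and therefore
    vanish in large degrees: both dimensions of M are finite. Applied to A and to
    Hom_k(A, k) this gives (a). If x is homogeneous of positive degree and not
    nilpotent modulo I, a maximal ideal containing I and 1 - x is a point of the
    variety of M other than m_gr. *)
From HB Require Import structures.
From mathcomp Require Import all_boot all_order all_algebra all_field.
From mathcomp Require Import boolp classical_sets functions reals.
Require Import Defs.

Set Implicit Arguments.
Unset Strict Implicit.
Unset Printing Implicit Defensive.

Import GRing.Theory.
Local Open Scope ring_scope.
Local Open Scope classical_set_scope.

(** * Growth of sequences of natural numbers *)

(** The primes that define Krull dimension need not be homogeneous, so the size of graded pieces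
    does not bound the length of a chain directly. Hence [H] is measured in two ways: by exact
    degree, which suits graded ideals and Ext, and by degree at most [n], which still makes sense
    modulo an arbitrary prime. Summing over degrees raises the exponent by one; this is the shift
    between [d] and [d - 1] in the definition of complexity. No dimension is ever computed exactly:
    one induction yields a chain of length [d] together with growth [d], and the two one-sided
    estimates then force equality.

    The bar resolution is far from minimal, so Ext is never read off from it. Every statement is
    moved along k-split short exact sequences, with coinduced modules as acyclic objects in the
    second variable and projective covers in the first. The same dimension shift compares the two
    actions of Hochschild cohomology. Only the vanishing of a product matters there, so the unit
    between the two sides is kept existential. *)

Definition growth (u : nat -> nat) (d : nat) :=
  exists a N : nat, forall n, (N <= n)%N -> (u n * n <= a * n ^ d)%N.

Lemma growth_le_trans u v d :
  (exists N, forall n, (N <= n)%N -> (u n <= v n)%N) -> growth v d -> growth u d.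
Proof.
move=> [N1 le1] [a [N leN]]; exists a, (maxn N1 N) => n; rewrite geq_max => /andP[h1 h2].
by apply: leq_trans (leN _ h2); rewrite leq_mul2r le1 ?orbT.
Qed.

Lemma growth_weaken u d e : (d <= e)%N -> growth u d -> growth u e.
Proof.
move=> le_de [a [N leN]]; exists a, N.+1 => n lt_n.
apply: leq_trans (leN _ (ltnW lt_n)) _; rewrite leq_mul2l leq_pexp2l ?orbT //.
exact: leq_trans lt_n.
Qed.

Lemma growth_add u v d : growth u d -> growth v d -> growth (fun n => u n + v n)%N d.
Proof.
move=> [a [N leN]] [b [N' leN']]; exists (a + b)%N, (maxn N N') => n.
by rewrite geq_max => /andP[/leN h /leN' h']; rewrite !mulnDl leq_add.
Qed.

Lemma growth_scale c u d : growth u d -> growth (fun n => c * u n)%N d.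
Proof.
by move=> [a [N leN]]; exists (c * a)%N, N => n /leN h; rewrite -!mulnA leq_mul2l h orbT.
Qed.

(** The factor [n] on the left of [growth] stands for the exponent [d - 1] and avoids a negative
    power at [d = 0]: there [u n * n] is bounded, so [u n] vanishes once [n] exceeds the bound. *)
Lemma growth0P u : growth u 0 <-> exists N, forall n, (N <= n)%N -> u n = 0%N.
Proof.
split=> [[a [N leN]]|[N u0]]; last by exists 0%N, N => n /u0 ->.
exists (maxn N a.+1) => n; rewrite geq_max => /andP[/leN + lt_an].
rewrite expn0 muln1; case: (u n) => // x; rewrite mulSn => le.
by have := leq_trans (leq_addr _ _) le; rewrite leqNgt lt_an.
Qed.

Lemma growthS u d : growth u d.+1 <->
  exists a N, forall n, (N <= n)%N -> (u n <= a * n ^ d)%N.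
Proof.
split=> -[a [N leN]]; exists a, N.+1 => n ltn.
  have n0 : (0 < n)%N by apply: leq_trans ltn.
  by rewrite -(leq_pmul2r n0) -mulnA -expnSr leN // ltnW.
by rewrite expnSr mulnA leq_mul2r leN ?orbT // ltnW.
Qed.

Lemma leq_expn2r m n e : (m <= n)%N -> (m ^ e <= n ^ e)%N.
Proof. by case: e => [|e] // le; rewrite leq_exp2r. Qed.

Lemma growth_shift u d s : growth u d -> growth (fun n => u (n - s)%N) d.
Proof.
case: d => [|d].
  by move=> /growth0P[N u0]; apply/growth0P; exists (N + s)%N => n le; rewrite u0 // leq_subRL //
    ?(leq_trans _ le) ?leq_addl // addnC.
move=> /growthS[a [N leN]]; apply/growthS; exists a, (N + s)%N => n le.
apply: leq_trans (leN _ _) _; first by rewrite leq_subRL ?(leq_trans _ le) ?leq_addl // addnC.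
by rewrite leq_mul2l leq_expn2r ?orbT // leq_subr.
Qed.

Lemma prefix_bound (u : nat -> nat) N : exists C, forall n, (n < N)%N -> (u n <= C)%N.
Proof.
exists (\sum_(i < N) u i)%N => n lt_n.
by rewrite (bigD1 (Ordinal lt_n)) //= leq_addr.
Qed.

(** The increment of the power [d + 1] dominates the power [d]; this closes the induction of
    [growth_incr]. *)
Lemma expn_incr n d : (n ^ d.+1 + n ^ d <= n.+1 ^ d.+1)%N.
Proof.
by rewrite expnS (expnS n.+1) addnC -mulSn leq_mul2l leq_expn2r ?orbT.
Qed.

Lemma growth_incr (w v : nat -> nat) e d : (0 < e)%N ->
  (exists N, forall n, (N <= n)%N -> (w n <= w (n - e) + v n)%N) -> growth v d ->
  exists C, forall n, (w n <= C * n.+1 ^ d)%N.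
Proof.
move=> e0 [N leN]; case: d => [/growth0P[N' v0]|d /growthS[a [N' leN']]].
  have [C leC] := prefix_bound w (maxn (maxn N N') e); exists C => n; rewrite expn0 muln1.
  have [m] := ubnP n; elim: m n => // m IH n le_n.
  have [/leC //|] := ltnP n (maxn (maxn N N') e); rewrite !geq_max => /andP[/andP[h1 h2] h3].
  apply: leq_trans (leN _ h1) _; rewrite v0 // addn0; apply: IH.
  have lt : (n - e < n)%N by rewrite ltn_subrL e0 (leq_trans e0).
  exact: leq_trans lt le_n.
(* [C] handles the initial values and [a] the increments; their sum serves both parts of the
   induction. *)
have [C leC] := prefix_bound w (maxn (maxn N N') e); exists (C + a)%N => n.
have [m] := ubnP n; elim: m n => // m IH n le_n.
have [/leC h|] := ltnP n (maxn (maxn N N') e).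
  by apply: leq_trans h _; rewrite -[X in (X <= _)%N]muln1 leq_mul ?leq_addr ?expn_gt0.
rewrite !geq_max => /andP[/andP[h1 h2] h3].
have n0 : (0 < n)%N by apply: leq_trans h3.
apply: leq_trans (leN _ h1) _.
apply: leq_trans (_ : (C + a) * n ^ d.+1 + (C + a) * n ^ d <= _)%N; last first.
  by rewrite -mulnDr leq_mul2l expn_incr orbT.
apply: leq_add.
  have lt : (n - e < n)%N by rewrite ltn_subrL e0 n0.
  apply: leq_trans (IH _ (leq_trans lt le_n)) _.
  by rewrite leq_mul2l leq_expn2r ?orbT.
by apply: leq_trans (leN' _ h2) _; rewrite leq_mul2r leq_addl orbT.
Qed.

Lemma growth_of_bound u C d : (forall n, (u n <= C * n.+1 ^ d)%N) -> growth u d.+1.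
Proof.
move=> le; apply/growthS; exists (C * 2 ^ d)%N, 1%N => n n0.
apply: leq_trans (le n) _; rewrite -mulnA -expnMn leq_mul2l leq_expn2r ?orbT //.
by rewrite mul2n -addnn -addn1 leq_add2l.
Qed.

Lemma poly_degree_le C s m b :
  (forall n, (n ^ m <= C * (n + s).+1 ^ b)%N) -> (m <= b)%N.
Proof.
move=> le; rewrite leqNgt; apply/negP => lt_bm.
(* If [b < m], the bound [(n + s).+1 <= s.+2 * n] turns the hypothesis into [n <= C * s.+2 ^ b],
   which this [n] violates. *)
pose n := (C * s.+2 ^ b).+1.
have : (n ^ b.+1 <= n ^ m)%N by rewrite leq_pexp2l.
move/leq_trans/(_ (le n)).
have le2 : ((n + s).+1 <= s.+2 * n)%N.
  by rewrite -addnS mulSn leq_add2l leq_pmulr.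
move=> le3; have := leq_trans le3 (leq_mul (leqnn C) (leq_expn2r b le2)).
rewrite expnMn mulnA expnS leq_pmul2r ?expn_gt0 //.
by rewrite /n ltnn.
Qed.

(** * Spanning and independence modulo a subspace *)

Section Spans.
Variable k : fieldType.

Definition subspace (L : lmodType k) (V : set L) :=
  V 0 /\ forall c x y, V x -> V y -> V (c *: x + y).

(** This says that (V + W)/W has dimension at most [t], and [independent] that it has dimension at
    least [t]; [W] need not lie in [V]. Families are indexed by all of [nat] so that they can be cut
    and concatenated freely. *)
Definition spanned (L : lmodType k) (V W : set L) (t : nat) :=
  exists s : nat -> L, (forall i, V (s i)) /\
    forall v, V v -> exists c : nat -> k, W (v - \sum_(i < t) c i *: s i).

Definition independent (L : lmodType k) (V W : set L) (t : nat) :=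
  exists s : nat -> L, (forall i, V (s i)) /\
    forall c : nat -> k, W (\sum_(i < t) c i *: s i) ->
      forall i, (i < t)%N -> c i = 0.

Section Subspace.
Variables (L : lmodType k) (V : set L).
Hypothesis sV : subspace V.

Lemma subspaceZ c x : V x -> V (c *: x).
Proof. by move=> Vx; rewrite -[_ *: _]addr0; apply sV.2 => //; exact sV.1. Qed.
Lemma subspaceD x y : V x -> V y -> V (x + y).
Proof. by move=> Vx Vy; rewrite -[x]scale1r; exact: sV.2. Qed.
Lemma subspaceB x y : V x -> V y -> V (x - y).
Proof. by move=> Vx Vy; rewrite addrC -scaleN1r; exact: sV.2. Qed.
Lemma subspace_sum n (F : nat -> L) :
  (forall i, (i < n)%N -> V (F i)) -> V (\sum_(i < n) F i).
Proof.
elim: n => [|n IH] VF; first by rewrite big_ord0; exact sV.1.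
rewrite big_ord_recr /=; apply: subspaceD; last exact: VF.
by apply: IH => i lti; apply: VF; exact: ltnW.
Qed.
Lemma subspace_lin n (c : nat -> k) (F : nat -> L) :
  (forall i, V (F i)) -> V (\sum_(i < n) c i *: F i).
Proof. by move=> VF; apply: (@subspace_sum n (fun i => c i *: F i)) => i _; exact: subspaceZ. Qed.
End Subspace.

Lemma spanned_leq (L : lmodType k) (V W : set L) s t :
  (s <= t)%N -> spanned V W s -> spanned V W t.
Proof.
move=> le_st [f [Vf sp]]; exists f; split=> // v /sp[c Wc].
exists (fun i => if (i < s)%N then c i else 0).
have -> : \sum_(i < t) (if (i < s)%N then c i else 0) *: f i = \sum_(i < s) c i *: f i.
  rewrite (big_ord_widen _ (fun i => c i *: f i) le_st) [RHS]big_mkcond.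
  by apply: eq_bigr => i _; case: ifP => //; rewrite scale0r.
by [].
Qed.

Lemma spanned0P (L : lmodType k) (V W : set L) :
  V 0 -> spanned V W 0 <-> V `<=` W.
Proof.
move=> V0; split=> [[s [_ sp]] v /sp[c]|VW]; first by rewrite big_ord0 subr0.
by exists (fun=> 0); split=> // v /VW Wv; exists (fun=> 0); rewrite big_ord0 subr0.
Qed.

Lemma big_cat_ord (U : zmodType) s t (f g : nat -> U) :
  \sum_(i < s + t) (if (i < s)%N then f i else g (i - s)%N) =
  \sum_(i < s) f i + \sum_(i < t) g i.
Proof.
rewrite big_split_ord; congr (_ + _); apply: eq_bigr => i _ /=.
  by rewrite ltn_ord.
by rewrite ltnNge leq_addr /= addKn.
Qed.

(* Subadditivity along V2/W2 -> V/W -> V/W1 -> 0. *)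
Lemma spanned_ext (L L2 : lmodType k) (V W W1 : set L) (V2 W2 : set L2)
    (f : L2 -> L) s t :
  linear f -> subspace V -> subspace W -> spanned V W1 s -> spanned V2 W2 t ->
  (forall v, V v -> W1 v -> exists2 y, V2 y & W (v - f y)) ->
  (forall y, W2 y -> W (f y)) -> (forall y, V2 y -> V (f y)) ->
  spanned V W (s + t).
Proof.
move=> lf sV sW [p [Vp sp]] [q [Vq sq]] lift fW fV.
exists (fun i => if (i < s)%N then p i else f (q (i - s)%N)).
split=> [i|v Vv]; first by case: ifP => _; [exact: Vp|exact: fV].
have [c W1c] := sp _ Vv.
have Vc : V (v - \sum_(i < s) c i *: p i) by apply: (subspaceB sV) => //; exact: (subspace_lin sV).
have [y Vy Wy] := lift _ Vc W1c; have [d W2d] := sq _ Vy.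
exists (fun i => if (i < s)%N then c i else d (i - s)%N).
have -> : \sum_(i < s + t) (if (i < s)%N then c i else d (i - s)%N) *:
     (if (i < s)%N then p i else f (q (i - s)%N)) =
   \sum_(i < s) c i *: p i + \sum_(i < t) d i *: f (q i).
  rewrite -(@big_cat_ord _ s t (fun i => c i *: p i) (fun i => d i *: f (q i))).
  by apply: eq_bigr => i _; case: ifP.
have fsum : f (\sum_(i < t) d i *: q i) = \sum_(i < t) d i *: f (q i).
  rewrite (big_morph f (linear_addE lf) (linear_zeroE lf)).
  by apply: eq_bigr => i _; rewrite (linear_scaleE lf).
have := subspaceD sW Wy (fW _ W2d).
have -> : f (y - \sum_(i < t) d i *: q i) = f y - \sum_(i < t) d i *: f (q i).
  by rewrite -fsum addrC -scaleN1r lf scaleN1r addrC.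
by rewrite subrKA opprD addrA.
Qed.

Lemma spanned_vspace (L : vectType k) (V : set L) :
  subspace V -> spanned V [set 0] (dim L).
Proof.
move=> sV; have [U UV] := linear_set_vspace sV.1 sV.2.
apply: (@spanned_leq _ _ _ (\dim U)); first by rewrite -dimvf dimvS ?subvf.
exists (fun i => (vbasis U)`_i); split=> [i|v /UV Uv].
  apply/UV; have [lt|le] := ltnP i (size (vbasis U)); first exact/vbasis_mem/mem_nth.
  by rewrite nth_default // mem0v.
exists (fun i => if insub i is Some j then coord (vbasis U) j v else 0) => /=.
rewrite {1}(coord_vbasis Uv) -sumrB big1 // => i _.
by rewrite valK subrr.
Qed.

Lemma spanned_image (L L' : lmodType k) (V W : set L) (V' W' : set L') (f : L -> L') t :
  linear f -> (forall v, V v -> V' (f v)) -> (forall v, W v -> W' (f v)) ->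
  (forall v, V' v -> exists2 u, V u & W' (v - f u)) -> subspace W' ->
  spanned V W t -> spanned V' W' t.
Proof.
move=> lf fV fW onto sW' [s [Vs sp]]; exists (f \o s); split=> [i|v /onto[u Vu Wu]].
  exact/fV/Vs.
have [c Wc] := sp _ Vu; exists c; have := subspaceD sW' Wu (fW _ Wc).
have -> : f (u - \sum_(i < t) c i *: s i) = f u - \sum_(i < t) c i *: f (s i).
  rewrite addrC -scaleN1r lf scaleN1r addrC; congr (_ - _).
  rewrite (big_morph f (linear_addE lf) (linear_zeroE lf)).
  by apply: eq_bigr => i _; rewrite (linear_scaleE lf).
by rewrite subrKA.
Qed.

(** Steinitz exchange modulo [W]: if [t < s], the matrix expressing the independent vectors by the
    generators has more rows than columns, and a nonzero row of its kernel is a relation. *)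
Lemma independent_leq_spanned (L : lmodType k) (V W : set L) s t :
  subspace W -> independent V W s -> spanned V W t -> (s <= t)%N.
Proof.
move=> sW [p [Vp ind]] [q [Vq sp]]; rewrite leqNgt; apply/negP => lt_ts.
have /choice[c Wc] : forall i, exists c : nat -> k, W (p i - \sum_(j < t) c j *: q j).
  by move=> i; apply: sp.
pose C : 'M[k]_(s, t) := \matrix_(i, j) c i j.
have nz : kermx C != 0.
  rewrite -mxrank_eq0 mxrank_ker subn_eq0 -ltnNge.
  exact: leq_ltn_trans (rank_leq_col C) lt_ts.
have [i nzi] : exists i, row i (kermx C) != 0.
  apply/existsP; rewrite -negb_forall; apply: contra nz => /forallP h.
  by apply/eqP/row_matrixP => i; rewrite row0; exact/eqP.
set u := row i (kermx C) in nzi.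
have uC : u *m C = 0 by apply/sub_kermxP; exact: row_sub.
pose e (j : nat) : k := if insub j is Some j' then u 0 j' else 0.
have We : W (\sum_(j < s) e j *: p j).
  have -> : \sum_(j < s) e j *: p j = \sum_(j < s) e j *: (p j - \sum_(l < t) c j l *: q l).
    apply/eqP; rewrite -subr_eq0 -sumrB; apply/eqP.
    under eq_bigr => j _ do rewrite scalerBr opprB addrCA subrr addr0 scaler_sumr.
    rewrite exchange_big big1 // => l _.
    under eq_bigr => j _ do rewrite scalerA.
    rewrite -scaler_suml (_ : \sum_(j < s) _ = (u *m C) 0 l); last first.
      by rewrite [RHS]mxE; apply: eq_bigr => j _; rewrite /e valK [C j l]mxE.
    by rewrite uC mxE scale0r.
  apply: (@subspace_sum _ _ sW s (fun j => e j *: (p j - \sum_(l < t) c j l *: q l))).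
  by move=> j _; apply: (subspaceZ sW).
move/negP: nzi; apply; apply/eqP/rowP => j; rewrite [RHS]mxE.
by have := ind _ We j (ltn_ord j); rewrite /e valK.
Qed.

(** Filter [V] by the vectors that are, modulo [W], sums of images from the first [j] spaces. Each
    layer is covered by one [f j], so [spanned_ext] applies once per layer. *)
Lemma spanned_family (L : lmodType k) (L2 : nat -> lmodType k) (V W : set L)
    (V2 W2 : forall i, set (L2 i)) (f : forall i, L2 i -> L) (t : nat -> nat) r :
  (forall i, linear (f i)) -> subspace V -> subspace W -> (forall i, subspace (V2 i)) ->
  (forall i, (i < r)%N -> spanned (V2 i) (W2 i) (t i)) ->
  (forall v, V v -> exists c : forall i, L2 i, (forall i, V2 i (c i)) /\
    W (v - \sum_(i < r) f i (c i))) ->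
  (forall i, (i < r)%N -> forall y, W2 i y -> W (f i y)) ->
  (forall i, (i < r)%N -> forall y, V2 i y -> V (f i y)) ->
  spanned V W (\sum_(i < r) t i).
Proof.
move=> lf sV sW sV2 sp lift fW fV.
pose Wj j := [set v | exists c : forall i, L2 i, (forall i, V2 i (c i)) /\
    W (v - \sum_(i < j) f i (c i))].
have sWj j : subspace (Wj j).
  split.
    exists (fun i => 0); split; first by move=> i; exact: (sV2 i).1.
    by rewrite big1 ?subr0 => [|i _]; [exact sW.1|rewrite linear_zeroE].
  move=> c x y [p [Vp Wp]] [q [Vq Wq]]; exists (fun i => c *: p i + q i); split.
    by move=> i; exact: (sV2 i).2.
  have := sW.2 c _ _ Wp Wq; congr W; rewrite scalerBr scaler_sumr.
  under [in RHS]eq_bigr => i _ do rewrite lf.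
  by rewrite big_split /= opprD addrACA.
have W0E : Wj 0%N = W.
  apply/seteqP; split=> v; first by case=> c [_]; rewrite big_ord0 subr0.
  move=> Wv; exists (fun i => 0); rewrite big_ord0 subr0; split=> // i; exact: (sV2 i).1.
have WWj j v : W v -> Wj j v.
  move=> Wv; exists (fun i => 0); split; first by move=> i; exact: (sV2 i).1.
  by rewrite big1 ?subr0 // => i _; rewrite linear_zeroE.
have step j : (j <= r)%N -> forall s, spanned V (Wj j) s ->
    spanned V (Wj 0%N) (s + \sum_(i < j) t i).
  elim: j => [|j IH] le_j s spj; first by rewrite big_ord0 addn0.
  rewrite big_ord_recr /= [X in (s + X)%N]addnC addnA; apply: IH; first exact: ltnW.
  apply: (@spanned_ext _ _ V (Wj j) (Wj j.+1) (V2 j) (W2 j) (f j)) => //.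
  - exact: sp.
  - move=> v Vv [c [Vc Wc]]; exists (c j) => //; exists c; split=> //.
    by move: Wc; rewrite big_ord_recr /= opprD [- _ - _]addrC addrA.
  - by move=> y /(fW _ le_j)/WWj.
  - exact: fV.
rewrite -W0E -[X in spanned _ _ X]add0n; apply: step => //.
apply/spanned0P; first exact: sV.1.
by move=> v /lift.
Qed.

(** Superadditivity, the counterpart of [spanned_ext]: a relation modulo [W], read modulo the larger
    [W1], loses its first [s] coefficients; the others vanish because [f] is injective modulo
    [W]. *)
Lemma independent_cat (L L2 : lmodType k) (V W W1 : set L) (V2 W2 : set L2)
    (f : L2 -> L) s t :
  linear f -> subspace V -> subspace W1 -> W `<=` W1 ->
  independent V W1 s -> independent V2 W2 t ->
  (forall y, V2 y -> V (f y)) -> (forall y, V2 y -> W1 (f y)) ->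
  (forall y, V2 y -> W (f y) -> W2 y) -> subspace V2 ->
  independent V W (s + t).
Proof.
move=> lf sV sW1 WW1 [p [Vp ip]] [q [Vq iq]] fV fW1 fW sV2.
exists (fun i => if (i < s)%N then p i else f (q (i - s)%N)).
split=> [i|c Wc]; first by case: ifP => _; [exact: Vp|exact/fV/Vq].
have cE : \sum_(i < s + t) c i *: (if (i < s)%N then p i else f (q (i - s)%N)) =
   \sum_(i < s) c i *: p i + f (\sum_(i < t) c (s + i)%N *: q i).
  rewrite (big_morph f (linear_addE lf) (linear_zeroE lf)).
  rewrite big_split_ord; congr (_ + _); apply: eq_bigr => i _ /=.
    by rewrite ltn_ord.
  by rewrite ltnNge leq_addr /= addKn (linear_scaleE lf).
rewrite cE in Wc.
have V2q : V2 (\sum_(i < t) c (s + i)%N *: q i).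
  exact: (@subspace_lin _ _ sV2 t (fun i => c (s + i)%N) q Vq).
have c0 i : (i < s)%N -> c i = 0.
  apply: ip; rewrite -[X in W1 X](addrK (f (\sum_(i < t) c (s + i)%N *: q i))).
  by apply: (subspaceB sW1); [exact: WW1|exact: fW1].
move=> i; have [lt _|le lti] := ltnP i s; first exact: c0.
rewrite -(subnKC le); apply: (iq (fun i => c (s + i)%N)); last by rewrite ltn_subLR.
apply: fW => //; move: Wc; rewrite big1 ?add0r // => j _.
by rewrite c0 ?scale0r.
Qed.

Lemma independent_mono (L : lmodType k) (V W W1 : set L) s :
  W `<=` W1 -> independent V W1 s -> independent V W s.
Proof. by move=> le [p [Vp ip]]; exists p; split=> // c /le/ip. Qed.
End Spans.

(** * Gradings and maximal ideals *)

Record grading (k : fieldType) (L : lmodType k) := Grading {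
  gpr :> nat -> L -> L;
  gpr_lin : forall n, linear (gpr n);
  gprK : forall m n x, gpr m (gpr n x) = if m == n then gpr n x else 0;
  gpr_sum : forall x, exists N, x = \sum_(i < N) gpr i x /\
    forall i, (N <= i)%N -> gpr i x = 0
}.

Section Grading.
Variables (k : fieldType) (L : lmodType k) (G : grading L).

Definition deg n : set L := [set x | G n x = x].

Lemma gpr0 n : G n 0 = 0.
Proof. exact: linear_zeroE (gpr_lin G n). Qed.
Lemma gprD n x y : G n (x + y) = G n x + G n y.
Proof. exact: linear_addE (gpr_lin G n) x y. Qed.
Lemma gprN n x : G n (- x) = - G n x.
Proof. by rewrite -scaleN1r (linear_scaleE (gpr_lin G n)) scaleN1r. Qed.
Lemma gprB n x y : G n (x - y) = G n x - G n y.
Proof. by rewrite gprD gprN. Qed.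
Lemma gpr_big n I (r : seq I) P (F : I -> L) :
  G n (\sum_(i <- r | P i) F i) = \sum_(i <- r | P i) G n (F i).
Proof. exact: (big_morph _ (gprD n) (gpr0 n)). Qed.

Lemma deg_gpr n x : deg n (G n x).
Proof. by rewrite /deg /= gprK eqxx. Qed.
Lemma deg_subspace n : subspace (deg n).
Proof.
split; first exact: gpr0.
by move=> c x y dx dy; rewrite /deg /= gpr_lin dx dy.
Qed.
Lemma gpr_deg m n x : deg n x -> G m x = if m == n then x else 0.
Proof. by move=> dx; rewrite -{1}dx gprK dx. Qed.

Lemma gpr_sum_ge x : exists N, forall M, (N <= M)%N -> x = \sum_(i < M) G i x.
Proof.
have [N [xE x0]] := gpr_sum G x; exists N => M le.
rewrite {1}xE (big_ord_widen _ (fun i => G i x) le) big_mkcond /=.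
by apply: eq_bigr => i _; case: ltnP => // /x0 ->.
Qed.

(** A non-homogeneous element respects this filtration by degree, up to a shift, but not the
    grading. *)
Definition Filt (V : set L) n : set L :=
  [set x | V x /\ forall i, (n < i)%N -> G i x = 0].

Lemma Filt_subspace V n : subspace V -> subspace (Filt V n).
Proof.
move=> sV; split; first by split; [exact sV.1|move=> i _; rewrite gpr0].
move=> c x y [Vx x0] [Vy y0]; split; first exact: sV.2.
by move=> i lti; rewrite gpr_lin x0 // y0 // scaler0 addr0.
Qed.

Lemma Filt_ex V x : V x -> exists n, forall m, (n <= m)%N -> Filt V m x.
Proof.
move=> Vx; have [N [_ x0]] := gpr_sum G x; exists N => m le; split=> // i lt.
by apply: x0; exact: leq_trans (ltnW lt).
Qed.

End Grading.

Section GradedBilinear.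
Variables (k : fieldType) (L1 L2 L3 : lmodType k).
Variables (G1 : grading L1) (G2 : grading L2) (G3 : grading L3).
Variable b : L1 -> L2 -> L3.
Hypotheses (bl : forall y, linear (b^~ y)) (br : forall x, linear (b x)).
Hypothesis bdeg : forall m n x y, deg G1 m x -> deg G2 n y -> deg G3 (m + n) (b x y).

Lemma bil0l y : b 0 y = 0. Proof. exact: linear_zeroE (bl y). Qed.
Lemma bil0r x : b x 0 = 0. Proof. exact: linear_zeroE (br x). Qed.

Lemma gpr_bil n x y : G3 n (b x y) = \sum_(i < n.+1) b (G1 i x) (G2 (n - i)%N y).
Proof.
have [N1 xE] := gpr_sum_ge G1 x; have [N2 yE] := gpr_sum_ge G2 y.
(* One range long enough for the expansions of [x] and [y] and for the sum on the right. *)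
pose N := (maxn n.+1 (maxn N1 N2)).
have le1 : (n.+1 <= N)%N by rewrite leq_maxl.
rewrite {1}(xE N) ?leq_max ?leqnn ?orbT //.
rewrite (big_morph (b^~ y) (linear_addE (bl y)) (bil0l y)) gpr_big.
rewrite (big_ord_widen _ (fun i => b (G1 i x) (G2 (n - i)%N y)) le1) [RHS]big_mkcond /=.
apply: eq_bigr => i _.
rewrite {1}(yE N) ?leq_max ?leqnn ?orbT //.
rewrite (big_morph (b _) (linear_addE (br _)) (bil0r _)) gpr_big.
have E (j : 'I_N) : G3 n (b (G1 i x) (G2 j y)) =
    if n == (i + j)%N then b (G1 i x) (G2 j y) else 0.
  by apply: gpr_deg; apply: bdeg; exact: deg_gpr.
under eq_bigr => j _ do rewrite E.
rewrite -big_mkcond /=; case: ltnP => [le|lt].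
  have ltN : (n - i < N)%N by apply: leq_ltn_trans (leq_subr _ _) _.
  rewrite (big_pred1 (Ordinal ltN)) // => j /=.
  by rewrite -val_eqE /= -[RHS](eqn_add2l i) subnKC // eq_sym.
rewrite big_pred0 // => j; apply/negP => /eqP nE.
by move: lt; rewrite nE ltnNge leq_addr.
Qed.

Lemma gpr_bil_deg m n x y : deg G1 m x ->
  G3 n (b x y) = if (m <= n)%N then b x (G2 (n - m)%N y) else 0.
Proof.
move=> dx; rewrite gpr_bil; case: leqP => [le|lt].
  have lt : (m < n.+1)%N by [].
  rewrite (bigD1 (Ordinal lt)) //= dx big1 ?addr0 // => i ne.
  by rewrite (gpr_deg _ dx) (_ : (_ == m) = false) ?bil0l //; apply: negbTE.
rewrite big1 // => i _; rewrite (gpr_deg _ dx).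
by rewrite ltn_eqF ?bil0l //; exact: leq_trans (ltn_ord i) lt.
Qed.

Lemma Filt_bil V2 V3 m n x y : Filt G1 V2 m x -> Filt G2 V3 n y ->
  Filt G3 setT (m + n) (b x y).
Proof.
move=> [_ x0] [_ y0]; split=> // i lt; rewrite gpr_bil big1 // => j _.
have [lej|ltj] := leqP j m; last by rewrite x0 ?bil0l.
rewrite y0 ?bil0r // ltn_subRL; apply: leq_ltn_trans lt.
by rewrite leq_add2r.
Qed.
End GradedBilinear.

Section MaximalIdeals.
Variables (R : nzRingType) (S : set R).
Hypotheses (S1 : S 1) (S0 : S 0).
Hypothesis SD : forall x y, S x -> S y -> S (x + y).
Hypothesis SM : forall x y, S x -> S y -> S (x * y).

Lemma ideal_proper I : left_ideal S I -> I <> S <-> ~ I 1.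
Proof.
case=> IS I0 ID IM; split=> [ne I1|n1 IE]; last by apply: n1; rewrite IE.
by apply: ne; apply/seteqP; split=> // x Sx; rewrite -[x]mulr1; exact: IM.
Qed.

Lemma exists_maximal_ideal I : left_ideal S I -> ~ I 1 ->
  exists m, maximal_left_ideal S m /\ I `<=` m.
Proof.
move=> idI nI1.
pose T := {J : set R | [/\ left_ideal S J, I `<=` J & ~ J 1]}.
pose leT (J K : T) := `[< sval J `<=` sval K >].
have [||||[m [idm Im m1]] mmax] := @Zorn T leT.
- by move=> J; apply/asboolP.
- by move=> J K M /asboolP h1 /asboolP h2; apply/asboolP => x /h1 /h2.
- move=> [J PJ] [K PK] /asboolP h1 /asboolP h2.
  have E : J = K by apply/seteqP; split; [exact: h1|exact: h2].
  by subst K; congr exist; exact: Prop_irrelevance.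
(* The empty chain is bounded by [I] itself, a nonempty one by its union. *)
- move=> C totC; have [[J0 CJ0]|C0] := pselect (exists J, C J); last first.
    exists (exist _ I (And3 idI (@subset_refl _ I) nI1)) => J CJ.
    by case: C0; exists J.
  pose U := [set x | exists2 J, C J & sval J x].
  have PU : [/\ left_ideal S U, I `<=` U & ~ U 1].
    split.
    - split.
      + by move=> x [[J [[JS _ _ _] ? ?]] _ /= Jx]; exact: JS.
      + by exists J0 => //; case: (proj2_sig J0) => -[].
      + move=> x y [J CJ Jx] [K CK Ky]; have [/asboolP JK|/asboolP KJ] := totC _ _ CJ CK.
          exists K => //; case: (proj2_sig K) => -[_ _ KD _] _ _; apply: KD => //; exact: JK.
        exists J => //; case: (proj2_sig J) => -[_ _ JD _] _ _; apply: JD => //; exact: KJ.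
      + move=> a x Sa [J CJ Jx]; exists J => //.
        by case: (proj2_sig J) => -[_ _ _ JM] _ _; exact: JM.
    - by move=> x Ix; exists J0 => //; case: (proj2_sig J0) => _ + _; apply.
    - by case=> J _ J1; case: (proj2_sig J).
  by exists (exist _ U PU) => J CJ; apply/asboolP => x Jx; exists J.
exists m; split=> //; split=> // [|J idJ mJ]; first exact/ideal_proper.
have [J1|nJ1] := pselect (J 1).
  right; apply: contrapT => /(ideal_proper idJ); exact.
left; have PJ : [/\ left_ideal S J, I `<=` J & ~ J 1] by split=> //; exact: subset_trans mJ.
exact: (congr1 (@sval _ _) (mmax (exist _ J PJ) (asboolT mJ))).
Qed.

Hypothesis SC : commutative_on S.

Definition ideal_add (I : set R) (x : R) : set R :=
  [set z | exists2 a, S a & I (z - a * x)].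

Lemma ideal_add_ideal I x : left_ideal S I -> S x -> left_ideal S (ideal_add I x).
Proof.
move=> [IS I0 ID IM] Sx; split.
- by move=> z [a Sa /IS Sz]; rewrite -(subrK (a * x) z); apply: SD => //; exact: SM.
- by exists 0 => //; rewrite mul0r subr0.
- move=> y z [a Sa Ia] [b Sb Ib]; exists (a + b); first exact: SD.
  by rewrite mulrDl opprD addrACA; exact: ID.
- move=> c z Sc [a Sa Ia]; exists (c * a); first exact: SM.
  by rewrite -mulrA -mulrBr; exact: IM.
Qed.
Lemma sub_ideal_add I x : S 0 -> I `<=` ideal_add I x.
Proof. by move=> Sz z Iz; exists 0 => //; rewrite mul0r subr0. Qed.
Lemma mem_ideal_add I x : left_ideal S I -> ideal_add I x x.
Proof. by case=> _ I0 _ _; exists 1; rewrite // mul1r subrr. Qed.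

(** If [x] is not in [m], then [1 - a * x] is in [m] for some [a], and [x ^+ n = x ^+ n * (1 - a *
    x) + a * x ^+ n.+1] lowers the exponent down to 0, contradicting that [m] is proper. *)
Lemma maximal_ideal_pow m x n :
  maximal_left_ideal S m -> S x -> m (x ^+ n) -> m x.
Proof.
case=> idm nm maxm Sx; have [mS m0 mD mM] := idm.
have m1 : ~ m 1 by apply/ideal_proper.
apply: contraPP => nmx.
have [E|E] := maxm _ (ideal_add_ideal idm Sx) (@sub_ideal_add m x S0).
  by exfalso; apply: nmx; rewrite -E; exact: mem_ideal_add.
have : ideal_add m x 1 by rewrite E.
case=> a Sa ma.
have SX j : S (x ^+ j) by elim: j => // j IH; rewrite exprS; exact: SM.
elim: n => [|n IH] // mx; apply: IH.
have -> : x ^+ n = x ^+ n * (1 - a * x) + a * x ^+ n.+1.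
  rewrite mulrBr mulr1 mulrA exprSr mulrA -(SC Sa (SX n)).
  by rewrite subrK.
by apply: mD; apply: mM.
Qed.
End MaximalIdeals.

(** * Noetherian modules *)

Section Noetherian.
Variables (R : nzRingType) (S : set R).
Hypotheses (S1 : S 1) (S0 : S 0) (SN1 : S (-1)).
Hypothesis SD : forall x y, S x -> S y -> S (x + y).
Hypothesis SM : forall x y, S x -> S y -> S (x * y).
Hypothesis SC : commutative_on S.
Hypothesis noethS : noetherian S.

Lemma ideal_sum I n (F : nat -> R) :
  left_ideal S I -> (forall i, (i < n)%N -> I (F i)) -> I (\sum_(i < n) F i).
Proof.
case=> _ I0 ID _; elim: n => [|n IH] IF; first by rewrite big_ord0.
rewrite big_ord_recr /=; apply: ID; last exact: IF.
by apply: IH => i lti; apply: IF; exact: ltnW.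
Qed.

(** A counterexample would start a strictly increasing sequence of counterexamples. The union is
    finitely generated, all generators appear at some stage [N], and the step after [N] cannot be
    strict. *)
Lemma noetherian_ind (P : set R -> Prop) :
  (forall I, left_ideal S I ->
     (forall J, left_ideal S J -> I `<=` J -> I <> J -> P J) -> P I) ->
  forall I, left_ideal S I -> P I.
Proof.
move=> ind I0 id0; apply: contrapT => nP0.
pose T := {J : set R | left_ideal S J /\ ~ P J}.
have next (J : T) : exists K : T, sval J `<=` sval K /\ sval J <> sval K.
  case: J => J [idJ nPJ] /=; apply: contrapT => nK; apply: nPJ; apply: ind => // K idK JK ne.
  by apply: contrapT => nPK; apply: nK; exists (exist _ K (conj idK nPK)).
have [f fP] := choice next.
pose J n := sval (iter n f (exist _ I0 (conj id0 nP0))).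
have idJ n : left_ideal S (J n) by have [] := proj2_sig (iter n f (exist _ I0 (conj id0 nP0))).
have incr m n : (m <= n)%N -> J m `<=` J n.
  move=> /subnK <-; elim: (n - m)%N => //= l IH x /IH Jx; rewrite addSn /J iterS.
  have [h _] := fP (iter (l + m) f (exist _ I0 (conj id0 nP0))); exact: h.
pose U := [set x | exists n, J n x].
have idU : left_ideal S U.
  split.
  - by move=> x [n Jx]; have [h _ _ _] := idJ n; exact: h.
  - by exists 0%N; case: (idJ 0%N).
  - move=> x y [m Jx] [n Jy]; exists (maxn m n); case: (idJ (maxn m n)) => _ _ D _.
    by apply: D; [apply: (incr m) => //; exact: leq_maxl|apply: (incr n) => //; exact: leq_maxr].
  - by move=> a x Sa [n Jx]; exists n; case: (idJ n) => _ _ _; apply.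
have [s [sU gen]] := noethS idU.
have [N sN] : exists N, forall x, x \in s -> J N x.
  have : forall x, x \in s -> U x by move=> x xs; exact: sU.
  elim: (s) => [|x t IH] tU; first by exists 0%N.
  have [N tN] : exists N, forall y, y \in t -> J N y.
    by apply: IH => y yt; apply: tU; rewrite inE yt orbT.
  have [n Jx] : U x by apply: tU; rewrite inE eqxx.
  exists (maxn n N) => y; rewrite inE => /orP[/eqP ->|/tN Jy].
    by apply: incr Jx; exact: leq_maxl.
  by apply: incr Jy; exact: leq_maxr.
have [JS ne] := fP (iter N f (exist _ I0 (conj id0 nP0))).
apply: ne; apply/seteqP; split=> // x Jx.
have [c Sc ->] : exists2 c : nat -> R, (forall i, S (c i)) & x = \sum_(i < size s) c i * s`_i.
  by apply: gen; exists N.+1; rewrite /J iterS.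
apply: (@ideal_sum (J N) (size s) (fun i => c i * s`_i)) => // i lt.
by case: (idJ N) => _ _ _; apply=> //; apply: sN; exact: mem_nth.
Qed.

Section Modules.
Variables (E : zmodType) (act : R -> E -> E).
Hypotheses (actDr : forall x e f, act x (e + f) = act x e + act x f)
  (actDl : forall x y e, act (x + y) e = act x e + act y e)
  (act1 : forall e, act 1 e = e)
  (actM : forall x y e, act (x * y) e = act y (act x e)).

Lemma act0l e : act 0 e = 0.
Proof. by apply: (addrI (act 0 e)); rewrite -actDl !addr0. Qed.
Lemma act0r x : act x 0 = 0.
Proof. by apply: (addrI (act x 0)); rewrite -actDr !addr0. Qed.
Lemma act_sumr x n (F : nat -> E) : act x (\sum_(i < n) F i) = \sum_(i < n) act x (F i).
Proof. exact: (big_morph _ (actDr x) (act0r x)). Qed.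
Lemma act_suml e n (F : nat -> R) : act (\sum_(i < n) F i) e = \sum_(i < n) act (F i) e.
Proof. exact: (big_morph (act^~ e) (fun x y => actDl x y e) (act0l e)). Qed.
Lemma actN1 e : act (-1) e = - e.
Proof. by apply: (addrI e); rewrite -[X in X + act _ _]act1 -actDl !subrr act0l. Qed.

Lemma actN x e : act (- x) e = - act x e.
Proof. by apply: (addrI (act x e)); rewrite -actDl !subrr act0l. Qed.

Definition submodule (N : set E) :=
  [/\ N 0, forall x y, N x -> N y -> N (x + y) & forall a x, S a -> N x -> N (act a x)].

Definition generated (N : set E) (t : nat) (e : nat -> E) :=
  forall x, N x -> exists c : nat -> R, (forall i, S (c i)) /\ x = \sum_(i < t) act (c i) (e i).

Lemma submodule_sum N n (F : nat -> E) :
  submodule N -> (forall i, (i < n)%N -> N (F i)) -> N (\sum_(i < n) F i).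
Proof.
case=> N0 ND _; elim: n => [|n IH] NF; first by rewrite big_ord0.
rewrite big_ord_recr /=; apply: ND; last exact: NF.
by apply: IH => i lti; apply: NF; exact: ltnW.
Qed.

(** Induction on the number of generators: the last coefficients of elements of [N] form an ideal,
    finitely generated by hypothesis; after subtracting lifts of its generators, an element of [N]
    involves only the first [r] generators. *)
Lemma submodule_generated r e N : submodule N -> generated N r e ->
  exists t f, (forall i, N (f i)) /\ generated N t f.
Proof.
elim: r N => [|r IH] N subN genN.
  exists 0%N, (fun=> 0); have [N0 _ _] := subN; split=> // x /genN[c [Sc ->]].
  by exists c; rewrite !big_ord0.
have [N0 ND NM] := subN.
pose N' := [set x | N x /\ exists c : nat -> R, (forall i, S (c i)) /\
   x = \sum_(i < r) act (c i) (e i)].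
pose I := [set h | S h /\ exists x, N x /\ exists c : nat -> R, (forall i, S (c i)) /\
   x = \sum_(i < r) act (c i) (e i) + act h (e r)].
have idI : left_ideal S I.
  split.
  - by move=> x [].
  - split=> //; exists 0; split=> //; exists (fun=> 0); split=> //.
    by rewrite big1 ?act0l ?addr0 // => i _; rewrite act0l.
  - move=> h h' [Sh [x [Nx [c [Sc xE]]]]] [Sh' [x' [Nx' [c' [Sc' xE']]]]].
    split; first exact: SD.
    exists (x + x'); split; first exact: ND.
    exists (fun i => c i + c' i); split; first by move=> i; exact: SD.
    rewrite xE xE' actDl addrACA -big_split; congr (_ + _).
    by apply: eq_bigr => i _; rewrite actDl.
  - move=> a h Sa [Sh [x [Nx [c [Sc xE]]]]]; split; first exact: SM.
    exists (act a x); split; first exact: NM.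
    exists (fun i => c i * a); split; first by move=> i; exact: SM.
    rewrite xE actDr (SC Sa Sh) actM (@act_sumr a r (fun i => act (c i) (e i))).
    by congr (_ + _); apply: eq_bigr => i _; rewrite actM.
have [s [sI gen]] := noethS idI.
have /choice[p pP] : forall j, exists x, N x /\ exists c : nat -> R, (forall i, S (c i)) /\
   x = \sum_(i < r) act (c i) (e i) + act s`_j (e r).
  move=> j; have [lt|le] := ltnP j (size s).
    by have /sI[_] : [set` s] s`_j by rewrite /= mem_nth.
  by rewrite nth_default //; case: idI => _ [] _.
have subN' : submodule N'.
  split.
  - split=> //; exists (fun=> 0); split=> //; rewrite big1 // => i _; exact: act0l.
  - move=> x y [Nx [c [Sc xE]]] [Ny [d [Sd yE]]]; split; first exact: ND.
    exists (fun i => c i + d i); split; first by move=> i; exact: SD.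
    by rewrite xE yE -big_split; apply: eq_bigr => i _; rewrite actDl.
  - move=> a x Sa [Nx [c [Sc xE]]]; split; first exact: NM.
    exists (fun i => c i * a); split; first by move=> i; exact: SM.
    rewrite xE (@act_sumr a r (fun i => act (c i) (e i))).
    by apply: eq_bigr => i _; rewrite actM.
have [|t [f [N'f genf]]] := IH N' subN'; first by move=> x [].
exists (size s + t)%N, (fun i => if (i < size s)%N then p i else f (i - size s)%N).
split=> [i|x Nx].
  by case: ifP => _; [have [] := pP i|have [] := N'f (i - size s)%N].
have [c [Sc xE]] := genN _ Nx.
have Ic : I (c r).
  split; first exact: Sc.
  by exists x; split=> //; exists c; split=> //; rewrite xE big_ord_recr.
have [d Sd cE] := gen _ Ic.
have [c' [Sc' pE]] : exists c' : nat -> nat -> R, (forall j i, S (c' j i)) /\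
   forall j, p j = \sum_(i < r) act (c' j i) (e i) + act s`_j (e r).
  have /choice[c' c'P] : forall j, exists c : nat -> R, (forall i, S (c i)) /\
    p j = \sum_(i < r) act (c i) (e i) + act s`_j (e r) by move=> j; case: (pP j).
  by exists c'; split=> j; case: (c'P j).
pose y := \sum_(j < size s) act (d j) (p j).
have Sopp h : S h -> S (- h) by move=> Sh; rewrite -mulN1r; exact: SM.
have Ssum n (F : nat -> R) : (forall i, S (F i)) -> S (\sum_(i < n) F i).
  move=> SF; elim: n => [|n IHn]; rewrite ?big_ord0 // big_ord_recr /=; exact: SD.
have Sc'' i : S (c i - \sum_(j < size s) c' j i * d j).
  apply: SD => //; apply: Sopp; apply: (@Ssum _ (fun j => c' j i * d j)) => j; exact: SM.
have N'xy : N' (x - y).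
  split.
    rewrite -actN1; apply: (ND) => //; apply: (NM) => //.
    apply: (@submodule_sum N (size s) (fun j => act (d j) (p j)) subN) => j _.
    by have [Np _] := pP j; exact: NM.
  exists (fun i => c i - \sum_(j < size s) c' j i * d j); split=> //.
  under eq_bigr => i _ do rewrite actDl.
  rewrite big_split /= {1}xE big_ord_recr /= -addrA; congr (_ + _).
  rewrite cE (@act_suml (e r) (size s) (fun j => d j * s`_j)).
  rewrite /y; under [X in _ - X]eq_bigr => j _ do rewrite pE actDr -actM.
  rewrite big_split /= opprD addrCA.
  (* [actM] composes in reverse order, so the last coefficients of [x] and [y] match only after
     swapping factors in the commutative [S]. *)
  have -> : \sum_(i < size s) act (d i * s`_i) (e r) = \sum_(i < size s) act (s`_i * d i) (e r).
    apply: eq_bigr => i _; rewrite SC //.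
    by have /sI[] : [set` s] s`_i by rewrite /= mem_nth.
  rewrite subrr addr0.
  have -> : \sum_(j < size s) act (d j) (\sum_(i < r) act (c' j i) (e i)) =
      \sum_(i < r) act (\sum_(j < size s) c' j i * d j) (e i).
    under [RHS]eq_bigr => i _ do rewrite (@act_suml (e i) (size s) (fun j => c' j i * d j)).
    rewrite exchange_big; apply: eq_bigr => j _.
    rewrite (@act_sumr (d j) r (fun i => act (c' j i) (e i))).
    by apply: eq_bigr => i _; rewrite actM.
  by rewrite -sumrN; apply: eq_bigr => i _; rewrite actN.
have [g [Sg xyE]] := genf _ N'xy.
exists (fun i => if (i < size s)%N then d i else g (i - size s)%N); split.
  by move=> i; case: ifP.
rewrite -(subrK y x) addrC xyE /y.
rewrite -(@big_cat_ord _ (size s) t (fun j => act (d j) (p j)) (fun i => act (g i) (f i))).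
by apply: eq_bigr => i _; case: ifP.
Qed.
End Modules.

Section Exact.
Variables (E1 E2 E3 : zmodType).
Variables (a1 : R -> E1 -> E1) (a2 : R -> E2 -> E2) (a3 : R -> E3 -> E3).
Hypotheses (a1Dr : forall x e f, a1 x (e + f) = a1 x e + a1 x f).
Hypotheses (a2Dr : forall x e f, a2 x (e + f) = a2 x e + a2 x f)
  (a2Dl : forall x y e, a2 (x + y) e = a2 x e + a2 y e).
Hypotheses (a3Dr : forall x e f, a3 x (e + f) = a3 x e + a3 x f)
  (a3Dl : forall x y e, a3 (x + y) e = a3 x e + a3 y e)
  (a31 : forall e, a3 1 e = e)
  (a3M : forall x y e, a3 (x * y) e = a3 y (a3 x e)).
Variables (f : E1 -> E2) (g : E2 -> E3).
Hypotheses (fD : {morph f : x y / x + y}) (gD : {morph g : x y / x + y}).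
Hypotheses (fa : forall x e, f (a1 x e) = a2 x (f e)) (ga : forall x e, g (a2 x e) = a3 x (g e)).
Hypothesis exact_fg : forall e, g e = 0 -> exists y, e = f y.

(** The image of [g] is a submodule of a finitely generated module, hence finitely generated. Lifts
    of its generators together with the images under [f] of those of [E1] generate [E2]. *)
Lemma generated_exact r3 e3 r1 e1 :
  generated a3 setT r3 e3 -> generated a1 setT r1 e1 ->
  exists r e, generated a2 setT r e.
Proof.
move=> gen3 gen1.
have g0 : g 0 = 0 by apply: (addrI (g 0)); rewrite -gD !addr0.
have f0 : f 0 = 0 by apply: (addrI (f 0)); rewrite -fD !addr0.
have gB x y : g (x - y) = g x - g y.
  by apply: (addIr (g y)); rewrite -gD !subrK.
have subg : submodule a3 (range g).
  split; first by exists 0.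
  - by move=> _ _ [x _ <-] [y _ <-]; exists (x + y); rewrite // gD.
  - by move=> a _ Sa [x _ <-]; exists (a2 a x); rewrite // ga.
have [|t [h [hg gen]]] := submodule_generated a3Dr a3Dl a31 a3M (r := r3) (e := e3) subg.
  by move=> x _; exact: gen3.
have /choice[l lh] : forall i, exists x, g x = h i by move=> i; case: (hg i) => x _ <-; exists x.
exists (t + r1)%N, (fun i => if (i < t)%N then l i else f (e1 (i - t)%N)) => x _.
have [|c [Sc gxE]] := gen (g x) => //.
have [|y yE] := exact_fg (e := x - \sum_(i < t) a2 (c i) (l i)).
  rewrite gB gxE (big_morph g gD g0) -sumrB big1 // => i _.
  by rewrite ga lh subrr.
have [d [Sd yd]] := gen1 y I.
exists (fun i => if (i < t)%N then c i else d (i - t)%N); split; first by move=> i; case: ifP.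
rewrite -(subrK (\sum_(i < t) a2 (c i) (l i)) x) yE addrC yd (big_morph f fD f0).
rewrite -(@big_cat_ord _ t r1 (fun i => a2 (c i) (l i)) (fun i => f (a1 (d i) (e1 i)))).
by apply: eq_bigr => i _; case: ifP => // _; rewrite fa.
Qed.
End Exact.
End Noetherian.

(** * Dimension theory of graded Noetherian rings *)

Lemma linear_id (k : fieldType) (L : lmodType k) : linear (@id L).
Proof. by []. Qed.

Lemma fct_lincombE (k : fieldType) (T : Type) (L : lmodType k) c (f g : T -> L) t :
  (c *: f + g) t = c *: f t + g t.
Proof. by []. Qed.

Lemma delta_linear (k : fieldType) (L : lmodType k) (j : nat) :
  linear (fun (x : L) (l : nat) => if l == j then x else 0).
Proof.
move=> c x y; apply/funext => l; rewrite fct_lincombE; case: eqP => // _.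
by rewrite scaler0 addr0.
Qed.

Lemma sum_delta (k : fieldType) (L : lmodType k) N (g : nat -> L) :
  (forall l, (N <= l)%N -> g l = 0) ->
  \sum_(j < N) (fun l : nat => if l == j :> nat then g j else 0) = g.
Proof.
move=> g0; apply/funext => l.
rewrite fct_sumE /=.
have [lt|le] := ltnP l N.
  rewrite (bigD1 (Ordinal lt)) //= eqxx big1 ?addr0 // => j nj.
  by case: eqP => // E; case/eqP: nj; exact/val_inj/esym.
by rewrite g0 // big1 // => j _; rewrite gtn_eqF // (leq_trans _ le).
Qed.

Section GradedNoetherian.
Variables (k : fieldType) (R : algType k) (G : grading R) (S : set R).
Hypotheses (S1 : S 1) (sS : subspace S).
Hypothesis SM : forall x y, S x -> S y -> S (x * y).
Hypothesis SG : forall n x, S x -> S (G n x).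
Hypothesis SC : commutative_on S.
Hypothesis noethS : noetherian S.
Hypothesis gM : forall m n x y, deg G m x -> deg G n y -> deg G (m + n) (x * y).
Hypothesis g1 : deg G 0 1.
Hypothesis fin0 : exists t, spanned (S `&` deg G 0) [set 0] t.

Let S0 : S 0. Proof. exact sS.1. Qed.
Let SD x y : S x -> S y -> S (x + y). Proof. exact: subspaceD. Qed.
Let SN1 : S (-1). Proof. by rewrite -scaleN1r; apply: (subspaceZ sS). Qed.

Let mull (y : R) : linear (fun x : R => x * y).
Proof. by move=> c u v; rewrite mulrDl scalerAl. Qed.
Let mulr_lin (x : R) : linear (fun y : R => x * y).
Proof. by move=> c u v; rewrite mulrDr scalerAr. Qed.

Lemma gprM n x y : G n (x * y) = \sum_(i < n.+1) G i x * G (n - i)%N y.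
Proof. exact: (gpr_bil mull mulr_lin gM). Qed.
Lemma gprM_degl m n x y : deg G m x ->
  G n (x * y) = if (m <= n)%N then x * G (n - m)%N y else 0.
Proof. exact: (gpr_bil_deg mull mulr_lin gM). Qed.

Lemma S_pow x n : S x -> S (x ^+ n).
Proof. by move=> Sx; elim: n => // n IH; rewrite exprS; exact: SM. Qed.

Lemma ideal_subspace I : left_ideal S I -> subspace I.
Proof.
case=> IS I0 ID IM; split=> // c x y Ix Iy; apply: ID => //.
by rewrite -[x]mul1r scalerAl; apply: IM => //; exact: (subspaceZ sS).
Qed.

Definition graded_ideal I := left_ideal S I /\ forall n x, I x -> I (G n x).

Lemma graded_ideal_add I e x : graded_ideal I -> S x -> deg G e x ->
  graded_ideal (ideal_add S I x).
Proof.
move=> [idI gI] Sx dx; split; first exact: ideal_add_ideal.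
move=> n z [a Sa Ia]; have := gI n _ Ia; rewrite gprB => H.
have [le|lt] := leqP e n; last first.
  exists 0 => //; rewrite mul0r subr0.
  move: H; rewrite (SC Sa Sx) (gprM_degl _ _ dx) leqNgt lt /= subr0 //.
by exists (G (n - e)%N a); rewrite ?(SC (SG _ Sa) Sx); [exact: SG|];
  move: H; rewrite (SC Sa Sx) (gprM_degl _ _ dx) le.
Qed.

Definition colon (I : set R) x : set R := [set y | S y /\ I (x * y)].

Lemma colon_ideal I x : left_ideal S I -> S x -> left_ideal S (colon I x).
Proof.
move=> [IS I0 ID IM] Sx; split.
- by move=> y [].
- by split=> //; rewrite mulr0.
- by move=> y z [Sy Iy] [Sz Iz]; split; [exact: SD|rewrite mulrDr; exact: ID].
- move=> a y Sa [Sy Iy]; split; first exact: SM.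
  by rewrite mulrA (SC Sx Sa) -mulrA; exact: IM.
Qed.

Lemma graded_colon I e x : graded_ideal I -> S x -> deg G e x ->
  graded_ideal (colon I x).
Proof.
move=> [idI gI] Sx dx; split; first exact: colon_ideal.
move=> n y [Sy Iy]; split; first exact: SG.
by have := gI (e + n)%N _ Iy; rewrite (gprM_degl _ _ dx) leq_addr addKn.
Qed.

(** Let [i] and [j] be the least degrees in which [x] and [y] have components outside [I]. In degree
    [i + j] every term of [x * y] except [G i x * G j y] lies in [I], so this one does too. *)
Lemma graded_prime I : graded_ideal I -> ~ I 1 ->
  (forall m n x y, S x -> deg G m x -> S y -> deg G n y -> I (x * y) -> I x \/ I y) ->
  prime_ideal S I.
Proof.
move=> [idI gI] nI1 hp; have sI := ideal_subspace idI; have [IS I0 ID IM] := idI.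
split=> //; first exact/ideal_proper.
move=> x y Sx Sy Ixy; apply: contrapT => /not_orP[nIx nIy].
have wit z : S z -> ~ I z -> exists i, `[< ~ I (G i z) >].
  move=> Sz nIz; apply: contrapT => none; apply: nIz.
  have [N [-> _]] := gpr_sum G z; apply: (ideal_sum (F := fun i => G i z) idI) => i _.
  by apply: contrapT => nIi; apply: none; exists i; apply/asboolP.
have [i /asboolP nIi mini] := ex_minnP (wit _ Sx nIx).
have [j /asboolP nIj minj] := ex_minnP (wit _ Sy nIy).
have lo z l (minl : forall n, `[< ~ I (G n z) >] -> (l <= n)%N) n : (n < l)%N -> I (G n z).
  by move=> lt; apply: contrapT => /asboolP/minl; rewrite leqNgt lt.
have : I (G i x * G j y).
  have lti : (i < (i + j).+1)%N by rewrite ltnS leq_addr.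
  have := gI (i + j)%N _ Ixy; rewrite gprM (bigD1 (Ordinal lti)) //= addKn.
  set s := \sum_(_ < _ | _) _ => Is.
  rewrite -(addrK s (G i x * G j y)); apply: (subspaceB sI) => //.
  rewrite /s big_mkcond /=.
  apply: (ideal_sum (F := fun a => if a != i then G a x * G (i + j - a)%N y else 0) idI) => a lta.
  case: eqP => // /eqP nai /=; have [lt|le] := ltnP a i.
    by rewrite (SC (SG _ Sx) (SG _ Sy)); apply: IM; [exact: SG|exact: lo lt].
  apply: IM; first exact: SG.
  have {}le : (i < a)%N by rewrite ltn_neqAle eq_sym nai.
  apply: (lo y j minj); rewrite ltn_subLR; first by rewrite ltn_add2r.
  by rewrite -ltnS.
by case/(hp i j _ _ (SG _ Sx) (deg_gpr _ _ _) (SG _ Sy) (deg_gpr _ _ _)).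
Qed.

Lemma deg_subspaceS n : subspace (S `&` deg G n).
Proof.
have [d0 dl] := deg_subspace G n; split; first by split.
by move=> c x y [Sx dx] [Sy dy]; split; [exact: sS.2|exact: dl].
Qed.

Lemma subspace0 (L : lmodType k) : subspace [set 0 : L].
Proof. by split=> // c x y -> ->; rewrite scaler0 addr0. Qed.

(** The elements without components below degree [n] form an ideal. In degree [n], only the degree 0
    components of the coefficients of its generators contribute, so [S] in degree [n] is finitely
    generated over [S] in degree 0. *)
Lemma spanned_deg n : exists t, spanned (S `&` deg G n) [set 0] t.
Proof.
have [t0 sp0] := fin0.
pose J := [set x | S x /\ forall i, (i < n)%N -> G i x = 0].
have [s [sJ gen]] : exists s : seq R, [set` s] `<=` J /\
    forall x, J x -> exists2 c : nat -> R, (forall i, S (c i)) &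
      x = \sum_(i < size s) c i * s`_i.
  apply: noethS; split.
  - by move=> x [].
  - by split=> // i _; rewrite gpr0.
  - move=> x y [Sx x0] [Sy y0]; split; first exact: SD.
    by move=> i lti; rewrite gprD x0 // y0 // addr0.
  - move=> a x Sa [Sx x0]; split; first exact: SM.
    move=> i lti; rewrite gprM big1 // => j _; rewrite x0 ?mulr0 //.
    by apply: leq_ltn_trans lti; exact: leq_subr.
have Js i : J s`_i.
  have [lt|le] := ltnP i (size s); first by apply: sJ; rewrite /= mem_nth.
  by rewrite nth_default //; split=> // j _; rewrite gpr0.
exists (\sum_(i < size s) t0)%N.
apply: (@spanned_family _ _ (fun=> R) (S `&` deg G n) [set 0] (fun=> S `&` deg G 0)
  (fun=> [set 0]) (fun i c => c * G n s`_i) (fun=> t0) (size s)) => //.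
- exact: deg_subspaceS.
- exact: subspace0.
- by move=> _; exact: deg_subspaceS.
- move=> v [Sv dv]; have [|c Sc vE] := gen v.
    split=> // i lti; rewrite (gpr_deg _ dv) (_ : (_ == _) = false) //.
    by rewrite ltn_eqF.
  exists (fun i => G 0%N (c i)); split; first by move=> i; split; [exact: SG|exact: deg_gpr].
  apply/eqP; rewrite subr_eq0; apply/eqP; rewrite -[LHS]dv vE gpr_big.
  apply: eq_bigr => i _; rewrite gprM big_ord_recl subn0 big1 ?addr0 // => j _.
  have [_ ->] := Js i; first by rewrite mulr0.
  by rewrite ltn_subrL /= ; case: (n) j => // -[].
- by move=> i _ y ->; rewrite mul0r.
move=> i _ y [Sy dy]; split.
  by apply: SM => //; apply: SG; case: (Js i).
by have := gM dy (deg_gpr G n s`_i); rewrite add0n.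
Qed.

Lemma spanned_deg_mod I n : left_ideal S I -> exists t, spanned (S `&` deg G n) I t.
Proof.
move=> idI; have [t [s [Vs sp]]] := spanned_deg n; exists t, s; split=> // v /sp[c E].
by exists c; rewrite E; case: idI.
Qed.

Definition codim_growth I d := exists u : nat -> nat,
  (forall n, spanned (S `&` deg G n) I (u n)) /\ growth u d.

(** The invariant of the induction. Its last clause, a homogeneous element of positive degree that
    is not nilpotent modulo [I], later produces a nontrivial point of the variety. *)
Definition chain_growth I d := [/\ codim_growth I d, exists p, prime_chain S I d p &
  (0 < d)%N -> exists e x, [/\ (0 < e)%N, S x, deg G e x & forall j, ~ I (x ^+ j)]].

(* Noetherian induction on graded ideals: a non-prime one is handled by
   [0 -> S/(I:x) -> S/I -> S/(I+x) -> 0], a prime one by the same sequence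
   with [(I:x) = I], which raises both the growth and the length of the chain. *)
Lemma exists_chain_growth I : graded_ideal I -> ~ I 1 -> exists d, chain_growth I d.
Proof.
move=> [idI]; move: I idI; apply: (noetherian_ind noethS (P := fun I => _ -> _ -> _)).
move=> I idI IH gI nI1; have gidI : graded_ideal I by [].
have [IS I0 ID IM] := idI; have sI := ideal_subspace idI.
have [hp|] := pselect (forall m n x y, S x -> deg G m x -> S y -> deg G n y ->
   I (x * y) -> I x \/ I y); last first.
  move=> /existsNP[e] /existsNP[f] /existsNP[x] /existsNP[y].
  move=> /not_implyP[Sx] /not_implyP[dx] /not_implyP[Sy] /not_implyP[dy].
  move=> /not_implyP[Ixy] /not_orP[nIx nIy].
  have gJ := graded_ideal_add gidI Sx dx; have gK := graded_colon gidI Sx dx.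
  set J := ideal_add S I x in gJ; set K := colon I x in gK.
  have IJ : I `<=` J by exact: sub_ideal_add.
  have IK : I `<=` K by move=> z Iz; split; [exact: IS|exact: IM].
  have [d2 [[u2 [sp2 gr2]] [p2 ch2] pow2]] : exists d, chain_growth K d.
    apply: IH => //; [by case: gK| |by case: gK|by case; rewrite mulr1].
    by move=> E; apply: nIy; rewrite E.
  have chI L (LI : I `<=` L) d p : prime_chain S L d p -> prime_chain S I d p.
    by case=> h1 h2; split=> // i /h1[? ?]; split=> //; exact: subset_trans LI _.
  (* Multiplication by [x] has degree [e], so the quotient by [K] enters in degree [n - e]. *)
  have comb u1 n : (forall n, spanned (S `&` deg G n) J (u1 n)) ->
      (e <= n)%N -> spanned (S `&` deg G n) I (u1 n + u2 (n - e))%N.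
    move=> sp1 le; apply: (@spanned_ext _ _ _ (S `&` deg G n) I J
      (S `&` deg G (n - e)) K (fun y => x * y)) => //.
    - exact: deg_subspaceS.
    - move=> v [Sv dv] [a Sa Ia]; exists (G (n - e)%N a).
        by split; [exact: SG|exact: deg_gpr].
      have := gI n _ Ia; rewrite gprB dv (SC Sa Sx) (gprM_degl _ _ dx) le //.
    - by move=> z [].
    - move=> z [Sz dz]; split; first exact: SM.
      by have := gM dx dz; rewrite subnKC.
  have comb2 u1 d : (forall n, spanned (S `&` deg G n) J (u1 n)) -> growth u1 d ->
      (d2 <= d)%N -> codim_growth I d.
    move=> sp1 gr1 le.
    have /choice[t tP] n := spanned_deg_mod n idI.
    exists (fun n => if (e <= n)%N then u1 n + u2 (n - e) else t n)%N; split.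
      by move=> n; case: leqP => // h; exact: comb.
    apply: growth_le_trans (growth_add gr1 (growth_weaken le (growth_shift e gr2))).
    by exists e => n ->.
  (* If [J] is everything, the induction hypothesis does not apply to it, but then S/J is zero and
     [K] alone controls [I]. *)
  have [J1|nJ1] := pselect (J 1).
    exists d2; split.
    - apply: (comb2 (fun=> 0%N)) => // [n|]; last first.
        by apply: (@growth_weaken _ 0) => //; apply/growth0P; exists 0%N.
      apply/spanned0P; first by case: (deg_subspaceS n).
      by move=> z [Sz _]; have [[_ _ _ JM] _] := gJ; rewrite -[z]mulr1; exact: JM.
    - by exists p2; exact: chI ch2.
    - move=> /pow2[e' [z [? ? ? nK]]]; exists e', z; split=> // j Ij.
      by apply: (nK j); exact: IK.
  have [d1 [[u1 [sp1 gr1]] [p1 ch1] pow1]] : exists d, chain_growth J d.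
    apply: IH => //; [by case: gJ| |by case: gJ].
    by move=> E; apply: nIx; rewrite E; exact: mem_ideal_add.
  (* The larger of the two exponents bounds the growth for [I], and the chain and the non-nilpotent
     element come from the ideal that realizes it. *)
  have [le|lt] := leqP d2 d1.
    exists d1; split.
    - exact: comb2 sp1 gr1 le.
    - by exists p1; exact: chI ch1.
    - move=> /pow1[e' [z [? ? ? nK]]]; exists e', z; split=> // j Ij.
      by apply: (nK j); exact: IJ.
  exists d2; split.
  - exact: comb2 sp1 (growth_weaken (ltnW lt) gr1) _.
  - by exists p2; exact: chI ch2.
  - move=> /pow2[e' [z [? ? ? nK]]]; exists e', z; split=> // j Ij.
    by apply: (nK j); exact: IK.
have prI : prime_ideal S I by exact: graded_prime.
(* If nothing of positive degree lies outside the prime [I], then S/I sits in degree 0 and the chain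
   is [I] alone. *)
have [[e [x [e0 Sx dx nIx]]]|none] :=
    pselect (exists e x, [/\ (0 < e)%N, S x, deg G e x & ~ I x]); last first.
  exists 0%N; split=> //.
    have /choice[t tP] n : exists t, spanned (S `&` deg G n) I t /\ ((0 < n)%N -> t = 0%N).
      have [t tP] := spanned_deg_mod n idI; case: n tP => [|n] tP; first by exists t.
      exists 0%N; split=> //; apply/spanned0P; first by case: (deg_subspaceS n.+1).
      move=> z [Sz dz]; apply: contrapT => nIz; apply: none; by exists n.+1, z.
    exists t; split; first by move=> n; case: (tP n).
    by apply/growth0P; exists 1%N => n n0; case: (tP n) => _ ->.
  exists (fun=> I); split=> [i _|i]; last by rewrite ltn0.
  by split=> //; exact: subset_refl.
have gJ := graded_ideal_add gidI Sx dx; set J := ideal_add S I x in gJ.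
have IJ : I `<=` J by exact: sub_ideal_add.
have [IJx] : J x /\ I <> J.
  have Jx : J x by exact: mem_ideal_add.
  by split=> // E; apply: nIx; rewrite E.
(* Since [x] has positive degree, the degree 0 component of [1 - a * x] is 1, which is not in
   [I]. *)
move=> neJ; have nJ1 : ~ J 1.
  case=> a Sa /(gI 0%N); rewrite gprB g1 (SC Sa Sx) (gprM_degl _ _ dx) leqNgt e0 /=.
  by rewrite subr0.
have [d1 [[u1 [sp1 gr1]] [p1 [ch1 ch1']] _]] := IH J gJ.1 IJ neJ gJ.2 nJ1.
exists d1.+1; split.
- have /choice[t tP] n := spanned_deg_mod n idI.
  (* The recursion goes from [n] to [n - e], which is not structural: [m] is fuel, and [wm] shows
     that any sufficient amount gives the same value. *)
  pose w := fix w m n := if m is m'.+1 then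
     if (e <= n)%N then (w m' (n - e) + u1 n)%N else t n else t n.
  have wE m n : (n <= m)%N -> spanned (S `&` deg G n) I (w m n).
    elim: m n => [|m IHm] n le //=; case: leqP => // len; rewrite addnC.
    apply: (@spanned_ext _ _ _ (S `&` deg G n) I J
      (S `&` deg G (n - e)) I (fun y => x * y)) => //.
    - exact: deg_subspaceS.
    - by apply: IHm; rewrite leq_subLR (leq_trans le) // -add1n leq_add2r.
    - move=> v [Sv dv] [a Sa Ia]; exists (G (n - e)%N a).
        by split; [exact: SG|exact: deg_gpr].
      have := gI n _ Ia; rewrite gprB dv (SC Sa Sx) (gprM_degl _ _ dx) len //.
    - by move=> z Iz; exact: IM.
    - move=> z [Sz dz]; split; first exact: SM.
      by have := gM dx dz; rewrite subnKC.
  have wm m m' n : (n <= m)%N -> (n <= m')%N -> w m n = w m' n.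
    elim: m m' n => [|m IHm] [|m'] n //=.
    - by rewrite leqn0 => /eqP -> _; rewrite leqNgt e0.
    - by move=> _; rewrite leqn0 => /eqP ->; rewrite leqNgt e0.
    - move=> le le'; case: ifP => // len; congr (_ + _)%N; apply: IHm.
        by rewrite leq_subLR (leq_trans le) // -add1n leq_add2r.
      by rewrite leq_subLR (leq_trans le') // -add1n leq_add2r.
  exists (fun n => w n n); split; first by move=> n; exact: wE.
  have [|C leC] := @growth_incr (fun n => w n n) u1 e d1 e0 _ gr1.
    exists e => n len; case: n len => [|n] len /=; first by rewrite leqNgt e0 in len.
    rewrite len leq_add2r (wm n (n.+1 - e)%N) //.
    by rewrite leq_subLR -add1n leq_add2r.
  exact: growth_of_bound leC.
- exists (fun i => if i is i'.+1 then p1 i' else I); split.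
    case=> [_|i lt]; first by split=> //; exact: subset_refl.
    have [? Jp] := ch1 _ lt; split=> //; exact: subset_trans IJ Jp.
  case=> [_|i lt]; last exact: ch1'.
  have [_ Jp] := ch1 0%N isT; split; first exact: subset_trans IJ Jp.
  by move=> E; apply: nIx; rewrite E; exact: Jp.
- move=> _; exists e, x; split=> // j; elim: j => [|j IHj]; first by rewrite expr0.
  by rewrite exprS; case: prI => _ _ pr /(pr _ _ Sx (S_pow j Sx))[].
Qed.

(** A discrete mean value inequality; it measures what is to be gained when the degree bound moves
    from [a] to [a + D]. *)
Lemma expnD_le a D m :
  ((a + D) ^ m.+1 <= a ^ m.+1 + m.+1 * D * (a + D) ^ m)%N.
Proof.
elim: m => [|m IH]; first by rewrite !expn1 expn0 mul1n muln1.
rewrite expnS mulnDl.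
apply: leq_trans (leq_add (leq_mul (leqnn a) IH) (leqnn _)) _.
rewrite mulnDr -expnS -addnA leq_add2l.
apply: leq_trans (_ : m.+1 * D * (a + D) ^ m.+1 + D * (a + D) ^ m.+1 <= _)%N.
  rewrite leq_add2r mulnCA leq_mul2l [(_ ^ m.+1)%N]expnS leq_mul2r leq_addr.
  by rewrite !orbT.
by rewrite -mulnDl [(m.+2 * D)%N]mulSn addnC.
Qed.

(* For [x] in [p 1] but not in [p 0], multiplication by [x] embeds S/(p 0)
   into the kernel of S/(p 0) -> S/(p 1). *)
Lemma prime_chain_independent I m p : prime_chain S I m p -> exists C, forall n,
  exists N, (n ^ m <= C * N)%N /\ independent (Filt G S n) (p 0%N) N.
Proof.
elim: m p => [|m IH] p [ch ch'].
  exists 1%N => n; exists 1%N; split=> //.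
  have [pr _] := ch 0%N isT; have [idp np _] := pr.
  have np1 : ~ p 0%N 1 by exact/(ideal_proper S1 idp).
  exists (fun=> 1); split=> [i|c].
    by split=> // i' lt; rewrite (gpr_deg _ g1) gtn_eqF // (leq_ltn_trans _ lt).
  rewrite big_ord1 => pc [|//] _; apply: contrapT => /eqP c0; apply: np1.
  have := subspaceZ (ideal_subspace idp) (c 0%N)^-1 pc.
  by rewrite scalerA mulVf // scale1r.
have [C' IHC] : exists C, forall n, exists N, (n ^ m <= C * N)%N /\
    independent (Filt G S n) (p 1%N) N.
  by apply: (IH (fun i => p i.+1)); split=> i lt; [exact: ch|exact: ch'].
have [[id0 np0 pr0] _] := ch 0%N isT; have [[id1 np1 pr1] _] := ch 1%N isT.
have [p01 ne01] := ch' 0%N isT.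
have [x [p1x np0x]] : exists x, p 1%N x /\ ~ p 0%N x.
  apply: contrapT => none; apply: ne01; apply/seteqP; split=> // x p1x.
  by apply: contrapT => np0x; apply: none; exists x.
have Sx : S x by case: id1 => + _ _ _; apply.
(* One more than a degree bound of [x], so that [D] is positive and [n - D] really decreases. *)
have [D0 FD] := Filt_ex G Sx; pose D := D0.+1.
have {FD} FD : Filt G S D x by apply: FD; exact: leqnSn.
(* From [n - D] to [n] the power [n ^ m.+1] grows by at most [m.+1 * D * n ^ m], and modulo [p 1]
   there are at least [n ^ m / C'] new independent elements. For [n < D] these alone suffice. *)
exists (m.+1 * D * C')%N => n; have [l] := ubnP n; elim: l n => // l IHl n le_n.
have [N1 [leN1 ind1]] := IHC n.
have [lt|le] := ltnP n D.
  exists N1; split; last exact: independent_mono ind1.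
  rewrite expnS -!mulnA; apply: leq_trans (leq_mul (ltnW lt) leN1) _.
  by rewrite leq_pmull.
have ltl : (n - D < l)%N.
  by apply: leq_trans (_ : (n - D < n)%N) _; rewrite ?ltn_subrL ?(leq_trans _ le).
have [N2 [leN2 ind2]] := IHl _ ltl.
exists (N1 + N2)%N; split.
  rewrite -{1}(subnK le); apply: leq_trans (expnD_le _ _ _) _.
  rewrite addnC mulnDr leq_add // -[(_ * C' * N1)%N]mulnA leq_mul2l subnK // ?leN1 ?orbT.
apply: (@independent_cat _ _ _ (Filt G S n) (p 0%N) (p 1%N) (Filt G S (n - D)) (p 0%N)
   (fun y => x * y)) => //.
- exact: Filt_subspace.
- exact: ideal_subspace.
- move=> y Fy; split; first by case: Fy => Sy _; exact: SM.
  by have [_] := Filt_bil mull mulr_lin gM FD Fy; rewrite subnKC.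
- by move=> y [Sy _]; rewrite (SC Sx Sy); case: id1 => _ _ _; apply.
- by move=> y [Sy _] /(pr0 _ _ Sx Sy)[].
- exact: Filt_subspace.
Qed.

(** An inverse [a] of [1 - x] modulo [I] must be the geometric series: its component of degree
    [j * e] is [x ^+ j] modulo [I]. As [a] has finitely many components, some power of [x] would lie
    in [I]. *)
Lemma maximal_avoiding_graded I e x : graded_ideal I -> ~ I 1 ->
  (0 < e)%N -> S x -> deg G e x -> (forall j, ~ I (x ^+ j)) ->
  exists m, [/\ maximal_left_ideal S m, I `<=` m & m (1 - x)].
Proof.
move=> [idI gI] nI1 e0 Sx dx nIx; have [IS I0 ID IM] := idI.
have S1x : S (1 - x) by apply: (subspaceB sS).
have idJ : left_ideal S (ideal_add S I (1 - x)) by exact: ideal_add_ideal.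
have nJ1 : ~ ideal_add S I (1 - x) 1.
  case=> a Sa Ia.
  have pw j : I (x ^+ j - G (j * e)%N a).
    elim: j => [|j IH].
      have := gI 0%N _ Ia; rewrite gprB g1 mulrBr mulr1 gprB (SC Sa Sx).
      by rewrite (gprM_degl _ _ dx) leqNgt e0 subr0 expr0.
    have := gI (j.+1 * e)%N _ Ia; rewrite gprB mulrBr mulr1 gprB (SC Sa Sx).
    rewrite (gprM_degl _ _ dx) (gpr_deg _ g1) muln_eq0 /= eqn0Ngt e0 /=.
    rewrite mulSn leq_addr addKn sub0r opprB => Ij.
    have := ID _ _ (IM _ _ Sx IH) Ij.
    by rewrite mulrBr -exprS subrKA.
  have [N [_ a0]] := gpr_sum G a.
  apply: (nIx N); have := pw N; rewrite a0 ?subr0 //.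
  by rewrite leq_pmulr.
have [m [maxm Jm]] : exists m, maximal_left_ideal S m /\ ideal_add S I (1 - x) `<=` m.
  exact: exists_maximal_ideal.
exists m; split=> //.
  apply: subset_trans Jm; exact: sub_ideal_add.
by apply: Jm; exact: mem_ideal_add.
Qed.

(** * Growth of finitely generated graded modules *)

Section Module.
Variables (E : lmodType k) (GE : grading E) (act : R -> E -> E).
Hypotheses (act_lin : forall x, linear (act x)) (act_linl : forall e, linear (act^~ e)).
Hypothesis act_deg : forall m n x e, deg G m x -> deg GE n e -> deg GE (m + n) (act x e).
Hypothesis act_commute : forall x y e, S x -> S y -> act x (act y e) = act y (act x e).
Variables (r : nat) (e_ : nat -> E).
Hypothesis gen : generated S act setT r e_.

Definition ann : set R := [set h | S h /\ forall e, act h e = 0].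

Lemma gpr_act_degr m n x e : deg GE n e ->
  GE m (act x e) = if (n <= m)%N then act (G (m - n)%N x) e else 0.
Proof.
apply: (@gpr_bil_deg _ _ _ _ _ G _ (fun e x => act x e)) => //.
by move=> i j f y df dy; rewrite addnC; exact: act_deg.
Qed.

(** For [e] homogeneous of degree [j], [act (G n x) e] is the component of degree [n + j] of
    [act x e], and homogeneous elements suffice. *)
Lemma ann_graded : (forall x y e, act (x * y) e = act y (act x e)) -> graded_ideal ann.
Proof.
move=> actM; have a0r x := bil0r act_lin x; have a0l x := bil0l act_linl x.
split; first split.
- by move=> x [].
- by split.
- move=> x y [Sx x0] [Sy y0]; split; first exact: SD.
  by move=> e; rewrite (linear_addE (act_linl e)) x0 y0 addr0.
- move=> a x Sa [Sx x0]; split; first exact: SM.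
  by move=> e; rewrite actM x0.
move=> n x [Sx x0]; split; first exact: SG.
move=> e; have [N [-> _]] := gpr_sum GE e.
rewrite (big_morph _ (linear_addE (act_lin _)) (a0r _)) big1 // => j _.
have := gpr_act_degr (n + j)%N x (deg_gpr GE j e).
by rewrite x0 gpr0 leq_addl addnK.
Qed.

(** The degree [n] part of the module is covered by the spaces obtained by letting [S] in degree
    [n - j] act on the degree [j] component of a generator; [N] bounds the degrees of all
    generators. *)
Lemma spanned_module u : (forall n, spanned (S `&` deg G n) ann (u n)) ->
  exists N, forall n, spanned (deg GE n) [set 0] (\sum_(i < r) \sum_(j < N) u (n - j)).
Proof.
move=> sp; have a0r x := bil0r act_lin x; have a0l x := bil0l act_linl x.
have [N eN] : exists N, forall i, (i < r)%N -> e_ i = \sum_(j < N) GE j (e_ i).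
  have /choice[h hP] i := gpr_sum_ge GE (e_ i).
  exists (\max_(i < r) h i) => i lti; apply: hP.
  exact: (leq_bigmax (Ordinal lti)).
exists N => n.
(* For [j > n] the truncated [n - j] would wrongly select degree 0, so the space is set to zero. *)
pose Vj j : set R := if (j <= n)%N then S `&` deg G (n - j) else [set 0].
have sVj j : subspace (Vj j).
  by rewrite /Vj; case: ifP => _; [exact: deg_subspaceS|exact: subspace0].
have sann : subspace ann.
  split; first by split.
  move=> c x y [Sx x0] [Sy y0]; split; first exact: sS.2.
  by move=> e; rewrite (act_linl e) x0 y0 scaler0 addr0.
have fam (i : nat) : spanned [set c : nat -> R | forall j, Vj j (c j) /\ ((N <= j)%N -> c j = 0)]
    [set c | forall j, ann (c j)] (\sum_(j < N) u (n - j)).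
  apply: (@spanned_family _ _ (fun=> R) _ _ Vj (fun=> ann)
    (fun j x => (fun l : nat => if l == j :> nat then x else 0)) (fun j => u (n - j)%N) N) => //.
  - by move=> j; exact: delta_linear.
  - split; first by move=> j; split=> //; exact: (sVj j).1.
    move=> c x y Vx Vy j; rewrite fct_lincombE; have [? x0] := Vx j; have [? y0] := Vy j.
    by split; [exact: (sVj j).2|move=> le; rewrite x0 // y0 // scaler0 addr0].
  - split; first by move=> j; exact: sann.1.
    by move=> c x y Vx Vy j; rewrite fct_lincombE; exact: sann.2.
  - move=> j ltj; rewrite /Vj; case: ifP => // _.
    by apply: (@spanned_leq _ _ _ _ 0) => //; apply/spanned0P => // x ->; exact sann.1.
  - move=> c Vc; exists c; split=> [j|l]; first by case: (Vc j).
    have -> : \sum_(j < N) (fun l : nat => if l == j :> nat then c j else 0) = c.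
      by apply: sum_delta => j le; case: (Vc j) => _ /(_ le).
    by rewrite subrr; exact: sann.1.
  - by move=> j _ y [Sy y0] l; case: eqP => // _; exact: sann.1.
  - move=> j ltj y Vy l; split; last by case: eqP => // -> ; rewrite leqNgt ltj.
    by case: eqP => [->|_] //; exact: (sVj l).1.
apply: (@spanned_family _ _ (fun=> nat -> R) _ _ _ _
  (fun i c => \sum_(j < N) act (c j) (GE j (e_ i))) (fun=> \sum_(j < N) u (n - j)%N) r
  _ _ _ _ (fun i _ => fam i)).
- move=> i c x y; rewrite scaler_sumr -big_split; apply: eq_bigr => j _.
  by rewrite fct_lincombE act_linl.
- exact: deg_subspace.
- exact: subspace0.
- move=> _; split; first by move=> j; split=> //; exact: (sVj j).1.
  move=> c x y Vx Vy j; rewrite fct_lincombE; have [? x0] := Vx j; have [? y0] := Vy j.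
  by split; [exact: (sVj j).2|move=> le; rewrite x0 // y0 // scaler0 addr0].
- move=> v dv; have [//|c [Sc vE]] := gen (x := v).
  exists (fun i j => if (j < N)%N && (j <= n)%N then G (n - j)%N (c i) else 0); split.
    move=> i j; split; last by rewrite leqNgt => /negPf ->.
    case: andP => [[_ le]|_]; last exact: (sVj j).1.
    by rewrite /Vj le; split; [exact: SG|exact: deg_gpr].
  apply/eqP; rewrite subr_eq0; apply/eqP.
  rewrite -[LHS]dv vE gpr_big; apply: eq_bigr => i _.
  rewrite {1}(eN i) // (big_morph _ (linear_addE (act_lin _)) (a0r _)) gpr_big.
  apply: eq_bigr => j _; rewrite (gpr_act_degr _ _ (deg_gpr _ _ _)) ltn_ord /=.
  by case: ifP => // _; rewrite a0l.
- by move=> i _ c kc; rewrite /= big1 // => j _; case: (kc j) => _ ->.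
- move=> i _ c Vc; apply: (@subspace_sum _ _ _ _ _ (fun j => act (c j) (GE j (e_ i)))).
    exact: deg_subspace.
  move=> j _; have [+ _] := Vc j; rewrite /Vj; case: leqP => [le [Sc dc]|_ ->].
    by have := act_deg dc (deg_gpr GE j (e_ i)); rewrite subnK.
  by rewrite a0l; exact: gpr0.
Qed.

Lemma codim_growth_module d : codim_growth ann d ->
  exists v, (forall n, spanned (deg GE n) [set 0] (v n)) /\ growth v d.
Proof.
move=> [u [sp gr]]; have [N spN] := spanned_module sp.
exists (fun n => \sum_(i < r) \sum_(j < N) u (n - j))%N; split=> //.
have gsum (F : nat -> nat -> nat) m : (forall j, growth (F j) d) ->
    growth (fun n => \sum_(j < m) F j n)%N d.
  move=> gF; elim: m => [|m IH].
    by exists 0%N, 0%N => n _; rewrite big_ord0.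
  apply: growth_le_trans (growth_add IH (gF m)).
  by exists 0%N => n _; rewrite big_ord_recr.
apply: (gsum (fun i n => \sum_(j < N) u (n - j))%N) => _.
by apply: (gsum (fun j n => u (n - j))%N) => j; exact: growth_shift.
Qed.

Lemma spanned_Filt u n : (forall n, spanned (deg GE n) [set 0] (u n)) ->
  spanned (Filt GE setT n) [set 0] (\sum_(j < n.+1) u j).
Proof.
move=> sp; apply: (@spanned_family _ _ (fun=> E) _ _ (deg GE) (fun=> [set 0]) (fun=> id) u n.+1).
- by move=> _; exact: linear_id.
- by apply: Filt_subspace.
- exact: subspace0.
- by move=> i; exact: deg_subspace.
- by move=> i _; exact: sp.
- move=> v [_ v0]; exists (fun i => GE i v); split; first by move=> i; exact: deg_gpr.
  have [N vN] := gpr_sum_ge GE v.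
  apply/eqP; rewrite subr_eq0; apply/eqP.
  rewrite {1}(vN (maxn N n.+1)) ?leq_maxl // (big_ord_widen _ (fun i => GE i v) (leq_maxr N n.+1)).
  rewrite [RHS]big_mkcond /=; apply: eq_bigr => i _.
  by case: ltnP => // lt; rewrite v0.
- by move=> i _ y ->.
- move=> i lti y dy; split=> // j ltj; rewrite (gpr_deg _ dy).
  by rewrite gtn_eqF // (leq_trans lti).
Qed.

(** Recording the action on the [r] generators maps S/ann injectively into the [r]-th power of [E]:
    by commutativity, an element killing the generators kills everything. This map raises degrees by
    at most [s], so about [n ^ m] independent elements fit into a space of dimension of order
    [(n + s) ^ b]. *)
Lemma chain_length_le_growth m p u b : prime_chain S ann m p ->
  (forall n, spanned (deg GE n) [set 0] (u n)) -> growth u b -> (m <= b)%N.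
Proof.
move=> ch sp gr; have [C CP] := prime_chain_independent ch.
have a0r x := bil0r act_lin x; have a0l x := bil0l act_linl x.
have [s sP] : exists s, forall i, (i < r)%N -> Filt GE setT s (e_ i).
  have /choice[h hP] i := @Filt_ex _ _ GE setT (e_ i) I.
  exists (\max_(i < r) h i) => i lti; apply: hP.
  exact: (leq_bigmax (Ordinal lti)).
pose U n := \sum_(j < n.+1) u j.
have [|C2 leC2] := @growth_incr U (fun n => u n) 1 b isT _ gr.
  by exists 1%N => -[|n] // _; rewrite subn1 /= /U big_ord_recr.
(* The [r]-th power of the module, as functions on [nat] that vanish from [r] on. *)
pose V n := [set g : nat -> E | forall i, (if (i < r)%N then Filt GE setT n (g i) else g i = 0)].
have sV n : subspace (V n).
  have [F0 Fl] := @Filt_subspace _ _ GE setT n (conj I (fun _ _ _ _ _ => I)).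
  split; first by move=> i; case: ifP.
  move=> c x y Vx Vy i; rewrite fct_lincombE; have := Vx i; have := Vy i.
  by case: ifP => _; [move=> ? ?; exact: Fl|move=> -> ->; rewrite scaler0 addr0].
have spV n : spanned (V n) [set 0] (r * U n).
  rewrite -[r in (r * _)%N]card_ord -sum_nat_const.
  apply: (@spanned_family _ _ (fun=> E) _ _ (fun=> Filt GE setT n) (fun=> [set 0])
    (fun i x => (fun l : nat => if l == i :> nat then x else 0)) (fun=> U n) r).
  - by move=> i; exact: delta_linear.
  - exact: sV.
  - exact: subspace0.
  - by move=> _; exact: Filt_subspace.
  - by move=> i _; exact: spanned_Filt.
  - move=> v Vv; exists (fun i => if (i < r)%N then v i else 0); split.
      move=> i; have := Vv i; case: ifP => // _ _.
      exact: (@Filt_subspace _ _ GE setT n (conj I (fun _ _ _ _ _ => I))).1.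
    rewrite /=; under eq_bigr => i _ do rewrite ltn_ord.
    rewrite sum_delta ?subrr // => l le.
    by have := Vv l; rewrite ltnNge le.
  - by move=> i _ y ->; apply/funext => l; case: eqP.
  - move=> i lti y Fy l; case: eqP => [->|_]; first by rewrite lti.
    case: ifP => // _; exact: (@Filt_subspace _ _ GE setT n (conj I (fun _ _ _ _ _ => I))).1.
apply: (@poly_degree_le (C * (r * C2)) s) => n.
have [N [leN ind]] := CP n; apply: leq_trans leN _.
rewrite -mulnA leq_mul2l; apply/orP; right.
apply: leq_trans (_ : r * U (n + s) <= _)%N; last by rewrite -mulnA leq_mul2l leC2 orbT.
have [[idp _ _] annp] := ch.1 0%N isT.
have [q [Fq iq]] := ind.
apply: (@independent_leq_spanned _ _ (V (n + s)%N) [set 0] _ _ (@subspace0 _)) (spV _).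
pose f (x : R) : nat -> E := fun i => if (i < r)%N then act x (e_ i) else 0.
have lf : linear f.
  move=> c x y; apply/funext => i; rewrite fct_lincombE /f; case: ifP => _.
    by rewrite act_linl.
  by rewrite scaler0 addr0.
exists (fun i => f (q i)); split=> [i j|c /= fc0].
  rewrite /f; case: ifP => [ltj|-> //]; rewrite ltj.
  exact: (Filt_bil act_linl act_lin act_deg (Fq i) (sP _ ltj)).
apply: iq; apply: annp.
have Sq : S (\sum_(i < N) c i *: q i) by apply: (subspace_lin sS) => i; case: (Fq i).
split=> // e; have [//|d [Sd ->]] := gen (x := e).
rewrite (big_morph _ (linear_addE (act_lin _)) (a0r _)) big1 // => i _.
rewrite act_commute //.
have -> : act (\sum_(i < N) c i *: q i) (e_ i) = 0; last by rewrite a0r.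
have := congr1 (fun g => g (i : nat)) fc0.
have -> : \sum_(i < N) c i *: f (q i) = f (\sum_(i < N) c i *: q i).
  rewrite (big_morph f (linear_addE lf) (linear_zeroE lf)).
  by apply: eq_bigr => j _; rewrite (linear_scaleE lf).
by rewrite /f ltn_ord.
Qed.

End Module.
End GradedNoetherian.

(** * Homogeneous cochains and the grading of cohomology *)

(** The counterpart of [spanned_image] when [f] induces a bijection from V/W to V'/W': generators
    are lifted by surjectivity, and relations return by injectivity. *)
Lemma spanned_lift (k : fieldType) (L L' : lmodType k) (V W : set L) (V' W' : set L')
    (f : L -> L') t :
  linear f -> subspace V -> subspace W' ->
  (forall v, V' v -> exists2 u, V u & W' (v - f u)) ->
  (forall v, V v -> V' (f v)) -> (forall v, V v -> W' (f v) -> W v) ->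
  spanned V' W' t -> spanned V W t.
Proof.
move=> lf sV sW' onto fV fW [s [Vs sp]].
have /choice[u uP] i : exists u, V u /\ W' (s i - f u).
  by have [u] := onto _ (Vs i); exists u.
exists u; split=> [i|v Vv]; first by case: (uP i).
have [c Wc] := sp _ (fV _ Vv); exists c.
have Vu : V (\sum_(i < t) c i *: u i) by apply: (subspace_lin sV) => i; case: (uP i).
apply: fW; first exact: subspaceB.
have -> : f (v - \sum_(i < t) c i *: u i) =
   (f v - \sum_(i < t) c i *: s i) + \sum_(i < t) c i *: (s i - f (u i)).
  rewrite addrC -scaleN1r lf scaleN1r addrC.
  rewrite (big_morph f (linear_addE lf) (linear_zeroE lf)).
  under [X in _ = _ + X]eq_bigr => i _ do rewrite scalerBr.
  rewrite sumrB addrA subrK; congr (_ - _).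
  by apply: eq_bigr => i _; rewrite (linear_scaleE lf).
apply: subspaceD => //.
by apply: (@subspace_lin _ _ _ sW' t c (fun i => s i - f (u i))) => i; case: (uP i).
Qed.

Lemma linear_comb4 (k : fieldType) (V : lmodType k) c (x y u v w z p q : V) :
  (c *: x + y) - (c *: u + v) + (c *: w + z) - (c *: p + q) =
  c *: (x - u + w - p) + (y - v + z - q).
Proof.
rewrite !(scalerBr, scalerDr) !opprD !addrA.
by rewrite [LHS](ACl (1*3*5*7*2*4*6*8)).
Qed.

Section Cochains.
Variables (k : fieldType) (A : falgType k).

Section One.
Variable B : bimod A.
Implicit Types f g u : seq A -> B.

Definition homogeneous (n : nat) f := forall s, size s != n -> f s = 0.

Lemma size_merge i (s : seq A) : (i.+1 < size s)%N -> size (merge i s) = (size s).-1.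
Proof.
move=> lt; rewrite /merge size_cat /= size_drop size_takel; last exact: ltnW (ltnW lt).
by rewrite addnS -[in RHS](subnKC lt).
Qed.

(** By [diff_cons2], fixing the first argument reduces to a cochain with one argument less; only a
    variable in one of the first two positions needs separate treatment. *)
Lemma diff_multilinear f : multilinear f -> multilinear (diff f).
Proof.
move=> mf s1; elim: s1 f mf => [|c s1 IH] f mf s2.
  case: s2 => [|b t] d x y; rewrite !cat0s.
    rewrite /= !big_ord0 !addr0 !expr1 !scaleN1r (lact_linl (f [::])) (ract_linr (f [::])).
    by rewrite opprD scalerBr addrACA.
  rewrite !diff_cons2 (lact_linl (f (b :: t))).
  have -> : f ((d *: x + y) * b :: t) = d *: f (x * b :: t) + f (y * b :: t).
    by rewrite mulrDl -scalerAl (mf [::] t).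
  rewrite (mf [::] t) (lact_linr b).
  have -> : (fun s => f (d *: x + y :: s)) = d *: (fun s => f (x :: s)) + (fun s => f (y :: s)).
    by apply/funext => s; rewrite (mf [::] s).
  rewrite diff_linear lincombE; exact: linear_comb4.
have mfc : multilinear (fun s => f (c :: s)) by move=> s s'; exact: (mf (c :: s)).
have IHc := IH _ mfc s2.
case: s1 {IH} IHc => [|b s1] IHc d x y; rewrite !cat_cons ?cat0s.
  rewrite !diff_cons2 (mf [::] s2) (lact_linr c).
  have -> : f (c * (d *: x + y) :: s2) = d *: f (c * x :: s2) + f (c * y :: s2).
    by rewrite mulrDr -scalerAr (mf [::] s2).
  rewrite (lact_linl (f (c :: s2))).
  have -> : diff (fun s => f (c :: s)) (d *: x + y :: s2) =
     d *: diff (fun s => f (c :: s)) (x :: s2) + diff (fun s => f (c :: s)) (y :: s2).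
    exact: (IHc d x y).
  exact: linear_comb4.
rewrite !diff_cons2.
rewrite (mf (b :: s1) s2) (mf (c :: s1) s2) (mf (c * b :: s1) s2) !(lact_linr _).
have -> : diff (fun s => f (c :: s)) (b :: s1 ++ d *: x + y :: s2) =
   d *: diff (fun s => f (c :: s)) (b :: s1 ++ x :: s2) +
   diff (fun s => f (c :: s)) (b :: s1 ++ y :: s2).
  exact: (IHc d x y).
exact: linear_comb4.
Qed.

(* [lmerge a f] and [bdiff f] are defined so that
   [diff f (a :: s) = lact a (f s) - lmerge a f s - bdiff (fun t => f (a :: t)) s]. *)
Definition lmerge a f (s : seq A) : B := if s is b :: t then f (a * b :: t) else ract (f [::]) a.
Fixpoint bdiff f (s : seq A) : B :=
  if s is a :: t then - lmerge a f t - bdiff (fun t => f (a :: t)) t else 0.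

Lemma diff_bdiff f a t : diff f (a :: t) = lact a (f t) + bdiff f (a :: t).
Proof.
elim: t f a => [|b t IH] f a; first by rewrite diff_sing /= subr0.
rewrite diff_cons2 IH.
by rewrite opprD addrA addrK -addrA.
Qed.
Lemma bdiff_lin : linear bdiff.
Proof.
move=> c f g; apply/funext => s; rewrite lincombE; elim: s f g => [|a s IH] f g /=.
  by rewrite scaler0 addr0.
have -> : bdiff (fun t => (c *: f + g) (a :: t)) s =
  c *: bdiff (fun t => f (a :: t)) s + bdiff (fun t => g (a :: t)) s by rewrite -IH.
have -> : lmerge a (c *: f + g) s = c *: lmerge a f s + lmerge a g s.
  by case: s {IH} => [|b s] //=; rewrite lincombE ractD ractZ.
by rewrite !opprD scalerBr scalerN addrACA.
Qed.
Lemma bdiff_lmerge a f : bdiff (lmerge a f) = lmerge a (bdiff f).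
Proof.
apply/funext => -[|c s] /=; first by rewrite (linear_zeroE (ract_linl a)).
by congr (- _ - _); case: s => [|b s] /=; rewrite ?ractM ?mulrA.
Qed.
(** [bdiff] is the differential without the left action. It commutes with [lmerge a], so the two
    mixed terms of the recursion cancel. *)
Lemma bdiff_bdiff f : bdiff (bdiff f) = 0.
Proof.
apply/funext => s; elim: s f => [|a s IH] f //=.
have -> : (fun t => - lmerge a f t - bdiff (fun t0 => f (a :: t0)) t) =
    -1 *: lmerge a f + (-1 *: bdiff (fun t => f (a :: t)) + 0).
  by apply/funext => t; rewrite !lincombE !scaleN1r addr0.
rewrite !bdiff_lin [LHS](_ : _ = - lmerge a (bdiff f) s - (-1 *: bdiff (lmerge a f) s +
  (-1 *: bdiff (bdiff (fun t => f (a :: t))) s + bdiff 0 s))) //.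
rewrite IH (linear_zeroE bdiff_lin) bdiff_lmerge.
by rewrite scaler0 !addr0 scaleN1r opprK addNr.
Qed.
Lemma bdiff_lact a f : bdiff (fun s => lact a (f s)) = (fun s => lact a (bdiff f s)).
Proof.
apply/funext => s; elim: s f => [|b s IH] f /=; first by rewrite (linear_zeroE (lact_linr a)).
rewrite IH -!scaleN1r lactD !lactZ; congr (_ *: _ + _).
by case: s {IH} => [|c s] //=; rewrite lract.
Qed.

Lemma diff_diff f : diff (diff f) = 0.
Proof.
apply/funext => -[|a s] //; rewrite diff_bdiff [bdiff _ _]/=.
have -> : (fun t => diff f (a :: t)) = 1 *: (fun s => lact a (f s)) +
    (-1 *: lmerge a f + (-1 *: bdiff (fun t => f (a :: t)) + 0)).
  by apply/funext => t; rewrite !lincombE diff_bdiff /= !scaleN1r scale1r addr0.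
rewrite !bdiff_lin bdiff_bdiff (linear_zeroE bdiff_lin) bdiff_lmerge bdiff_lact.
rewrite scaler0 !addr0 [LHS](_ : _ = lact a (diff f s) + (- lmerge a (diff f) s -
  (1 *: lact a (bdiff f s) + -1 *: lmerge a (bdiff f) s))) //.
rewrite scaleN1r scale1r; case: s => [|b s].
  by rewrite /= (linear_zeroE (lact_linr a)) (linear_zeroE (ract_linl a)) !subr0 ?addr0 ?oppr0.
rewrite /lmerge !diff_bdiff lactM lactD opprB opprD.
move: (lact a (lact b _)) (lact a (bdiff _ _)) (bdiff f (a * b :: s)) => X Y Z.
by rewrite !addrA subrK [X in X - _ - _]addrC addrK subrr.
Qed.

Definition trunc (n : nat) f (s : seq A) : B := if size s == n then f s else 0.

Lemma trunc_homog n f : homogeneous n (trunc n f).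
Proof. by move=> s /negPf h; rewrite /trunc h. Qed.
Lemma trunc_id n f : homogeneous n f -> trunc n f = f.
Proof. by move=> h; apply/funext => s; rewrite /trunc; case: eqP => // /eqP/h. Qed.
Lemma trunc_lin n : linear (trunc n).
Proof.
move=> c f g; apply/funext => s; rewrite lincombE /trunc; case: ifP => // _.
by rewrite scaler0 addr0.
Qed.
Lemma trunc_multilinear n f : multilinear f -> multilinear (trunc n f).
Proof.
move=> mf s1 s2 c x y; rewrite /trunc !size_cat /=; case: ifP => _.
  exact: (mf s1 s2).
by rewrite scaler0 addr0.
Qed.
Lemma homog_bounded n f : homogeneous n f -> bounded f.
Proof. by move=> h; exists n.+1 => s lt; rewrite h // gtn_eqF. Qed.

Lemma diff_trunc n f : diff (trunc n f) = trunc n.+1 (diff f).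
Proof.
apply/funext => -[|a t]; first by rewrite /trunc.
rewrite /trunc [size (a :: t)]/= eqSS.
have [E|ne] := eqVneq (size t) n.
  rewrite /= E eqxx size_belast E eqxx; congr (_ + _ + _).
  apply: eq_bigr => i _; rewrite size_merge /=; last by rewrite ltnS E.
  by rewrite E eqxx.
rewrite /= (negPf ne) size_belast (negPf ne).
rewrite (linear_zeroE (lact_linr a)) (linear_zeroE (ract_linl _)) scaler0 addr0 add0r.
rewrite big1 // => i _; rewrite size_merge /=; last by rewrite ltnS.
by rewrite (negPf ne) scaler0.
Qed.

Lemma diff_homog n f : homogeneous n f -> homogeneous n.+1 (diff f).
Proof. by move/trunc_id => <-; rewrite diff_trunc; exact: trunc_homog. Qed.

Definition ncocycle n : set (seq A -> B) :=
  [set f | [/\ multilinear f, homogeneous n f & diff f = 0]].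
Definition ncoboundary n : set (seq A -> B) :=
  [set f | if n is m.+1 then
     exists u, [/\ multilinear u, homogeneous m u & f = diff u] else f = 0].

Lemma multilinear_sub c f g : multilinear f -> multilinear g -> multilinear (c *: f + g).
Proof.
move=> mf mg s1 s2 e x y; rewrite !lincombE (mf s1 s2) (mg s1 s2).
rewrite !scalerDr !scalerA (mulrC c) -!addrA; congr (_ + _).
by rewrite addrCA.
Qed.
Lemma multilinear0 : multilinear (0 : seq A -> B).
Proof. by move=> s1 s2 c x y; rewrite [RHS]addr0 [RHS]scaler0. Qed.
Lemma homog_sub n c f g : homogeneous n f -> homogeneous n g -> homogeneous n (c *: f + g).
Proof. by move=> hf hg s ne; rewrite lincombE hf // hg // scaler0 addr0. Qed.

Lemma ncocycle_subspace n : subspace (ncocycle n).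
Proof.
split; first by split; [exact: multilinear0| |exact: diff0].
move=> c f g [mf hf df] [mg hg dg]; split.
- exact: multilinear_sub.
- exact: homog_sub.
- by rewrite diff_linear df dg scaler0 addr0.
Qed.
Lemma ncoboundary_subspace n : subspace (ncoboundary n).
Proof.
case: n => [|n].
  by split=> // c f g -> ->; rewrite /ncoboundary /= scaler0 addr0.
split; first by exists 0; split; [exact: multilinear0| |rewrite diff0].
move=> c _ _ [u [mu hu ->]] [v [mv hv ->]]; exists (c *: u + v); split.
- exact: multilinear_sub.
- exact: homog_sub.
- by rewrite diff_linear.
Qed.

Lemma ncocycle_cocycle n f : ncocycle n f -> f \in @cocycle k A B.
Proof. by case=> mf /homog_bounded bf df; apply/asboolP. Qed.

Lemma trunc_ncocycle n (z : Zcoc B) : ncocycle n (trunc n z).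
Proof.
have [[mz _] dz] := cocycleP z; split; [exact: trunc_multilinear|exact: trunc_homog|].
by rewrite diff_trunc dz; exact: (linear_zeroE (@trunc_lin n.+1)).
Qed.
Definition ztrunc n z : Zcoc B := MkZcoc (ncocycle_cocycle (trunc_ncocycle n z)).

Lemma coboundary_trunc n (z : Zcoc B) : z \in @coboundary k A B -> ncoboundary n (trunc n z).
Proof.
move=> /asboolP[u [mu _] ->]; case: n => [|n].
  by rewrite /ncoboundary /=; apply/funext => -[].
exists (trunc n u); split; [exact: trunc_multilinear|exact: trunc_homog|].
by rewrite diff_trunc.
Qed.
Lemma ncoboundary_coboundary n (z : Zcoc B) : ncoboundary n z -> z \in @coboundary k A B.
Proof.
move=> h; apply/asboolP; case: n h => [z0|n [u [mu hu zE]]].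
  by exists 0; [exact: is_cochain0|rewrite diff0].
by exists u => //; split=> //; exact: homog_bounded hu.
Qed.

Definition coh_gpr n (x : coh B) : coh B := cls (ztrunc n (repr x)).

Lemma ncoboundary_cls n (z : Zcoc B) : ncoboundary n z -> cls z = 0.
Proof. by move=> h; rewrite -cls0; apply/clsE; rewrite subr0; exact: ncoboundary_coboundary h. Qed.
Lemma cls_ncoboundary n (z : Zcoc B) : homogeneous n z -> cls z = 0 -> ncoboundary n z.
Proof.
move=> hz; rewrite -cls0 => /clsE; rewrite subr0 => /(coboundary_trunc n).
by rewrite trunc_id.
Qed.

Lemma coh_gpr_cls n z : coh_gpr n (cls z) = cls (ztrunc n z).
Proof.
apply/clsE; apply: (@ncoboundary_coboundary n).
have := coboundary_trunc n (repr_cls z); congr (ncoboundary n).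
apply/funext => s.
rewrite [RHS](_ : _ = trunc n (repr (cls z)) s - trunc n z s) // /trunc.
by case: ifP => // _; rewrite subrr.
Qed.

Lemma coh_gpr_lin n : linear (coh_gpr n).
Proof.
move=> c x y; rewrite -(clsK x) -(clsK y).
have cZ d z : d *: cls z = cls (d *: z) by rewrite clsZ.
rewrite cZ -clsD !coh_gpr_cls cZ -clsD; congr cls; apply: val_inj.
exact: trunc_lin.
Qed.

Lemma coh_gprK m n x : coh_gpr m (coh_gpr n x) = if m == n then coh_gpr n x else 0.
Proof.
rewrite -(clsK x) !coh_gpr_cls; case: eqP => [->|ne].
  by congr cls; apply: val_inj; rewrite /= trunc_id //; exact: trunc_homog.
rewrite -cls0; congr cls; apply: val_inj; apply/funext => s.
by rewrite /= /trunc; case: eqP => [->|//]; case: eqP.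
Qed.

Lemma cls_sum n (F : nat -> Zcoc B) : cls (\sum_(i < n) F i) = \sum_(i < n) cls (F i).
Proof. exact: (big_morph _ (@clsD _ _ _) (@cls0 _ _ _)). Qed.
Lemma zval_sum n (F : nat -> Zcoc B) s : zval (\sum_(i < n) F i) s = \sum_(i < n) zval (F i) s.
Proof. by elim: n => [|n IH]; rewrite ?big_ord0 // !big_ord_recr /= -IH. Qed.

Lemma coh_gpr_sum x : exists N, x = \sum_(i < N) coh_gpr i x /\
  forall i, (N <= i)%N -> coh_gpr i x = 0.
Proof.
rewrite -(clsK x); set z := repr x; have [[_ [N bz]] _] := cocycleP z.
exists N; split.
  under eq_bigr => i _ do rewrite coh_gpr_cls.
  rewrite -(@cls_sum N (fun i => ztrunc i z)); congr cls; apply: val_inj; apply/funext => s.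
  rewrite [RHS](@zval_sum N (fun i => ztrunc i z)) /= /trunc.
  have [lt|le] := ltnP (size s) N.
    rewrite (bigD1 (Ordinal lt)) //= eqxx big1 ?addr0 // => i ni.
    by case: eqP => // E; case/eqP: ni; exact: val_inj.
  by rewrite bz // big1 // => i _; case: ifP.
move=> i le; rewrite coh_gpr_cls -cls0; congr cls; apply: val_inj; apply/funext => s.
by rewrite /= /trunc; case: eqP => // E; rewrite bz // E.
Qed.

Definition coh_grading : grading (coh B) := Grading coh_gpr_lin coh_gprK coh_gpr_sum.

Lemma in_degreeP n (x : coh B) : in_degree n x <-> deg coh_grading n x.
Proof.
split=> [[z hz ->]|<-]; last by exists (ztrunc n (repr x)) => // s /(trunc_homog (zval (repr x))).
by rewrite /deg /= coh_gpr_cls; congr cls; apply: val_inj; exact: trunc_id.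
Qed.

Lemma deg_cls n (z : Zcoc B) : homogeneous n z -> deg coh_grading n (cls z).
Proof. by move=> h; apply/in_degreeP; exists z. Qed.

(** An upper bound on the dimension of the cohomology in degree [n], stated on cochains so that maps
    of complexes apply without passing to classes. *)
Definition cspan n t := spanned (ncocycle n) (ncoboundary n) t.
Definition vanishes n := ncocycle n `<=` ncoboundary n.

Lemma cspan0 n : cspan n 0 <-> vanishes n.
Proof. by apply: spanned0P; case: (ncocycle_subspace n). Qed.

(** The homogeneous elements of [Zcoc] map both to cochains, by [zval], and to classes, by [cls];
    both maps are bijective modulo coboundaries. *)
Lemma cspan_coh n t : cspan n t <-> spanned (deg coh_grading n) [set 0] t.
Proof.
have Zsub : subspace [set z : Zcoc B | homogeneous n z].
  by split=> // c x y hx hy; exact: homog_sub.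
have Wsub : subspace [set z : Zcoc B | ncoboundary n z].
  have [h0 hl] := ncoboundary_subspace n.
  by split=> // c x y hx hy; exact: hl.
have lcls : linear (@cls _ _ B) by move=> c x y; rewrite clsD clsZ.
have mid : spanned [set z : Zcoc B | homogeneous n z] [set z : Zcoc B | ncoboundary n z] t <->
    cspan n t.
  split.
    apply: (@spanned_image _ _ _ _ _ _ _ (fun z : Zcoc B => zval z)) => //.
    - by move=> z hz; have [[mz _] dz] := cocycleP z.
    - move=> f nf; exists (MkZcoc (ncocycle_cocycle nf)); first by case: nf.
      by rewrite subrr; case: (ncoboundary_subspace n).
    - exact: ncoboundary_subspace.
  apply: (@spanned_lift _ _ _ _ _ _ _ (fun z : Zcoc B => zval z)) => //.
  - exact: ncoboundary_subspace.
  - move=> f nf; exists (MkZcoc (ncocycle_cocycle nf)); first by case: nf.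
    by rewrite subrr; case: (ncoboundary_subspace n).
  - by move=> z hz; have [[mz _] dz] := cocycleP z.
rewrite -mid; split.
  apply: (@spanned_image _ _ _ _ _ _ _ (@cls _ _ B)) => //.
  - by move=> z; exact: deg_cls.
  - by move=> z; exact: ncoboundary_cls.
  - move=> x /in_degreeP[z hz ->]; exists z => //; rewrite subrr //.
  - exact: subspace0.
apply: (@spanned_lift _ _ _ _ _ _ _ (@cls _ _ B)) => //.
- exact: subspace0.
- move=> x /in_degreeP[z hz ->]; exists z => //; rewrite subrr //.
- by move=> z; exact: deg_cls.
- by move=> z hz /(cls_ncoboundary hz).
Qed.

Lemma vanishesP n : vanishes n <-> forall x, deg coh_grading n x -> x = 0.
Proof.
rewrite -cspan0 cspan_coh; apply: spanned0P; exact: (deg_subspace coh_grading n).1.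
Qed.
End One.
End Cochains.

(** * The long exact sequence *)

Section BimodMaps.
Variables (k : fieldType) (A : falgType k).

Record bimod_hom (B1 B2 : bimod A) := BimodHom {
  bfun :> B1 -> B2;
  bfun_lin : linear bfun;
  bfun_lact : forall a x, bfun (lact a x) = lact a (bfun x);
  bfun_ract : forall x a, bfun (ract x a) = ract (bfun x) a
}.

Section LinearPost.
Variables (L1 L2 : lmodType k) (f : L1 -> L2).
Hypothesis lf : linear f.
Lemma comp_linear : linear (fun g : seq A -> L1 => f \o g).
Proof. by move=> c x y; apply/funext => s; rewrite /comp /= lf. Qed.
End LinearPost.

Section Post.
Variables (B1 B2 : bimod A).

Lemma multilinear_comp (f : B1 -> B2) g :
  linear f -> multilinear g -> multilinear (f \o g).
Proof. by move=> lf mg s1 s2 c x y; rewrite /= (mg s1 s2) lf. Qed.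
Lemma homog_comp (f : B1 -> B2) n g :
  linear f -> homogeneous n g -> homogeneous n (f \o g).
Proof. by move=> lf hg s ne; rewrite /= hg // linear_zeroE. Qed.

Variable f : bimod_hom B1 B2.
Let fD := linear_addE (bfun_lin f).
Let f0 := linear_zeroE (bfun_lin f).
Let fZ := linear_scaleE (bfun_lin f).

Lemma diff_comp g : diff (f \o g) = f \o diff g.
Proof.
apply/funext => -[|a t] /=; first by rewrite f0.
rewrite !fD fZ bfun_lact bfun_ract (big_morph f fD f0).
by congr (_ + _ + _); apply: eq_bigr => i _; rewrite fZ.
Qed.

Lemma ncocycle_comp n g : ncocycle n g -> ncocycle n (f \o g).
Proof.
have lf := bfun_lin f; case=> mg hg dg; split.
- exact: multilinear_comp.
- exact: homog_comp.
- by rewrite diff_comp dg; apply/funext => s /=; rewrite f0.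
Qed.
Lemma ncoboundary_comp n g : ncoboundary n g -> ncoboundary n (f \o g).
Proof.
have lf := bfun_lin f; case: n => [->|n [u [mu hu ->]]].
  by apply/funext => s /=; rewrite f0.
exists (f \o u); split; [exact: multilinear_comp|exact: homog_comp|].
by rewrite diff_comp.
Qed.

Fact comp_cocycle (z : Zcoc B1) : f \o z \in @cocycle k A B2.
Proof.
have lf := bfun_lin f; have [[mz [N bz]] dz] := cocycleP z; apply/asboolP; split.
  split; first exact: multilinear_comp.
  by exists N => s /bz sN; rewrite /= sN f0.
by rewrite diff_comp dz; apply/funext => s /=; rewrite f0.
Qed.
Definition zcomp z := MkZcoc (comp_cocycle z).
Definition coh_map (x : coh B1) : coh B2 := cls (zcomp (repr x)).

Lemma coh_map_cls z : coh_map (cls z) = cls (zcomp z).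
Proof.
have lf := bfun_lin f.
have /asboolP[u [mu [N bu]] du] := repr_cls z; apply/clsE/asboolP.
exists (f \o u).
  by split; [exact: multilinear_comp|exists N => s /bu sN; rewrite /= sN f0].
rewrite diff_comp -du; apply/funext => s.
transitivity (f (zval (repr (cls z)) s) - f (z s)) => //.
by rewrite -scaleN1r -fZ -fD scaleN1r.
Qed.
Lemma coh_mapD x y : coh_map (x + y) = coh_map x + coh_map y.
Proof.
rewrite -(clsK x) -(clsK y) -clsD !coh_map_cls -clsD; congr cls.
by apply: val_inj; apply/funext => s /=; rewrite fD.
Qed.
Lemma coh_map0 : coh_map 0 = 0.
Proof. by apply: (addrI (coh_map 0)); rewrite -coh_mapD !addr0. Qed.
Lemma coh_map_gpr n x : coh_map (coh_gpr n x) = coh_gpr n (coh_map x).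
Proof.
rewrite -(clsK x) coh_gpr_cls !coh_map_cls coh_gpr_cls; congr cls; apply: val_inj.
by apply/funext => s; rewrite /= /trunc; case: ifP.
Qed.
End Post.

(** The section and the retraction are only k-linear. Keeping them as data turns the connecting
    homomorphism into a formula on cochains. *)
Record bimod_ses (B1 B2 B3 : bimod A) := BimodSes {
  ses_i : bimod_hom B1 B2;
  ses_p : bimod_hom B2 B3;
  ses_r : B2 -> B1;
  ses_s : B3 -> B2;
  ses_r_lin : linear ses_r;
  ses_s_lin : linear ses_s;
  ses_ri : forall x, ses_r (ses_i x) = x;
  ses_ps : forall x, ses_p (ses_s x) = x;
  ses_split : forall x, ses_i (ses_r x) + ses_s (ses_p x) = x
}.

Section Ses.
Variables (B1 B2 B3 : bimod A) (E : bimod_ses B1 B2 B3).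
Notation i := (ses_i E).
Notation p := (ses_p E).
Notation r := (ses_r E).
Notation s := (ses_s E).
Let lr := ses_r_lin E.
Let ls := ses_s_lin E.
Let li := bfun_lin i.
Let lp := bfun_lin p.

Lemma ses_i_inj x : i x = 0 -> x = 0.
Proof. by move=> ix; rewrite -(ses_ri E x) ix (linear_zeroE lr). Qed.
Lemma ses_pi x : p (i x) = 0.
Proof.
have := ses_split E (i x); rewrite ses_ri -[X in _ = X]addr0 => /addrI spi.
by rewrite -(ses_ps E (p (i x))) spi (linear_zeroE lp).
Qed.
Lemma ses_ker x : p x = 0 -> i (r x) = x.
Proof. by move=> px; rewrite -[RHS](ses_split E) px (linear_zeroE ls) addr0. Qed.

Lemma ses_p_diff_s u t : p (diff (s \o u) t) = diff u t.
Proof.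
transitivity (diff (p \o (s \o u)) t); first by rewrite diff_comp.
by congr (diff _ t); apply/funext => t'; exact: ses_ps.
Qed.
Lemma ses_i_diff0 f : diff (i \o f) = 0 -> diff f = 0.
Proof.
rewrite diff_comp => h; apply/funext => t; apply: ses_i_inj.
exact: (congr1 (fun g => g t) h).
Qed.

(** If [p] maps the cocycle [z] to [diff u], then [z - diff (s \o u)] is killed by [p] and therefore
    comes from a cocycle in [B1]. *)
Lemma coh_exact (x : coh B2) : coh_map p x = 0 -> exists y, x = coh_map i y.
Proof.
rewrite -(clsK x) coh_map_cls -cls0; set z := repr x.
have [[mz [N bz]] dz] := cocycleP z.
move=> /clsE/asboolP[u [mu [M bu]] du].
pose v := -1 *: diff (s \o u) + zval z.
have pv t : p (v t) = 0.
  rewrite /v lincombE lp ses_p_diff_s.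
  have := congr1 (fun h => h t) du; rewrite (_ : zval (_ - _) t = p (z t) - 0) // => <-.
  by rewrite subr0 scaleN1r addNr.
have msu : is_cochain (s \o u).
  split; first exact: multilinear_comp.
  by exists M => t /bu tM; rewrite /= tM (linear_zeroE ls).
have ivE : i \o (r \o v) = v by apply/funext => t /=; rewrite ses_ker.
have w_coc : (r \o v) \in @cocycle k A B1.
  apply/asboolP; split.
    split.
      apply: multilinear_comp => //; apply: multilinear_sub => //.
      by apply: diff_multilinear; case: msu.
    exists (maxn M.+1 N) => t; rewrite geq_max => /andP[h1 h2] /=.
    rewrite /v lincombE bz // addr0; case: t h1 {h2} => [//|a t] h1.
    have h1' : (M <= size t)%N by [].
    rewrite [diff _ _](_ : _ = 0) ?scaler0 ?(linear_zeroE lr) // /=.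
    rewrite bu // (linear_zeroE ls) (linear_zeroE (lact_linr a)).
    rewrite bu ?size_belast // (linear_zeroE ls) (linear_zeroE (ract_linl _)) scaler0 addr0 add0r.
    rewrite big1 // => j _; rewrite bu ?(linear_zeroE ls) ?scaler0 //.
    by rewrite size_merge /= ?ltnS.
  by apply: ses_i_diff0; rewrite ivE /v diff_linear diff_diff dz addr0 scaler0.
exists (cls (MkZcoc w_coc)); rewrite coh_map_cls; apply/clsE/asboolP.
exists (s \o u) => //.
apply/funext => t; rewrite (_ : zval (_ - _) t = z t - i (r (v t))) //.
rewrite ses_ker // /v lincombE scaleN1r opprD opprK addrCA subrr addr0 //.
Qed.

(** The snake construction: lift by the section, differentiate, and return to [B1]. *)
Definition connecting (g : seq A -> B3) : seq A -> B1 := r \o diff (s \o g).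

Lemma connecting_linear : linear connecting.
Proof.
move=> c x y; rewrite /connecting (comp_linear ls) diff_linear.
by apply/funext => t /=; rewrite lr.
Qed.

Lemma i_connecting g : diff g = 0 -> i \o connecting g = diff (s \o g).
Proof.
by move=> dg; apply/funext => t /=; apply: ses_ker; rewrite ses_p_diff_s dg.
Qed.

Lemma connecting_cocycle n g : ncocycle n g -> ncocycle n.+1 (connecting g).
Proof.
case=> mg hg dg; split.
- apply: multilinear_comp => //; apply: diff_multilinear; exact: multilinear_comp.
- apply: homog_comp => //; apply: diff_homog; exact: homog_comp.
by apply: ses_i_diff0; rewrite i_connecting // diff_diff.
Qed.

(** For [g = diff u], the defect [s \o diff u - diff (s \o u)] comes from [B1], and there it bounds
    [connecting g]. *)
Lemma connecting_coboundary n g : ncoboundary n g -> ncoboundary n.+1 (connecting g).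
Proof.
case: n => [->|n [u [mu hu ->]]].
  exists 0; split; first exact: multilinear0.
    by [].
  rewrite /connecting diff0; have -> : s \o (0 : seq A -> B3) = 0.
    by apply/funext => t /=; exact: (linear_zeroE ls).
  by rewrite diff0; apply/funext => t /=; exact: (linear_zeroE lr).
pose v := -1 *: diff (s \o u) + (s \o diff u).
have ivE : i \o (r \o v) = v.
  apply/funext => t /=; apply: ses_ker; rewrite /v lincombE lp ses_ps ses_p_diff_s.
  by rewrite scaleN1r addNr.
exists (r \o v); split.
- apply: multilinear_comp => //; apply: multilinear_sub.
    by apply: diff_multilinear; exact: multilinear_comp.
  by apply: multilinear_comp => //; exact: diff_multilinear.
- apply: homog_comp => //; apply: homog_sub.
    by apply: diff_homog; exact: homog_comp.
  by apply: homog_comp => //; exact: diff_homog.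
have h : i \o diff (r \o v) = diff (s \o diff u).
  by rewrite -diff_comp ivE /v diff_linear diff_diff scaler0 add0r.
apply/funext => t; rewrite /connecting /=.
by have := congr1 (fun f => r (f t)) h; rewrite /= ses_ri.
Qed.

(** Since [i \o f] bounds some [u], the cocycle [p \o u] is a preimage; the part of [u] in [B1], cut
    out by the splitting, bounds the error. *)
Lemma connecting_onto n f : vanishes B2 n.+1 -> ncocycle n.+1 f ->
  exists2 g, ncocycle n g & ncoboundary n.+1 (f - connecting g).
Proof.
move=> van nf; have [mf hf df] := nf.
have /van[u [mu hu ifE]] := ncocycle_comp i nf.
have dpu : diff (p \o u) = 0.
  by rewrite diff_comp -ifE; apply/funext => t /=; rewrite ses_pi.
exists (p \o u).
  by split=> //; [exact: multilinear_comp|exact: homog_comp].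
pose v := -1 *: (s \o (p \o u)) + u.
have ivE : i \o (r \o v) = v.
  by apply/funext => t /=; apply: ses_ker; rewrite /v lincombE lp /= ses_ps scaleN1r addNr.
exists (r \o v); split.
- apply: multilinear_comp => //; apply: multilinear_sub => //.
  by apply: multilinear_comp => //; exact: multilinear_comp.
- apply: homog_comp => //; apply: homog_sub => //.
  by apply: homog_comp => //; exact: homog_comp.
have h : i \o diff (r \o v) = -1 *: diff (s \o (p \o u)) + (i \o f).
  by rewrite -diff_comp ivE /v diff_linear ifE.
apply/funext => t; have := congr1 (fun f => r (f t)) h; rewrite /= ses_ri => ->.
by rewrite lr ses_ri scaleN1r addrC.
Qed.

(** If [connecting g = diff u], subtracting [i \o u] from the lift [s \o g] makes it a cocycle. *)
Lemma connecting_ker n g : ncocycle n g -> ncoboundary n.+1 (connecting g) ->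
  exists2 h, ncocycle n h & p \o h = g.
Proof.
move=> [mg hg dg] [u [mu hu gE]].
exists (-1 *: (i \o u) + (s \o g)).
  split.
  - by apply: multilinear_sub; exact: multilinear_comp.
  - by apply: homog_sub; exact: homog_comp.
  - by rewrite diff_linear diff_comp -gE i_connecting // scaleN1r addNr.
by apply/funext => t /=; rewrite lincombE lp /= ses_pi ses_ps scaler0 add0r.
Qed.

Lemma connecting_image n h : ncocycle n h -> ncoboundary n.+1 (connecting (p \o h)).
Proof.
move=> [mh hh dh]; exists (-1 *: (r \o h) + 0); split.
- by apply: multilinear_sub; [exact: multilinear_comp|exact: multilinear0].
- by apply: homog_sub => //; exact: homog_comp.
have spE : s \o (p \o h) = -1 *: (i \o (r \o h)) + h.
  apply/funext => t; rewrite lincombE scaleN1r /= -[X in _ = _ + X](ses_split E (h t)).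
  by rewrite addKr.
apply/funext => t; rewrite /connecting spE diff_linear dh addr0 diff_comp addr0 diffZ /=.
by rewrite [X in r X](_ : _ = -1 *: i (diff (r \o h) t)) // (linear_scaleE lr) ses_ri.
Qed.

Lemma cspan_shift n t : vanishes B2 n.+1 -> cspan B3 n t -> cspan B1 n.+1 t.
Proof.
move=> van; apply: (@spanned_image _ _ _ _ _ _ _ connecting).
- exact: connecting_linear.
- by move=> g; exact: connecting_cocycle.
- by move=> g; exact: connecting_coboundary.
- by move=> f; exact: connecting_onto.
- exact: ncoboundary_subspace.
Qed.

(** The second hypothesis says that [p] is zero on cohomology in degree [n]; this makes the
    connecting map injective. *)
Lemma cspan_unshift n t : vanishes B2 n.+1 ->
  (forall h, ncocycle n h -> ncoboundary n (p \o h)) ->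
  cspan B1 n.+1 t -> cspan B3 n t.
Proof.
move=> van h0; apply: (@spanned_lift _ _ _ _ _ _ _ connecting).
- exact: connecting_linear.
- exact: ncocycle_subspace.
- exact: ncoboundary_subspace.
- by move=> f; exact: connecting_onto.
- by move=> g; exact: connecting_cocycle.
- move=> g ng cg; have [h nh <-] := connecting_ker ng cg; exact: h0.
Qed.

Lemma vanishes_shift n : vanishes B2 n.+1 -> vanishes B3 n -> vanishes B1 n.+1.
Proof. by move=> van /cspan0 sp; apply/cspan0; exact: cspan_shift. Qed.

Lemma vanishes_unshift n : vanishes B2 n -> vanishes B2 n.+1 ->
  vanishes B1 n.+1 -> vanishes B3 n.
Proof.
move=> van van1 /cspan0 sp; apply/cspan0; apply: cspan_unshift sp => // h /van.
exact: ncoboundary_comp.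
Qed.

Lemma vanishes_middle n : vanishes B1 n -> vanishes B3 n -> vanishes B2 n.
Proof.
move=> /vanishesP v1 /vanishesP v3; apply/vanishesP => x dx.
have [|y xE] := @coh_exact x; first by apply: v3; rewrite /deg /= -coh_map_gpr [coh_gpr n x]dx.
by rewrite -dx xE -[LHS]coh_map_gpr (v1 (coh_gpr n y)) ?coh_map0 //; exact: deg_gpr.
Qed.
End Ses.
End BimodMaps.

(** * Modules, short exact sequences and coinduced modules *)

Section LinHom.
Variables (k : fieldType) (U V : vectType k) (f : U -> V) (lf : linear f).
Definition lin_hom : 'Hom(U, V) :=
  linfun (HB.pack_for {linear U -> V} f (GRing.isLinear.Build _ _ _ _ f lf)).
Lemma lin_homE x : lin_hom x = f x.
Proof. by rewrite /lin_hom lfunE. Qed.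
End LinHom.

Lemma sub_lfunE (k : fieldType) (U V : vectType k) (f g : 'Hom(U, V)) x :
  (f - g) x = f x - g x.
Proof. by rewrite add_lfunE opp_lfunE. Qed.

Section Modules.
Variables (k : fieldType) (A : falgType k).
Implicit Types M N X : fgMod A.

Lemma act1E M (m : M) : act M 1 m = m.
Proof. by rewrite act1 id_lfunE. Qed.
Lemma actME M a b (m : M) : act M (a * b) m = act M a (act M b m).
Proof. by rewrite actM comp_lfunE. Qed.
Lemma act_lin M (m : M) : linear (fun a => act M a m).
Proof. by move=> c a b; rewrite act_linear add_lfunE scale_lfunE. Qed.

Lemma is_hom_comp M N X (g : 'Hom(N, X)) (f : 'Hom(M, N)) :
  is_hom g -> is_hom f -> is_hom (g \o f)%VF.
Proof. by move=> hg hf a m; rewrite !comp_lfunE hf hg. Qed.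
Lemma is_hom_id M : is_hom (\1%VF : 'Hom(M, M)).
Proof. by move=> a m; rewrite !id_lfunE. Qed.
Lemma is_hom_lfun M N (f : 'Hom(M, N)) : is_hom f ->
  forall a, (f \o act M a)%VF = (act N a \o f)%VF.
Proof. by move=> hf a; apply/lfunP => m; rewrite !comp_lfunE hf. Qed.
Lemma is_homP M N (f : 'Hom(M, N)) :
  (forall a, (f \o act M a)%VF = (act N a \o f)%VF) -> is_hom f.
Proof. by move=> h a m; have /lfunP/(_ m) := h a; rewrite !comp_lfunE. Qed.
Lemma is_hom_lincomb M N c (f g : 'Hom(M, N)) :
  is_hom f -> is_hom g -> is_hom (c *: f + g).
Proof.
by move=> hf hg a m; rewrite !add_lfunE !scale_lfunE hf hg linearP.
Qed.
Lemma is_hom0 M N : is_hom (0 : 'Hom(M, N)).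
Proof. by move=> a m; rewrite !zero_lfunE linear0. Qed.

Lemma lker_submod M N (f : 'Hom(M, N)) : is_hom f -> is_submod (lker f).
Proof. by move=> hf a m; rewrite !memv_ker hf => /eqP ->; rewrite linear0. Qed.
Lemma limg_submod M N (f : 'Hom(M, N)) : is_hom f -> is_submod (limg f).
Proof.
by move=> hf a m /memv_imgP[x _ ->]; rewrite -hf memv_img ?memvf.
Qed.

Section Precomp.
Variables (M M' N : fgMod A) (f : 'Hom(M', M)) (hf : is_hom f).
Definition pre_hom : bimod_hom (hom_bimod M N) (hom_bimod M' N).
Proof.
refine (@BimodHom k A (hom_bimod M N) (hom_bimod M' N) (fun g : 'Hom(M, N) => g \o f)%VF _ _ _).
- by move=> c x y; rewrite comp_lfunDl comp_lfunZl.
- by move=> a x; rewrite /= comp_lfunA.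
- by move=> x a; rewrite /= -!comp_lfunA is_hom_lfun.
Defined.
End Precomp.
Section Postcomp.
Variables (M N N' : fgMod A) (f : 'Hom(N, N')) (hf : is_hom f).
Definition post_hom : bimod_hom (hom_bimod M N) (hom_bimod M N').
Proof.
refine (@BimodHom k A (hom_bimod M N) (hom_bimod M N') (fun g : 'Hom(M, N) => f \o g)%VF _ _ _).
- by move=> c x y; rewrite comp_lfunDr comp_lfunZr.
- by move=> a x; rewrite /= !comp_lfunA is_hom_lfun.
- by move=> x a; rewrite /= comp_lfunA.
Defined.
End Postcomp.

Record mod_ses (M1 M2 M3 : fgMod A) := ModSes {
  ms_i : 'Hom(M1, M2);
  ms_p : 'Hom(M2, M3);
  ms_hi : is_hom ms_i;
  ms_hp : is_hom ms_p;
  ms_inj : lker ms_i = 0%VS;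
  ms_exact : limg ms_i = lker ms_p;
  ms_surj : limg ms_p = fullv
}.

Section Ses.
Variables (M1 M2 M3 : fgMod A) (E : mod_ses M1 M2 M3).
Notation i := (ms_i E).
Notation p := (ms_p E).
Definition ms_s : 'Hom(M3, M2) := (p^-1)%VF.
Definition ms_r : 'Hom(M2, M1) := (i^-1 \o (\1 - (ms_s \o p)))%VF.

Lemma ms_iK x : (i^-1)%VF (i x) = x.
Proof. by apply: lker0_lfunK; apply/eqP; exact: ms_inj. Qed.
Lemma ms_pi : (p \o i)%VF = 0.
Proof.
apply/lfunP => x; rewrite comp_lfunE zero_lfunE; apply/eqP.
by rewrite -memv_ker -ms_exact memv_img ?memvf.
Qed.
Lemma ms_ps : (p \o ms_s)%VF = \1%VF.
Proof.
apply/lfunP => x; rewrite comp_lfunE id_lfunE limg_lfunVK // ms_surj memvf //.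
Qed.
Lemma ms_ri : (ms_r \o i)%VF = \1%VF.
Proof.
apply/lfunP => x; rewrite !comp_lfunE id_lfunE sub_lfunE id_lfunE comp_lfunE.
have /lfunP/(_ x) := ms_pi; rewrite comp_lfunE zero_lfunE => ->.
by rewrite linear0 subr0 ms_iK.
Qed.
Lemma ms_split : ((i \o ms_r) + (ms_s \o p))%VF = \1%VF.
Proof.
apply/lfunP => x; rewrite add_lfunE !comp_lfunE id_lfunE sub_lfunE id_lfunE comp_lfunE.
rewrite limg_lfunVK ?subrK // ms_exact memv_ker linearB /=.
by have /lfunP/(_ (p x)) := ms_ps; rewrite comp_lfunE id_lfunE => ->; rewrite subrr.
Qed.
Lemma ms_dim : dim M2 = (dim M1 + dim M3)%N.
Proof.
rewrite -!dimvf -(limg_ker_dim p fullv) capfv -ms_exact ms_surj.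
by rewrite limg_dim_eq // ms_inj capv0.
Qed.

Definition hom_ses_l (N : fgMod A) :
  bimod_ses (hom_bimod M3 N) (hom_bimod M2 N) (hom_bimod M1 N).
Proof.
refine (@BimodSes k A _ _ _ (pre_hom N (ms_hp E)) (pre_hom N (ms_hi E))
  (fun f : 'Hom(M2, N) => f \o ms_s)%VF (fun f : 'Hom(M1, N) => f \o ms_r)%VF _ _ _ _ _).
- by move=> c x y; rewrite comp_lfunDl comp_lfunZl.
- by move=> c x y; rewrite comp_lfunDl comp_lfunZl.
- by move=> x; rewrite /= -comp_lfunA ms_ps comp_lfun1r.
- by move=> x; rewrite /= -comp_lfunA ms_ri comp_lfun1r.
- move=> x /=; have := ms_split; move: ms_r ms_s => r s Ers.
  by rewrite addrC -!comp_lfunA -comp_lfunDr Ers comp_lfun1r.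
Defined.

Definition hom_ses_r (N : fgMod A) :
  bimod_ses (hom_bimod N M1) (hom_bimod N M2) (hom_bimod N M3).
Proof.
refine (@BimodSes k A _ _ _ (post_hom N (ms_hi E)) (post_hom N (ms_hp E))
  (fun f : 'Hom(N, M2) => ms_r \o f)%VF (fun f : 'Hom(N, M3) => ms_s \o f)%VF _ _ _ _ _).
- by move=> c x y; rewrite comp_lfunDr comp_lfunZr.
- by move=> c x y; rewrite comp_lfunDr comp_lfunZr.
- by move=> x; rewrite /= comp_lfunA ms_ri comp_lfun1l.
- by move=> x; rewrite /= comp_lfunA ms_ps comp_lfun1l.
- move=> x /=; have := ms_split; move: ms_r ms_s => r s Ers.
  by rewrite !comp_lfunA -comp_lfunDl Ers comp_lfun1l.
Defined.
End Ses.

Section SubMod.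
Variables (M : fgMod A) (U : {vspace M}).
Hypothesis sU : is_submod U.

Fact sub_act_subproof a (x : subvs_of U) : act M a (vsval x) \in U.
Proof. exact/sU/subvsP. Qed.
Definition sub_incl : 'Hom(subvs_of U, M) := linfun vsval.
Lemma sub_inclE x : sub_incl x = vsval x. Proof. by rewrite lfunE. Qed.
Definition sub_act (a : A) : 'End(subvs_of U) :=
  (linfun (vsproj U) \o act M a \o sub_incl)%VF.
Lemma sub_actE a x : vsval (sub_act a x) = act M a (vsval x).
Proof. by rewrite !comp_lfunE lfunE sub_inclE /= vsprojK // sub_act_subproof. Qed.
Fact sub_act_linear : linear sub_act.
Proof.
move=> c a b; apply/lfunP => x; apply: val_inj; rewrite /= add_lfunE scale_lfunE.
by rewrite [LHS]sub_actE linearP /= !sub_actE (act_lin (vsval x)).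
Qed.
Fact sub_act1 : sub_act 1 = \1%VF.
Proof. by apply/lfunP => x; apply: val_inj; rewrite [LHS]sub_actE act1E id_lfunE. Qed.
Fact sub_actM a b : sub_act (a * b) = (sub_act a \o sub_act b)%VF.
Proof.
apply/lfunP => x; apply: val_inj.
by rewrite [LHS]sub_actE actME comp_lfunE [RHS]sub_actE sub_actE.
Qed.
Definition sub_mod : fgMod A := FgMod sub_act_linear sub_act1 sub_actM.

Lemma sub_incl_hom : is_hom (sub_incl : 'Hom(sub_mod, M)).
Proof. by move=> a x; rewrite !sub_inclE [LHS]sub_actE. Qed.
Lemma lker_sub_incl : lker sub_incl = 0%VS.
Proof.
apply/eqP; rewrite -subv0; apply/subvP => x; rewrite memv_ker sub_inclE memv0.
by move=> /eqP x0; apply/eqP; apply: val_inj.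
Qed.
Lemma limg_sub_incl : limg sub_incl = U.
Proof.
apply/vspaceP => x; apply/memv_imgP/idP => [[y _ ->]|Ux]; first by rewrite sub_inclE subvsP.
by exists (vsproj U x); rewrite ?memvf // sub_inclE /= vsprojK.
Qed.
Lemma dim_sub_mod : dim sub_mod = \dim U.
Proof. by []. Qed.

Lemma quo_proj_hom : is_hom (quo_proj U : 'Hom(M, quo_mod sU)).
Proof.
move=> a m.
have -> : act (quo_mod sU) a (quo_proj U m) =
    quo_proj U (act M a (quo_lift U (quo_proj U m))) by rewrite /= /quo_act 2!comp_lfunE.
apply/eqP; rewrite -subr_eq0 -linearB /=; apply/eqP/quo_proj_eq0.
rewrite -linearB /=; apply: sU; exact: quo_liftK.
Qed.
Lemma limg_quo_proj : limg (quo_proj U) = fullv.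
Proof.
apply/vspaceP => x; rewrite memvf; have /lfunP/(_ x) := quo_projK U.
by rewrite comp_lfunE id_lfunE => <-; rewrite memv_img ?memvf.
Qed.
Lemma lker_quo_proj : lker (quo_proj U) = U.
Proof.
apply/vspaceP => m; rewrite memv_ker; apply/eqP/idP => [m0|/quo_proj_eq0 //].
by have := quo_liftK U m; rewrite m0 linear0 subr0.
Qed.
Definition sub_ses : mod_ses sub_mod M (quo_mod sU).
Proof.
apply: (@ModSes _ _ _ (sub_incl : 'Hom(sub_mod, M)) (quo_proj U : 'Hom(M, quo_mod sU))).
- exact: sub_incl_hom.
- exact: quo_proj_hom.
- exact: lker_sub_incl.
- by rewrite limg_sub_incl lker_quo_proj.
- exact: limg_quo_proj.
Defined.
End SubMod.

Definition ker_ses (M N : fgMod A) (p : 'Hom(M, N)) (hp : is_hom p) (sp : limg p = fullv) :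
  mod_ses (sub_mod (lker_submod hp)) M N.
Proof.
apply: (@ModSes _ _ _ (sub_incl (lker p) : 'Hom(sub_mod (lker_submod hp), M)) p) => //.
- exact: sub_incl_hom.
- exact: lker_sub_incl.
- exact: limg_sub_incl.
Defined.

Definition coker_ses (M N : fgMod A) (i : 'Hom(M, N)) (hi : is_hom i) (ii : lker i = 0%VS) :
  mod_ses M N (quo_mod (limg_submod hi)).
Proof.
apply: (@ModSes _ _ _ i (quo_proj (limg i) : 'Hom(N, quo_mod (limg_submod hi)))) => //.
- exact: quo_proj_hom.
- by rewrite lker_quo_proj.
- exact: limg_quo_proj.
Defined.

Section Degree0.
Variables (M N : fgMod A).
Definition cochain0 (h : 'Hom(M, N)) (s : seq A) : hom_bimod M N :=
  if s is [::] then h else 0.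
Lemma cochain0_cocycle h : is_hom h -> ncocycle 0 (cochain0 h).
Proof.
move=> hh; split.
- by move=> [|b s1] s2 c x y /=; rewrite ?scaler0 ?addr0.
- by case.
apply/funext => -[|a [|b t]] //.
  by rewrite diff_sing /= is_hom_lfun // subrr.
rewrite /= !comp_lfun0r comp_lfun0l scaler0 addr0 add0r.
by rewrite big1 // => i _; rewrite /merge; case: (i : nat) => [|j] /=; rewrite scaler0.
Qed.
Lemma cocycle0_hom (z : seq A -> hom_bimod M N) : ncocycle 0 z -> is_hom (z [::] : 'Hom(M, N)).
Proof.
move=> [_ _ dz]; apply: is_homP => a; have := congr1 (fun f => f [:: a]) dz.
by rewrite diff_sing => /eqP; rewrite subr_eq0 => /eqP.
Qed.
Lemma cochain0E (z : seq A -> hom_bimod M N) : homogeneous 0 z -> z = cochain0 (z [::]).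
Proof. by move=> hz; apply/funext => -[|a s] //=; rewrite hz. Qed.
End Degree0.

(** * Coinduced modules and the vanishing of their higher Ext groups *)

Section Coinduced.
Variable V : vectType k.

Fact coind_act_subproof (a : A) : linear (fun g : 'Hom(A, V) => (g \o amulr a)%VF).
Proof. by move=> c x y; rewrite comp_lfunDl comp_lfunZl. Qed.
Definition coind_act (a : A) : 'End('Hom(A, V)) := lin_hom (coind_act_subproof a).
Lemma coind_actE a g b : coind_act a g b = g (b * a).
Proof. by rewrite lin_homE comp_lfunE lfunE. Qed.
Fact coind_act_linear : linear coind_act.
Proof.
move=> c a b; apply/lfunP => g; apply/lfunP => x.
by rewrite !(add_lfunE, scale_lfunE) !coind_actE mulrDr -scalerAr linearP.
Qed.
Fact coind_act1 : coind_act 1 = \1%VF.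
Proof. by apply/lfunP => g; apply/lfunP => x; rewrite coind_actE mulr1 id_lfunE. Qed.
Fact coind_actM a b : coind_act (a * b) = (coind_act a \o coind_act b)%VF.
Proof.
by apply/lfunP => g; apply/lfunP => x; rewrite comp_lfunE !coind_actE mulrA.
Qed.
(** Hom_k(A, V), the right adjoint of restriction from [A] to [k]. *)
Definition coind : fgMod A := FgMod coind_act_linear coind_act1 coind_actM.

Section Contraction.
Variables (X : fgMod A) (f : seq A -> hom_bimod X coind).
Hypothesis mf : multilinear f.
Let fval (b : A) (s : seq A) (x : X) : V := (f (b :: s) : 'Hom(X, coind)) x 1.
Fact contraction_lin1 s x : linear (fun b : A => fval b s x).
Proof.
move=> c a b; rewrite /fval (mf [::] s) /=.
by rewrite add_lfunE scale_lfunE [LHS]add_lfunE scale_lfunE.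
Qed.
Fact contraction_lin2 s : linear (fun x : X => lin_hom (contraction_lin1 s x) : 'Hom(A, V)).
Proof.
move=> c x y; apply/lfunP => b; rewrite [LHS]lin_homE [RHS]add_lfunE scale_lfunE !lin_homE.
by rewrite /fval linearP add_lfunE scale_lfunE.
Qed.
(** The contracting homotopy of the bar complex: the argument of the coinduced value becomes the
    first argument of [f], and the old value is taken at 1. *)
Definition contraction (s : seq A) : hom_bimod X coind := lin_hom (contraction_lin2 s).
Lemma contractionE s x b : (contraction s : 'Hom(X, coind)) x b = (f (b :: s) : 'Hom(X, coind)) x 1.
Proof. by rewrite /contraction !lin_homE. Qed.

(** Evaluate [diff f = 0] on [b, a, t] at the point 1. The term [lact b (f (a :: t))] gives the
    value of [f (a :: t)] at [b], and the remaining terms form the differential of the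
    contraction. *)
Lemma diff_contraction a t : diff f = 0 -> diff contraction (a :: t) = f (a :: t).
Proof.
move=> df; apply/lfunP => x; apply/lfunP => b.
pose ev (c : A) (h : hom_bimod X coind) : V := (h : 'Hom(X, coind)) x c.
have evL c : linear (ev c).
  by move=> d g h; rewrite /ev add_lfunE scale_lfunE [LHS]add_lfunE scale_lfunE.
have evD c := linear_addE (evL c); have ev0 c := linear_zeroE (evL c).
have evZ c := linear_scaleE (evL c).
have h0 : ev 1 (diff f [:: b, a & t]) = 0 by rewrite df ev0.
rewrite diff_cons2 in h0.
have evN c h : ev c (- h) = - ev c h by rewrite -scaleN1r evZ scaleN1r.
have E : ev b (diff contraction (a :: t)) =
   ev 1 (f (b * a :: t)) + ev 1 (diff (fun s => f (b :: s)) (a :: t)) - ev 1 (lact a (f (b :: t))).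
  have aux (P L S T : V) : P + (L + S + T) - L = P + S + T.
    by rewrite -[L + S + T]addrA [L + _]addrC addrA addrK addrA.
  rewrite /= !evD !evZ !(big_morph _ (evD _) (ev0 _)) aux.
  have -> : ev b (lact a (contraction t)) = ev 1 (f (b * a :: t)).
    by rewrite /ev /= comp_lfunE coind_actE contractionE.
  congr (_ + _ + _ *: _).
    by apply: eq_bigr => i _; rewrite !evZ /ev contractionE.
  by rewrite /ev /= !comp_lfunE contractionE.
transitivity (ev b (diff contraction (a :: t))) => //; rewrite E.
have -> : (f (a :: t) : 'Hom(X, coind)) x b = ev 1 (lact b (f (a :: t))).
  by rewrite /ev /= comp_lfunE coind_actE mul1r.
move: h0; move: (diff _ (a :: t)) => s; rewrite !evD !evN.
move: (ev 1 (lact b _)) (ev 1 (f _)) (ev 1 (lact a _)) (ev 1 s) => p q r {}s /eqP.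
by rewrite subr_eq0 => /eqP <-; rewrite addrA addrK addrC subrK.
Qed.
End Contraction.

Lemma coind_vanishes X n : vanishes (hom_bimod X coind) n.+1.
Proof.
move=> f [mf hf df]; exists (contraction mf); split.
- move=> s1 s2 c x y; apply/lfunP => z; apply/lfunP => b.
  rewrite contractionE add_lfunE scale_lfunE [RHS]add_lfunE scale_lfunE !contractionE.
  by rewrite (mf (b :: s1) s2) add_lfunE scale_lfunE [LHS]add_lfunE scale_lfunE.
- move=> s ns; apply/lfunP => z; apply/lfunP => b.
  have z0 c : ((0 : 'Hom(X, coind)) z : 'Hom(A, V)) c = 0.
    by rewrite zero_lfunE; exact: zero_lfunE.
  by rewrite contractionE hf //; exact: etrans (z0 1) (esym (z0 b)).
- by apply/funext => -[|a t]; [rewrite hf|rewrite diff_contraction].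
Qed.
End Coinduced.

Section Embedding.
Variable M : fgMod A.
Fact coind_embed_subproof : linear (fun m : M => lin_hom (act_lin m) : 'Hom(A, M)).
Proof.
move=> c x y; apply/lfunP => b; rewrite [LHS]lin_homE [RHS]add_lfunE scale_lfunE !lin_homE.
by rewrite linearP.
Qed.
(** The unit of the adjunction, sending [m] to the map [b |-> b m]. *)
Definition coind_embed : 'Hom(M, coind M) := lin_hom coind_embed_subproof.
Lemma coind_embedE m b : coind_embed m b = act M b m.
Proof. by rewrite !lin_homE. Qed.
Lemma coind_embed_hom : is_hom coind_embed.
Proof.
by move=> a m; apply/lfunP => b; rewrite coind_actE !coind_embedE actME.
Qed.
Lemma lker_coind_embed : lker coind_embed = 0%VS.
Proof.
apply/eqP; rewrite -subv0; apply/subvP => m; rewrite memv_ker memv0 => /eqP m0.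
by rewrite -[m]act1E -coind_embedE m0 zero_lfunE.
Qed.
Definition coind_ses := coker_ses coind_embed_hom lker_coind_embed.
Definition cosyzygy : fgMod A := quo_mod (limg_submod coind_embed_hom).
End Embedding.

(** An injective module is a retract of a coinduced one, whose higher cohomology vanishes. *)
Lemma injective_vanishes E X n : injective_mod E -> vanishes (hom_bimod X E) n.+1.
Proof.
move=> injE f nf.
have [h hh hE] := injE _ _ _ _ (coind_embed_hom (M := E)) (lker_coind_embed E) (is_hom_id (M := E)).
have := ncoboundary_comp (post_hom X hh)
  (coind_vanishes (ncocycle_comp (post_hom X (coind_embed_hom (M := E))) nf)).
congr ncoboundary; apply/funext => s /=.
by rewrite comp_lfunA hE comp_lfun1l.
Qed.

(** The obstruction to extending [f] along [g] is its connecting class in degree 1 over the cokernel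
    of [g]. *)
Lemma vanishes1_injective E :
  (forall X, vanishes (hom_bimod X E) 1) -> injective_mod E.
Proof.
move=> van X Y g f hg ig hf.
pose ses := hom_ses_l (coker_ses hg ig) E.
have [h nh hE] := connecting_ker (cochain0_cocycle hf)
  (van _ _ (connecting_cocycle ses (cochain0_cocycle hf))).
exists (h [::]); first exact: cocycle0_hom nh.
exact: (congr1 (fun z => z [::]) hE).
Qed.

Lemma coind_injective V : injective_mod (coind V).
Proof. by apply: vanishes1_injective => X; exact: coind_vanishes. Qed.

(** In degree 1 a class is the connecting class of a map from [P] to the cosyzygy of [N];
    projectivity lifts this map to the coinduced module, and lifted maps have trivial connecting
    class. Higher degrees follow by shifting. *)
Lemma projective_vanishes P N n : projective P -> vanishes (hom_bimod P N) n.+1.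
Proof.
move=> projP; elim: n N => [|n IH] N; last first.
  exact: (vanishes_shift (hom_ses_r (coind_ses N) P) (@coind_vanishes _ _ _)).
move=> f nf.
pose ses := hom_ses_r (coind_ses N) P.
have [g ng fE] := @connecting_onto _ _ _ _ _ ses _ _ (@coind_vanishes _ _ 0) nf.
have [h hh hE] := projP _ _ _ _ (ms_hp (coind_ses N)) (ms_surj (coind_ses N)) (cocycle0_hom ng).
have gE : g = ses_p ses \o cochain0 h.
  rewrite (cochain0E (let: And3 _ h _ := ng in h)) -hE.
  by apply/funext => -[|a s] //=; rewrite comp_lfun0r.
have := subspaceD (ncoboundary_subspace _ _) fE
  (connecting_image ses (cochain0_cocycle hh)).
by rewrite -gE subrK.
Qed.
End Modules.

(** * Free modules and projective covers *)

Section Projectives.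
Variables (k : fieldType) (A : falgType k).
Implicit Types M N X : fgMod A.

Section Free.
Variable V : vectType k.
Fact free_act_subproof (a : A) : linear (fun g : 'Hom(V, A) => (amull a \o g)%VF).
Proof. by move=> c x y; rewrite comp_lfunDr comp_lfunZr. Qed.
Definition free_act (a : A) : 'End('Hom(V, A)) := lin_hom (free_act_subproof a).
Lemma free_actE a g v : free_act a g v = a * g v.
Proof. by rewrite lin_homE comp_lfunE lfunE. Qed.
Fact free_act_linear : linear free_act.
Proof.
move=> c a b; apply/lfunP => g; apply/lfunP => x.
by rewrite !(add_lfunE, scale_lfunE) !free_actE mulrDl scalerAl.
Qed.
Fact free_act1 : free_act 1 = \1%VF.
Proof. by apply/lfunP => g; apply/lfunP => x; rewrite free_actE mul1r id_lfunE. Qed.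
Fact free_actM a b : free_act (a * b) = (free_act a \o free_act b)%VF.
Proof. by apply/lfunP => g; apply/lfunP => x; rewrite comp_lfunE !free_actE mulrA. Qed.
(** A tensored with the dual of [V], written as Hom_k(V, A); it is free of rank dim V on the dual
    basis [free_gen]. *)
Definition free_mod : fgMod A := FgMod free_act_linear free_act1 free_actM.

Let b : (\dim {:V}).-tuple V := vbasis {:V}.

Fact free_gen_subproof (j : 'I_(\dim {:V})) : linear (fun v : V => (coord b j v)%:A : A).
Proof. by move=> c x y; rewrite linearP scalerDl scalerA. Qed.
Definition free_gen j : free_mod := lin_hom (free_gen_subproof j).
Lemma free_genE (g : free_mod) :
  g = \sum_(j < \dim {:V}) act free_mod ((g : 'Hom(V, A)) b`_j) (free_gen j).
Proof.
apply/lfunP => v; rewrite {1}(coord_vbasis (memvf v)) linear_sum /= sum_lfunE.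
by apply: eq_bigr => j _; rewrite linearZ /= free_actE lin_homE -scalerAr mulr1.
Qed.

Section Extend.
Variables (X : fgMod A) (x : 'I_(\dim {:V}) -> X).
Fact free_ext_subproof :
  linear (fun g : free_mod => \sum_(j < \dim {:V}) act X ((g : 'Hom(V, A)) b`_j) (x j)).
Proof.
move=> c f g; rewrite scaler_sumr -big_split; apply: eq_bigr => j _ /=.
by rewrite add_lfunE scale_lfunE act_lin.
Qed.
Definition free_ext : 'Hom(free_mod, X) := lin_hom free_ext_subproof.
Lemma free_ext_hom : is_hom free_ext.
Proof.
move=> a g; rewrite [LHS]lin_homE [in RHS]lin_homE linear_sum; apply: eq_bigr => j _.
by rewrite /= free_actE actME.
Qed.
Lemma free_ext_gen j : free_ext (free_gen j) = x j.
Proof.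
rewrite lin_homE (bigD1 j) //= lin_homE coord_free ?(basis_free (vbasisP _)) // eqxx.
rewrite scale1r act1E big1 ?addr0 // => i ni.
rewrite lin_homE coord_free ?(basis_free (vbasisP _)) // eq_sym -val_eqE /= in ni *.
by rewrite (negPf ni) scale0r (linear_zeroE (act_lin _)).
Qed.
End Extend.

Lemma free_projective : projective free_mod.
Proof.
move=> X Y g f hg sg hf; pose x j := (g^-1)%VF (f (free_gen j)).
exists (free_ext x); first exact: free_ext_hom.
apply/lfunP => m; rewrite comp_lfunE lin_homE linear_sum [in RHS](free_genE m) linear_sum.
apply: eq_bigr => j _; rewrite [LHS]hg [RHS]hf limg_lfunVK // sg memvf //.
Qed.
End Free.

Definition free_cover M : 'Hom(free_mod M, M) :=
  free_ext (fun j => (vbasis {:M})`_j).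

Lemma limg_full M N (f : 'Hom(M, N)) : (forall y, exists x, f x = y) -> limg f = fullv.
Proof.
move=> sf; apply/eqP; rewrite eqEsubv subvf /=; apply/subvP => y _.
by have [x <-] := sf y; rewrite memv_img ?memvf.
Qed.
Lemma limg_fullP M N (f : 'Hom(M, N)) : limg f = fullv -> forall y, exists x, f x = y.
Proof. by move=> sf y; exists ((f^-1)%VF y); rewrite limg_lfunVK // sf memvf. Qed.
Lemma lker0P M N (f : 'Hom(M, N)) : lker f = 0%VS <-> forall x, f x = 0 -> x = 0.
Proof.
split=> [k0 x fx|inj]; first by apply/eqP; rewrite -memv0 -k0 memv_ker fx.
apply/eqP; rewrite -subv0; apply/subvP => x; rewrite memv_ker memv0 => /eqP/inj ->.
exact: eqxx.
Qed.
Lemma vspace_full M (U : {vspace M}) : (forall x, x \in U) -> U = fullv.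
Proof. by move=> Ux; apply/vspaceP => x; rewrite Ux memvf. Qed.

Lemma free_cover_surj M : limg (free_cover M) = fullv.
Proof.
apply/eqP; rewrite eqEsubv subvf /= -(span_basis (vbasisP {:M})).
apply/span_subvP => x /tnthP[j ->]; rewrite (tnth_nth 0).
by rewrite -(free_ext_gen (fun j => (vbasis {:M})`_j) j) memv_img ?memvf.
Qed.

Lemma retract_projective (P Q : fgMod A) (a : 'Hom(Q, P)) (b : 'Hom(P, Q)) :
  projective P -> is_hom a -> is_hom b -> (b \o a)%VF = \1%VF -> projective Q.
Proof.
move=> projP ha hb ba X Y g f hg sg hf.
have [h hh hE] := projP _ _ _ _ hg sg (is_hom_comp hf hb).
exists (h \o a)%VF; first exact: is_hom_comp.
by rewrite comp_lfunA hE -comp_lfunA ba comp_lfun1r.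
Qed.

Lemma img_submod M N (f : 'Hom(M, N)) (U : {vspace M}) :
  is_hom f -> is_submod U -> is_submod (f @: U)%VS.
Proof.
move=> hf sU a y /memv_imgP[x Ux ->]; rewrite -hf memv_img //; exact: sU.
Qed.
Lemma add_submod M (U W : {vspace M}) : is_submod U -> is_submod W -> is_submod (U + W)%VS.
Proof.
move=> sU sW a x /memv_addP[u Uu [w Ww ->]]; rewrite linearD memv_add //; [exact: sU|exact: sW].
Qed.
Lemma cap_submod M (U W : {vspace M}) : is_submod U -> is_submod W -> is_submod (U :&: W)%VS.
Proof.
move=> sU sW a x; rewrite !memv_cap => /andP[Uu Ww]; apply/andP; split; [exact: sU|exact: sW].
Qed.

Lemma submod_min M (P : {vspace M} -> Prop) U0 : is_submod U0 -> P U0 ->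
  exists U, [/\ is_submod U, P U & forall W, is_submod W -> P W -> (\dim U <= \dim W)%N].
Proof.
move=> sU0 PU0.
have ex : exists n, `[< exists U, [/\ is_submod U, P U & \dim U = n] >].
  by exists (\dim U0); apply/asboolP; exists U0.
have [n /asboolP[U [sU PU <-]] min] := ex_minnP ex.
by exists U; split=> // W sW PW; apply: min; apply/asboolP; exists W.
Qed.
Lemma submod_max M (P : {vspace M} -> Prop) U0 : is_submod U0 -> P U0 ->
  exists U, [/\ is_submod U, P U & forall W, is_submod W -> P W -> (\dim W <= \dim U)%N].
Proof.
move=> sU0 PU0.
have ex : exists n, `[< exists U, [/\ is_submod U, P U & \dim U = n] >].
  by exists (\dim U0); apply/asboolP; exists U0.
have bd n : `[< exists U, [/\ is_submod U, P U & \dim U = n] >] -> (n <= dim M)%N.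
  by move=> /asboolP[U [_ _ <-]]; rewrite -dimvf dimvS ?subvf.
have [n /asboolP[U [sU PU <-]] max] := ex_maxnP ex bd.
by exists U; split=> // W sW PW; apply: max; apply/asboolP; exists W.
Qed.

(* A submodule [U] of a free module minimal with [U + K = F], [K] the kernel of
   F -> M, is a direct summand: F -> M lifts to F -> U, which is onto by minimality. *)
Lemma projective_cover_ex M : exists (P : fgMod A) (e : 'Hom(P, M)),
  [/\ projective P, is_hom e, limg e = fullv & superfluous (lker e)].
Proof.
pose F := free_mod M; pose p : 'Hom(F, M) := free_cover M.
have hp : is_hom p by exact: free_ext_hom.
have sp : limg p = fullv by exact: free_cover_surj.
pose K := lker p.
have [U [sU UK minU]] : exists U : {vspace F}, [/\ is_submod U, (U + K)%VS = fullv &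
    forall W : {vspace F}, is_submod W -> (W + K)%VS = fullv -> (\dim U <= \dim W)%N].
  apply: (@submod_min F (fun U => (U + K)%VS = fullv) fullv); first by move=> *; exact: memvf.
  by apply/eqP; rewrite eqEsubv subvf addvSl.
pose S := sub_mod sU; pose j : 'Hom(S, F) := sub_incl U.
have hj : is_hom j by exact: sub_incl_hom.
pose q : 'Hom(S, M) := (p \o j)%VF.
have hq : is_hom q by exact: is_hom_comp.
have jU x : x \in U -> exists s, j s = x.
  by rewrite -(limg_sub_incl U) => /memv_imgP[s _ ->]; exists s.
have decomp x : exists s, x - j s \in K.
  have : x \in (U + K)%VS by rewrite UK memvf.
  by case/memv_addP => u /jU[s <-] [y Ky ->]; exists s; rewrite addrC addKr.
have sq : limg q = fullv.
  apply: limg_full => y; have [x <-] := limg_fullP sp y; have [s] := decomp x.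
  by rewrite memv_ker linearB subr_eq0 => /eqP ->; exists s; rewrite comp_lfunE.
(* Minimality of [U] restated inside [S]: a submodule that still covers [F] modulo [K] is
   everything. *)
have minS (W : {vspace S}) : is_submod W -> (forall x, exists2 s, s \in W & x - j s \in K) ->
    W = fullv.
  move=> sW dW; apply/eqP; rewrite eqEdim subvf /= dimvf.
  have dimj : \dim (j @: W)%VS = \dim W.
    by rewrite limg_dim_eq // lker_sub_incl capv0.
  rewrite -[X in (_ <= X)%N]dimj; apply: minU; first exact: img_submod.
  apply: vspace_full => x; have [s Ws Kx] := dW x.
  by rewrite -(subrK (j s) x) addrC memv_add // memv_img.
have [h hh hE] := @free_projective M _ _ _ _ hq sq hp.
(* By minimality this endomorphism is onto, hence bijective by dimension, so [j \o t^-1] is a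
   section of [h]. *)
pose t : 'Hom(S, S) := (h \o j)%VF.
have ht : is_hom t by exact: is_hom_comp.
have st : limg t = fullv.
  apply: minS; first exact: limg_submod.
  move=> x; have [s Kx] := decomp x; exists (t s); first by rewrite memv_img ?memvf.
  have : j s - j (t s) \in K.
    have tE : t s = h (j s) by rewrite comp_lfunE.
    have /lfunP/(_ (j s)) := hE; rewrite 2!comp_lfunE => E.
    by rewrite memv_ker linearB subr_eq0 /= tE E.
  by move/(memvD Kx); rewrite addrA subrK.
have kt : lker t = 0%VS.
  apply/eqP; rewrite -dimv_eq0; have := limg_ker_dim t fullv; rewrite st capfv.
  by move/eqP; rewrite -{2}[\dim fullv]add0n eqn_add2r.
have tK : (t \o t^-1)%VF = \1%VF.
  by apply/lfunP => x; rewrite comp_lfunE id_lfunE limg_lfunVK // st memvf.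
exists S, q; split=> //.
  apply: (@retract_projective F S (j \o t^-1)%VF h) => //; first exact: free_projective.
    apply: is_hom_comp => // a m; apply/eqP.
    rewrite -subr_eq0 -memv0 -kt memv_ker linearB /= ht.
    have tE x : t ((t^-1)%VF x) = x by rewrite limg_lfunVK // st memvf.
    by rewrite !tE subrr.
  by rewrite comp_lfunA.
move=> W sW WK; apply: minS => // x; have [s Kx] := decomp x.
have : s \in (W + lker q)%VS by rewrite WK memvf.
case/memv_addP => w Ww [y qy sE]; exists w => //.
have -> : x - j w = (x - j s) + j y by rewrite sE linearD opprD addrA subrK.
by rewrite memvD // memv_ker -comp_lfunE -memv_ker.
Qed.

Definition cover_mod M : fgMod A := sval (cid (projective_cover_ex M)).
Definition cover_map M : 'Hom(cover_mod M, M) :=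
  sval (cid (svalP (cid (projective_cover_ex M)))).
Lemma cover_mapP M : [/\ projective (cover_mod M), is_hom (cover_map M),
  limg (cover_map M) = fullv & superfluous (lker (cover_map M))].
Proof. exact: (svalP (cid (svalP (cid (projective_cover_ex M))))). Qed.
Lemma cover_hom M : is_hom (cover_map M). Proof. by case: (cover_mapP M). Qed.
Lemma cover_surj M : limg (cover_map M) = fullv. Proof. by case: (cover_mapP M). Qed.
Lemma cover_projective M : projective (cover_mod M). Proof. by case: (cover_mapP M). Qed.
Definition syz M : fgMod A := sub_mod (lker_submod (@cover_hom M)).
Definition cover_ses M : mod_ses (syz M) (cover_mod M) M := ker_ses (@cover_hom M) (cover_surj M).

Definition min_res M n := cover_mod (iter n syz M).
Definition min_res_d M n : 'Hom(min_res M n.+1, min_res M n) :=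
  (sub_incl (lker (cover_map (iter n syz M))) \o cover_map (iter n.+1 syz M))%VF.

Lemma min_res_minimal M : minimal_projective_resolution (@min_res_d M) (cover_map M).
Proof.
have kd n : lker (min_res_d M n) = lker (cover_map (iter n.+1 syz M)).
  apply/vspaceP => x; rewrite !memv_ker comp_lfunE sub_inclE.
  by apply/eqP/eqP => [x0|->]; [exact: val_inj|].
have gd n : limg (min_res_d M n) = lker (cover_map (iter n syz M)).
  by rewrite limg_comp (cover_surj (iter n.+1 syz M)) limg_sub_incl.
split; last 1 first.
- by move=> n; rewrite kd; case: (cover_mapP (iter n.+1 syz M)).
- split.
  + by move=> n; exact: cover_projective.
  + exact: cover_hom.
  + move=> n.
    apply: (@is_hom_comp _ _ (min_res M n.+1) (iter n.+1 syz M) (min_res M n)).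
      exact: sub_incl_hom.
    exact: cover_hom.
  + exact: cover_surj.
  + by split=> [|n]; rewrite gd // kd.
- by case: (cover_mapP M).
Qed.
End Projectives.

(** * Simple modules and the top of the algebra *)

Section Simple.
Variables (k : fieldType) (A : falgType k).
Implicit Types M N X S : fgMod A.

Definition simple_mod S := dim S <> 0%N /\
  forall U : {vspace S}, is_submod U -> U = 0%VS \/ U = fullv.

Lemma dim0_eq0 M (x : M) : dim M = 0%N -> x = 0.
Proof.
move=> d0; apply/eqP; rewrite -memv0; have /eqP <- : fullv == 0%VS :> {vspace M}.
  by rewrite -dimv_eq0 dimvf d0.
exact: memvf.
Qed.
Lemma dim_neq0 M : dim M <> 0%N -> exists x : M, x != 0.
Proof.
move=> d0; exists (vpick (fullv : {vspace M})); rewrite vpick0 -dimv_eq0 dimvf.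
exact/eqP.
Qed.

Lemma maximal_submod M (U : {vspace M}) : is_submod U -> U <> fullv ->
  exists W (sW : is_submod W), [/\ (U <= W)%VS, W <> fullv & simple_mod (quo_mod sW)].
Proof.
move=> sU nU.
have [W [sW [UW nW] maxW]] := @submod_max _ A M (fun W => (U <= W)%VS /\ W <> fullv) U sU
  (conj (subvv U) nU).
exists W, sW; split=> //; pose p : 'Hom(M, quo_mod sW) := quo_proj W.
have hp : is_hom p by exact: quo_proj_hom.
have sp : limg p = fullv by exact: limg_quo_proj.
have kp : lker p = W by exact: lker_quo_proj.
split.
  move=> d0; apply: nW; rewrite -kp; apply: vspace_full => x.
  by rewrite memv_ker; apply/eqP; exact: dim0_eq0.
move=> V sV; pose V' := (p @^-1: V)%VS.
have sV' : is_submod V' by move=> a x; rewrite -!memv_preim hp; exact: sV.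
have WV' : (W <= V')%VS.
  by apply/subvP => x; rewrite -{1}kp memv_ker -memv_preim => /eqP ->; rewrite mem0v.
have [E|ne] := pselect (V' = fullv).
  right; apply: vspace_full => y; have [x <-] := limg_fullP sp y.
  by rewrite memv_preim -/V' E memvf.
left; have le := maxW V' sV' (conj (subv_trans UW WV') ne).
have WE : W = V' by apply/eqP; rewrite eqEdim WV' le.
apply/eqP; rewrite -subv0; apply/subvP => y; have [x <-] := limg_fullP sp y.
by rewrite memv_preim -/V' -WE -{1}kp memv_ker memv0.
Qed.

Lemma fgMod_ind (P : fgMod A -> Prop) :
  (forall M, dim M = 0%N -> P M) -> (forall S, simple_mod S -> P S) ->
  (forall M1 M2 M3, mod_ses M1 M2 M3 -> P M1 -> P M3 -> P M2) -> forall M, P M.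
Proof.
move=> P0 Ps Pe M; have [n] := ubnP (dim M); elim: n M => // n IH M lt.
have [d0|/eqP d0] := eqVneq (dim M) 0%N; first exact: P0.
have s0 : is_submod (0%VS : {vspace M}).
  by move=> a x; rewrite !memv0 => /eqP ->; rewrite linear0.
have n0 : (0%VS : {vspace M}) <> fullv.
  by move=> E; apply: d0; rewrite -dimvf -E dimv0.
have [W [sW [_ nW sim]]] := maximal_submod s0 n0.
apply: Pe (sub_ses sW) _ (Ps _ sim); apply: IH; rewrite -ltnS; apply: leq_trans lt.
rewrite dim_sub_mod -dimvf ltnS ltn_neqAle dimvS ?subvf // andbT.
by apply/negP => /eqP E; apply: nW; apply/eqP; rewrite eqEdim subvf E /=.
Qed.

Section Top.
Lemma regular_actE (a m : regular_mod A) : act (regular_mod A) a m = (a : A) * m.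
Proof. by rewrite /= lfunE. Qed.
Lemma vspace_left_ideal (U : {vspace regular_mod A}) :
  is_submod U <-> left_ideal setT [set x : A | x \in U].
Proof.
split=> [sU|[_ _ _ UM] a m Um]; last first.
  by have := UM a m I Um; rewrite /= lfunE.
split=> //=; first exact: mem0v.
  by move=> x y; exact: memvD.
by move=> a x _ Ux; have := sU a x Ux; rewrite /= lfunE.
Qed.

Lemma left_ideal_vspace (I : set A) : left_ideal setT I ->
  exists2 U : {vspace regular_mod A}, is_submod U & forall x, x \in U <-> I x.
Proof.
move=> [_ I0 ID IM].
have [c x y Ix Iy|U UE] := @linear_set_vspace k (regular_mod A) I I0.
  by apply: ID => //; rewrite -[x]mul1r scalerAl; exact: IM.
exists U => // a m /UE Im; apply/UE; rewrite /= lfunE; exact: IM.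
Qed.

Lemma radAP (x : regular_mod A) : x \in radA A <->
  forall U : {vspace regular_mod A}, is_submod U -> U <> fullv ->
   (forall V : {vspace regular_mod A}, is_submod V -> (U <= V)%VS -> V = U \/ V = fullv) -> x \in U.
Proof.
rewrite mem_radA; split=> [[_ Jx] U sU nU maxU|h].
  have /(_ _) := Jx [set x | x \in U]; apply; split.
  - exact/vspace_left_ideal.
  - move=> E; apply: nU; apply: vspace_full => y.
    by have : [set x : A | x \in U] y by rewrite E.
  - move=> J /left_ideal_vspace[V sV VE] UJ.
    have [|E|E] := maxU V sV.
    + by apply/subvP => y Uy; apply/VE/UJ.
    + by left; apply/seteqP; split=> y; rewrite /= -E => /VE.
    + by right; apply/seteqP; split=> // y _; apply/VE; rewrite E memvf.
split=> // I [idI nI maxI]; have [U sU UE] := left_ideal_vspace idI.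
apply/UE; apply: h => //.
  by move=> E; apply: nI; apply/seteqP; split=> // y _; apply/UE; rewrite E memvf.
move=> V sV UV; have [||E|E] := maxI [set x | x \in V].
- exact/vspace_left_ideal.
- by move=> y /UE Uy; exact: (subvP UV).
- left; apply/vspaceP => y; apply/idP/idP.
    by move=> Vy; apply/UE; rewrite -E.
  by move/UE; rewrite -E.
- by right; apply: vspace_full => y; have : [set x : A | x \in V] y by rewrite E.
Qed.

Lemma maximal_add (U : {vspace regular_mod A}) (x y : regular_mod A) : is_submod U ->
  (forall V : {vspace regular_mod A}, is_submod V -> (U <= V)%VS -> V = U \/ V = fullv) ->
  x \notin U -> exists u (c : A), u \in U /\ y = u + act (regular_mod A) c x.
Proof.
move=> sU maxU nUx; pose V := (U + limg (lin_hom (act_lin (M := regular_mod A) x)))%VS.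
have sV : is_submod V.
  apply: add_submod => // a m /memv_imgP[c _ ->]; apply/memv_imgP; exists (a * c).
    exact: memvf.
  by rewrite [X in act _ a X]lin_homE [RHS]lin_homE actME.
have /memv_addP[u Uu [w /memv_imgP[c _ ->] ->]] : y \in V.
  case: (maxU V sV (addvSl _ _)) => [E|->]; last exact: memvf.
  case/negP: nUx; rewrite -E -[x]add0r memv_add ?mem0v //; apply/memv_imgP.
  by exists (1 : A); rewrite ?memvf // lin_homE act1E.
by exists u, c; split=> //; rewrite lin_homE.
Qed.

Definition top_proj : 'Hom(regular_mod A, top_mod A) :=
  quo_proj (radA A : {vspace regular_mod A}).
Lemma top_proj_hom : is_hom top_proj.
Proof. exact: (quo_proj_hom (@radA_submod k A)). Qed.
Lemma top_proj_surj : limg top_proj = fullv.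
Proof. exact: limg_quo_proj. Qed.
Lemma top_proj_ker : lker top_proj = radA A.
Proof. exact: lker_quo_proj. Qed.
Lemma top_proj0 (x : regular_mod A) : x \in radA A -> top_proj x = 0.
Proof. exact: (@quo_proj_eq0 k A (regular_mod A) (radA A) x). Qed.

Section SimpleTop.
Variable S : fgMod A.
Hypothesis simS : simple_mod S.
Variable s : S.
Hypothesis s0 : s != 0.

Let f : 'Hom(regular_mod A, S) := lin_hom (act_lin s).
Let fE (a : A) : f a = act S a s. Proof. exact: lin_homE. Qed.
Let hf : is_hom f.
Proof. by move=> a m; rewrite !fE /= lfunE /= actME. Qed.
Let sf : limg f = fullv.
Proof.
case: (simS.2 _ (limg_submod hf)) => // E; case/negP: s0.
by rewrite -memv0 -E; apply/memv_imgP; exists (1 : A); rewrite ?memvf ?fE ?act1E.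
Qed.

Let maxf (V : {vspace regular_mod A}) : is_submod V -> (lker f <= V)%VS ->
  V = lker f \/ V = fullv.
Proof.
move=> sV kV; case: (simS.2 _ (img_submod hf sV)) => E.
  left; apply/eqP; rewrite eqEsubv kV andbT; apply/subvP => x Vx.
  by rewrite memv_ker -memv0 -E memv_img.
right; apply: vspace_full => x.
have : f x \in (f @: V)%VS by rewrite E memvf.
case/memv_imgP => y Vy fxy; rewrite -(subrK y x) memvD // (subvP kV) //.
by rewrite memv_ker linearB /= fxy subrr.
Qed.

(** The annihilator of [s] is a maximal left ideal, so it contains the radical and the map
    [a |-> a s] factors through the top. *)
Lemma simple_top_quotient : exists2 q : 'Hom(top_mod A, S), is_hom q &
  forall a : regular_mod A, q (top_proj a) = act S a s.
Proof.
have nf : lker f <> fullv.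
  move=> E; case/negP: s0; have : (1 : A) \in lker f by rewrite E memvf.
  by rewrite memv_ker fE act1E.
have kf : (radA A <= lker f)%VS.
  by apply/subvP => x /radAP; apply=> //; exact: lker_submod.
pose q : 'Hom(top_mod A, S) := (f \o quo_lift (radA A : {vspace regular_mod A}))%VF.
have qE (a : regular_mod A) : q (top_proj a) = act S a s.
  rewrite comp_lfunE -fE; apply/esym/eqP; rewrite -subr_eq0 -linearB /= -memv_ker.
  apply: (subvP kf); exact: (@quo_liftK k A (regular_mod A) (radA A) a).
exists q => // a m.
have [x <-] := limg_fullP (top_proj_surj) m.
by rewrite -top_proj_hom !qE /= lfunE /= actME.
Qed.

(* For [J] a minimal left ideal with J + ann(s) = A, every maximal left ideal
   contains J :&: ann(s); hence J :&: ann(s) lies in the radical and the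
   inverse of J / (J :&: ann(s)) = S maps to the top. *)
Lemma simple_top_section (q : 'Hom(top_mod A, S)) :
  (forall a : regular_mod A, q (top_proj a) = act S a s) ->
  exists2 j : 'Hom(S, top_mod A), is_hom j & (q \o j)%VF = \1%VF.
Proof.
move=> qE; pose K := lker f.
have sK : is_submod K by exact: lker_submod.
have [J [sJ JK minJ]] : exists U : {vspace regular_mod A}, [/\ is_submod U, (U + K)%VS = fullv &
    forall W : {vspace regular_mod A}, is_submod W -> (W + K)%VS = fullv -> (\dim U <= \dim W)%N].
  apply: (@submod_min _ _ (regular_mod A) (fun U => (U + K)%VS = fullv) fullv).
    by move=> *; exact: memvf.
  by apply/eqP; rewrite eqEsubv subvf addvSl.
have capJ x : x \in J -> x \in K -> x \in radA A.
  move=> Jx Kx; apply/radAP => U sU nU maxU; apply: contrapT => /negP nUx.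
  (* If [x] is outside the maximal [U], every element of [J] differs from one of [W] by a multiple
     of [x], which lies in [K]. So [W] also complements [K], and minimality gives [W = J], which
     contains [x]. *)
  pose W := (J :&: U)%VS.
  have sW : is_submod W by exact: cap_submod.
  have WK : (W + K)%VS = fullv.
    apply/eqP; rewrite eqEsubv subvf -JK subv_add addvSr andbT; apply/subvP => y Jy.
    have [u [c [Uu yE]]] := maximal_add y sU maxU nUx.
    rewrite yE memv_add //; last exact: sK.
    rewrite memv_cap Uu andbT.
    have -> : u = y - act (regular_mod A) c x by rewrite yE addrK.
    by rewrite memvB //; exact: sJ.
  have /eqP WE : W == J by rewrite eqEdim capvSl minJ.
  by move: Jx; rewrite -WE memv_cap (negPf nUx) andbF.
pose f0 : 'Hom(regular_mod A, S) := (f \o projv J)%VF.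
have sf0 : limg f0 = fullv.
  apply: limg_full => y; have [x <-] := limg_fullP sf y.
  have : x \in (J + K)%VS by rewrite JK memvf.
  case/memv_addP => u Ju [w Kw ->]; exists u; rewrite comp_lfunE projv_id //.
  by move: Kw; rewrite linearD memv_ker /= => /eqP ->; rewrite addr0.
(* A k-linear section of [f] with values in [J]; it is linear over [A] up to elements of [J] and
   [K], that is, up to the radical. *)
pose g := (projv J \o f0^-1)%VF.
have gJ y : g y \in J by rewrite comp_lfunE memv_proj.
have fg y : f (g y) = y.
  rewrite comp_lfunE -[f _]comp_lfunE -/f0 limg_lfunVK // sf0 memvf //.
pose j : 'Hom(S, top_mod A) := (top_proj \o g)%VF.
exists j; last first.
  by apply/lfunP => y; rewrite comp_lfunE id_lfunE comp_lfunE qE -fE fg.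
have jE z : j z = top_proj (g z) by rewrite [LHS]comp_lfunE.
move=> a y; rewrite !jE -top_proj_hom.
apply/eqP; rewrite -subr_eq0 -linearB /=; apply/eqP/top_proj0.
apply: capJ; first by rewrite memvB //; apply: sJ.
by rewrite memv_ker linearB /= -/f hf !fg subrr.
Qed.
End SimpleTop.

Lemma simple_retract S : simple_mod S -> exists (j : 'Hom(S, top_mod A)) (q : 'Hom(top_mod A, S)),
  [/\ is_hom j, is_hom q & (q \o j)%VF = \1%VF].
Proof.
move=> simS; have [s s0] := dim_neq0 simS.1.
have [q hq qE] := simple_top_quotient simS s0.
by have [j hj qj] := simple_top_section simS s0 qE; exists j, q.
Qed.

(** The quotient by a maximal submodule containing [U] is simple and embeds in the top. *)
Lemma hom_to_top M (U : {vspace M}) : is_submod U -> U <> fullv ->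
  exists h : 'Hom(M, top_mod A), [/\ is_hom h, (U <= lker h)%VS & lker h <> fullv].
Proof.
move=> sU nU; have [W [sW [UW nW sim]]] := maximal_submod sU nU.
have [j [q [hj hq qj]]] := simple_retract sim.
pose p : 'Hom(M, quo_mod sW) := quo_proj W.
have hp : is_hom p by exact: quo_proj_hom.
have kE : lker (j \o p)%VF = W.
  transitivity (lker p); last exact: lker_quo_proj.
  apply/vspaceP => x; rewrite !memv_ker comp_lfunE.
  apply/eqP/eqP => [E|->]; last exact: linear0.
  by rewrite -[LHS](id_lfunE) -qj comp_lfunE E linear0.
by exists (j \o p)%VF; split; [exact: is_hom_comp|rewrite kE|rewrite kE].
Qed.

(** Suppose a lift [a] of [h x] lies outside a maximal left ideal [U]. Every element of [P] can be
    moved by a multiple of [x] into the preimage [W] of the image of [U], so [W + K] is [P] and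
    hence [W] is [P]; then [x] lies in [W], which puts [a] in [U]. *)
Lemma superfluous_hom_top (P : fgMod A) (K : {vspace P}) (h : 'Hom(P, top_mod A)) :
  is_submod K -> superfluous K -> is_hom h -> (K <= lker h)%VS.
Proof.
move=> sK supK hh; apply/subvP => x Kx; rewrite memv_ker; apply/eqP.
have [a aE] := limg_fullP (top_proj_surj) (h x).
rewrite -aE; apply: top_proj0; apply/radAP => U sU nU maxU.
apply: contrapT => /negP nUa.
pose p := top_proj; have hp : is_hom p := top_proj_hom.
have kp : (lker p <= U)%VS.
  by apply/subvP => y; rewrite top_proj_ker => /radAP; apply.
pose W := (h @^-1: (p @: U))%VS.
have sW : is_submod W.
  by move=> b y; rewrite -!memv_preim hh; exact: img_submod.
have WE y b : p b = h y -> y \in W -> b \in U.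
  move=> pb; rewrite -memv_preim -pb => /memv_imgP[c Uc E].
  rewrite -(subrK c b) memvD // (subvP kp) // memv_ker linearB /= E subrr //.
have Wfull : W = fullv.
  apply: supK => //; apply: vspace_full => y.
  have [b bE] := limg_fullP (top_proj_surj) (h y).
  have [u [c [Uu bE']]] := maximal_add b sU maxU nUa.
  have hE : h (y - act P c x) = p u.
    by rewrite linearB /= hh -bE -aE bE' linearD /= -hp addrK.
  rewrite -(subrK (act P c x) y) memv_add //; last exact: sK.
  by rewrite -memv_preim hE memv_img.
by case/negP: nUa; apply: (WE x) => //; rewrite Wfull memvf.
Qed.
End Top.
End Simple.

(** * Homological dimensions and minimal resolutions *)

Lemma limg_dim_leq (k : fieldType) (U V : vectType k) (f : 'Hom(U, V)) (W : {vspace U}) :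
  (\dim (f @: W) <= \dim W)%N.
Proof. by rewrite -(limg_ker_dim f W) leq_addl. Qed.

Section Dimensions.
Variables (k : fieldType) (A : falgType k).
Implicit Types M N X S : fgMod A.

Lemma vanishes_zero_l M N n : dim M = 0%N -> vanishes (hom_bimod M N) n.
Proof.
move=> d0 f [mf hf df].
have -> : f = 0 by apply/funext => s; apply/lfunP => x; rewrite (dim0_eq0 x d0) !linear0.
by case: (ncoboundary_subspace (hom_bimod M N) n).
Qed.
Lemma vanishes_zero_r M N n : dim N = 0%N -> vanishes (hom_bimod M N) n.
Proof.
move=> d0 f [mf hf df].
have -> : f = 0.
  apply/funext => s; apply/lfunP => x.
  exact: etrans (dim0_eq0 _ d0) (esym (dim0_eq0 _ d0)).
by case: (ncoboundary_subspace (hom_bimod M N) n).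
Qed.

(** The index counts terms of the resolution: 0 means the zero module, so [proj_dim_le n.+1] is
    projective dimension at most [n]. The same shift holds for [inj_dim_le]. *)
Fixpoint proj_dim_le n M : Prop := if n is m.+1 then
  exists P K (E : mod_ses K P M), projective P /\ proj_dim_le m K else dim M = 0%N.
Fixpoint inj_dim_le n M : Prop := if n is m.+1 then
  exists I C (E : mod_ses M I C), injective_mod I /\ inj_dim_le m C else dim M = 0%N.

Lemma surj_dim0 M N (f : 'Hom(M, N)) : limg f = fullv -> dim M = 0%N -> dim N = 0%N.
Proof.
by move=> sf d0; rewrite -dimvf -sf; apply/eqP; rewrite -leqn0 -d0 -dimvf limg_dim_leq.
Qed.

Section Corestrict.
Variables (M N : fgMod A) (f : 'Hom(M, N)) (U : {vspace N}) (sU : is_submod U).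
Hypotheses (hf : is_hom f) (fU : (limg f <= U)%VS).
Definition corestrict : 'Hom(M, sub_mod sU) := (linfun (vsproj U) \o f)%VF.
Lemma corestrictE x : vsval (corestrict x) = f x.
Proof.
by rewrite comp_lfunE lfunE /= vsprojK // (subvP fU) // memv_img ?memvf.
Qed.
Lemma corestrict_hom : is_hom corestrict.
Proof.
move=> a m; apply: val_inj; rewrite [LHS]corestrictE hf; apply/esym.
by rewrite [LHS](sub_actE sU); exact: (congr1 (fun z => act N a z) (corestrictE m)).
Qed.
Lemma lker_corestrict : lker corestrict = lker f.
Proof.
apply/vspaceP => x; rewrite !memv_ker -corestrictE; apply/eqP/eqP => [->//|].
by move=> h; apply: val_inj.
Qed.
Lemma limg_corestrict : U = limg f -> limg corestrict = fullv.
Proof.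
move=> UE; apply: limg_full => y; have : vsval y \in limg f by rewrite -UE subvsP.
by case/memv_imgP => x _ yE; exists x; apply: val_inj; rewrite [LHS]corestrictE.
Qed.
End Corestrict.

Lemma resolution_proj_dim_le n M (P : nat -> fgMod A) (d : forall n, 'Hom(P n.+1, P n)) 
    (e : 'Hom(P 0%N, M)) : @projective_resolution k A M P d e ->
  (forall i, (n <= i)%N -> dim (P i) = 0%N) -> proj_dim_le n M.
Proof.
elim: n M P d e => [|n IH] M P d e [pP he hd se [d0e ex]] P0.
  by apply: surj_dim0 se _; exact: P0.
exists (P 0%N), (sub_mod (lker_submod he)), (ker_ses he se); split; first exact: pP.
have le : (limg (d 0%N) <= lker e)%VS by rewrite d0e.
apply: (IH _ (fun n => P n.+1) (fun n => d n.+1) (corestrict (d 0%N) (lker_submod he))).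
  split.
  - by move=> i; exact: pP.
  - exact: corestrict_hom.
  - by move=> i; exact: hd.
  - by apply: limg_corestrict; rewrite d0e.
  - by rewrite lker_corestrict // ex; split=> // i; exact: ex.
by move=> i le_i; apply: P0.
Qed.

Lemma proj_dim_le_vanishes n M N m : proj_dim_le n M -> (n <= m)%N -> vanishes (hom_bimod M N) m.
Proof.
elim: n M m => [|n IH] M m /=; first by move=> d0 _; exact: vanishes_zero_l.
case: m => // m [P [K [E [pP pK]]]] le.
by apply: (vanishes_shift (hom_ses_l E N)); [exact: projective_vanishes|exact: IH].
Qed.

Lemma mod_ses_dim0 M1 M2 M3 (E : mod_ses M1 M2 M3) : dim M2 = 0%N -> dim M1 = 0%N.
Proof. by move/eqP; rewrite (ms_dim E) addn_eq0 => /andP[/eqP]. Qed.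

Lemma injres_inj_dim_le n M (E : nat -> fgMod A) (d : forall n, 'Hom(E n, E n.+1)) 
    (e : 'Hom(M, E 0%N)) : @injective_resolution k A M E d e ->
  (forall i, (n <= i)%N -> dim (E i) = 0%N) -> inj_dim_le n M.
Proof.
elim: n M E d e => [|n IH] M E d e [iE he hd ke [d0e ex]] E0.
  by apply: mod_ses_dim0 (coker_ses he ke) _; exact: E0.
have sU := limg_submod (hd 0%N); pose p := corestrict (d 0%N) sU.
have hp : is_hom p by exact: corestrict_hom.
have ses : mod_ses M (E 0%N) (sub_mod sU).
  apply: (@ModSes _ _ _ _ _ e p) => //; first by rewrite lker_corestrict.
  exact: limg_corestrict.
exists (E 0%N), (sub_mod sU), ses; split; first exact: iE.
apply: (IH (sub_mod sU) (fun n => E n.+1) (fun n => d n.+1)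
  (sub_incl (limg (d 0%N)) : 'Hom(sub_mod sU, E 1%N))).
  split.
  - by move=> i; exact: iE.
  - exact: sub_incl_hom.
  - by move=> i; exact: hd.
  - exact: lker_sub_incl.
  - by rewrite limg_sub_incl ex; split=> // i; exact: ex.
by move=> i le_i; apply: E0.
Qed.

Lemma zero_injective M : dim M = 0%N -> injective_mod M.
Proof.
move=> d0 X Y g f hg ig hf; exists 0; first exact: is_hom0.
by apply/lfunP => x; exact: etrans (dim0_eq0 _ d0) (esym (dim0_eq0 _ d0)).
Qed.

Lemma inj_dim_le_injres n M : inj_dim_le n M ->
  exists (E : nat -> fgMod A) (d : forall n, 'Hom(E n, E n.+1)) (e : 'Hom(M, E 0%N)),
  @injective_resolution k A M E d e /\ forall i, (n <= i)%N -> dim (E i) = 0%N.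
Proof.
elim: n M => [|n IH] M /=.
  move=> d0; exists (fun=> M), (fun=> 0), \1%VF; split; last by [].
  have Z (U V : {vspace M}) : U = V.
    by apply/vspaceP => x; rewrite (dim0_eq0 x d0) !mem0v.
  split.
  - by move=> _; exact: zero_injective.
  - exact: is_hom_id.
  - by move=> i; exact: (@is_hom0 _ _ M M).
  - exact: Z.
  - by split=> *; exact: Z.
move=> [I [C [ses [iI /IH[E [d [e [[iE he hd ke [d0e ex]] E0]]]]]]]].
pose E' i := if i is j.+1 then E j else I.
pose d' i : 'Hom(E' i, E' i.+1) := match i with 0%N => (e \o ms_p ses)%VF | j.+1 => d j end.
exists E', d', (ms_i ses : 'Hom(M, E' 0%N)); split; last by case.
have kd0 : lker (d' 0%N) = lker (ms_p ses).
  apply/vspaceP => x; rewrite !memv_ker /= comp_lfunE.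
  by apply/eqP/eqP => [/(lker0P e).1|->]; [apply|exact: linear0].
split.
- by case.
- exact: ms_hi.
- by case=> [|i] //=; apply: is_hom_comp => //; exact: ms_hp.
- exact: ms_inj.
split; first by rewrite kd0 ms_exact.
by case=> [|i]; rewrite ?ex //= -d0e limg_comp ms_surj.
Qed.

Lemma finite_pdP M : finite_projective_dimension M -> exists n, proj_dim_le n M.
Proof. by move=> [P [d [e [res [n P0]]]]]; exists n.+1; apply: resolution_proj_dim_le res _. Qed.

Lemma finite_idP M : finite_injective_dimension M <-> exists n, inj_dim_le n M.
Proof.
split=> [[E [d [e [res [n E0]]]]]|[n /inj_dim_le_injres[E [d [e [res E0]]]]]].
  by exists n.+1; apply: injres_inj_dim_le res _.
by exists E, d, e; split=> //; exists n => i /ltnW; exact: E0.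
Qed.

Lemma inj_dim_le_vanishes n M X m : inj_dim_le n M -> (n <= m)%N -> vanishes (hom_bimod X M) m.
Proof.
elim: n M m => [|n IH] M m /=; first by move=> d0 _; exact: vanishes_zero_r.
case: m => // m [I [C [E [iI iC]]]] le.
by apply: (vanishes_shift (hom_ses_r E X)); [exact: injective_vanishes|exact: IH].
Qed.

(** Simple modules are retracts of the top, and vanishing passes to extensions. *)
Lemma top_vanishes N n : vanishes (hom_bimod (top_mod A) N) n ->
  forall X, vanishes (hom_bimod X N) n.
Proof.
move=> van; apply: fgMod_ind => [X d0|S simS|M1 M2 M3 E v1 v3].
- exact: vanishes_zero_l.
- have [j [q [hj hq qj]]] := simple_retract simS.
  move=> f nf.
  have := ncoboundary_comp (pre_hom N hj) (van _ (ncocycle_comp (pre_hom N hq) nf)).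
  congr ncoboundary; apply/funext => s /=.
  by rewrite -comp_lfunA qj comp_lfun1r.
- exact: (vanishes_middle (hom_ses_l E N)).
Qed.

(** Replacing [M] by its cosyzygy lowers the degree by one until all Ext groups in positive degree
    vanish, where the module is injective. *)
Lemma vanishes_inj_dim_le (N : nat) M :
  (forall m, (N < m)%N -> vanishes (hom_bimod (top_mod A) M) m) -> inj_dim_le N.+1 M.
Proof.
elim: N M => [|N IH] M van.
  have iM : injective_mod M by apply: vanishes1_injective; exact/top_vanishes/van.
  have k0 : lker (\1%VF : 'Hom(M, M)) = 0%VS by apply/lker0P => x; rewrite id_lfunE.
  exists M, (quo_mod (limg_submod (is_hom_id (M := M)))), (coker_ses (is_hom_id (M := M)) k0).
  split=> //=.
  have := ms_dim (coker_ses (is_hom_id (M := M)) k0).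
  by move/eqP; rewrite -{1}[dim M]addn0 eqn_add2l => /eqP.
exists (coind A M), (cosyzygy M), (coind_ses M); split; first exact: coind_injective.
apply: IH => m ltm; apply: (vanishes_unshift (hom_ses_r (coind_ses M) (top_mod A))).
- by case: m ltm => // m _; exact: coind_vanishes.
- exact: coind_vanishes.
- exact: van.
Qed.

Lemma minimal_hom_zero M (h : seq A -> hom_bimod (cover_mod M) (top_mod A)) :
  ncocycle 0 h -> pre_hom (top_mod A) (ms_hi (cover_ses M)) \o h = 0.
Proof.
move=> nh; have [_ h0 _] := nh; have hh := cocycle0_hom nh.
have [_ _ _ sup] := cover_mapP M.
have kh := superfluous_hom_top (lker_submod (@cover_hom _ _ M)) sup hh.
apply/funext => -[|a s]; last by rewrite /= h0 // comp_lfun0l.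
apply/lfunP => x; rewrite /= comp_lfunE zero_lfunE; apply/eqP; rewrite -memv_ker.
by apply: (subvP kh); rewrite sub_inclE subvsP.
Qed.

(** Dimension shifting identifies Ext in degree [n] with maps from the [n]-th syzygy to the top; at
    the last step, into degree 0, [minimal_hom_zero] gives injectivity. *)
Lemma cspan_syz M n t :
  cspan (hom_bimod M (top_mod A)) n t <-> cspan (hom_bimod (iter n (@syz _ _) M) (top_mod A)) 0 t.
Proof.
elim: n M => [|n IH] M //; rewrite iterSr -IH.
pose ses := hom_ses_l (cover_ses M) (top_mod A).
have van m : vanishes (hom_bimod (cover_mod M) (top_mod A)) m.+1.
  by apply: projective_vanishes; exact: cover_projective.
split.
  apply: (cspan_unshift (E := ses)); first exact: van.
  move=> h nh; case: n IH nh => [|n] IH nh.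
    rewrite minimal_hom_zero //; by case: (ncoboundary_subspace (hom_bimod (syz M) (top_mod A)) 0).
  by apply: (ncoboundary_comp (ses_p ses)); exact: van.
by apply: (cspan_shift ses); exact: van.
Qed.

(** By [minimal_hom_zero], every map from the cover to the top factors through [M]. *)
Lemma cspan_cover M t : cspan (hom_bimod M (top_mod A)) 0 t ->
  cspan (hom_bimod (cover_mod M) (top_mod A)) 0 t.
Proof.
pose ses := hom_ses_l (cover_ses M) (top_mod A).
apply: (@spanned_image _ _ _ _ _ _ _ (fun g => ses_i ses \o g)).
- exact: (comp_linear (bfun_lin (ses_i ses))).
- by move=> g; exact: ncocycle_comp.
- by move=> g; exact: ncoboundary_comp.
- move=> h nh; have [mh hh dh] := nh.
  have E : ses_i ses \o (ses_r ses \o h) = h.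
    apply/funext => s /=; apply: (ses_ker (E := ses)).
    exact: (congr1 (fun f => f s) (minimal_hom_zero nh)).
  exists (ses_r ses \o h).
    split; [exact: (multilinear_comp (ses_r_lin ses))|exact: (homog_comp (ses_r_lin ses))|].
    by apply: (ses_i_diff0 (E := ses)); rewrite E.
  by rewrite E subrr; case: (ncoboundary_subspace (hom_bimod (cover_mod M) (top_mod A)) 0).
- exact: ncoboundary_subspace.
Qed.

Lemma cap_ker_dim (M N : fgMod A) (U : {vspace M}) (h : 'Hom(M, N)) :
  (\dim U <= \dim (U :&: lker h) + dim N)%N.
Proof. by rewrite -(limg_ker_dim h U) leq_add2l -dimvf dimvS ?subvf. Qed.

(* Nakayama: the joint kernel [J] of all maps to the top is superfluous. *)
Lemma dim_le_hom_top M t : cspan (hom_bimod M (top_mod A)) 0 t ->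
  (dim M <= t * (dim (top_mod A) * dim A))%N.
Proof.
move=> [s [Vs sp]]; pose h i : 'Hom(M, top_mod A) := s i [::].
have hh i : is_hom (h i) by exact: cocycle0_hom (Vs i).
pose J := (\bigcap_(i < t) lker (h i))%VS.
have Jker g : is_hom g -> (J <= lker (g : 'Hom(M, top_mod A)))%VS.
  move=> hg; have [c /(congr1 (fun f => f [::]))] := sp _ (cochain0_cocycle hg).
  rewrite (_ : (cochain0 g - _) [::] = g - \sum_(i < t) c i *: h i); last first.
    congr (_ - _); rewrite fct_sumE; by [].
  move/eqP; rewrite subr_eq0 => /eqP ->; apply/subvP => x Jx.
  rewrite memv_ker sum_lfunE big1 // => i _; rewrite scale_lfunE.
  have : x \in lker (h i).
    by apply: (subvP _ x Jx); exact: (@bigcapv_inf _ _ _ i _ _ _ isT (subvv _)).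
  by rewrite memv_ker => /eqP ->; rewrite scaler0.
(* Each of the [t] kernels lowers the dimension by at most that of the top. *)
have dimJ : (dim M <= \dim J + t * dim (top_mod A))%N.
  pose Jn n := (\bigcap_(i < n) lker (h i))%VS.
  suff : forall n, (dim M <= \dim (Jn n) + n * dim (top_mod A))%N by apply.
  elim=> [|n IH]; first by rewrite /Jn big_ord0 dimvf addn0.
  rewrite /Jn big_ord_recr /= mulSn addnA; apply: leq_trans IH _.
  exact: (leq_add (cap_ker_dim (\bigcap_(i < n) lker (h i))%VS (h n)) (leqnn _)).
have nak (U : {vspace M}) : is_submod U -> (U + J)%VS = fullv -> U = fullv.
  move=> sU UJ; apply: contrapT => nU; have [g [hg Ug ng]] := hom_to_top sU nU.
  by apply: ng; apply/eqP; rewrite eqEsubv subvf -UJ subv_add Ug Jker.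
(* By Nakayama the submodule generated by a complement of [J] is everything, and each basis vector
   generates at most [dim A] dimensions. This gives the constant of the statement. *)
pose X := vbasis (J^C)%VS.
pose U := (\sum_(i < \dim (J^C)%VS) limg (lin_hom (act_lin (M := M) X`_i)))%VS.
have sU : is_submod U.
  move=> a m /memv_sumP[u Uu ->]; rewrite linear_sum; apply: memv_sumr => i _.
  have /memv_imgP[b _ ->] := Uu i isT; apply/memv_imgP; exists (a * b); first exact: memvf.
  by rewrite !lin_homE actME.
have UF : U = fullv.
  apply: nak => //; apply/eqP; rewrite eqEsubv subvf -(addv_complf J) addvC addvS //.
  rewrite -(span_basis (vbasisP (J^C)%VS)); apply/span_subvP => x /tnthP[i ->].
  rewrite (tnth_nth 0); apply: (subvP (@sumv_sup _ _ _ i _ _ _ isT (subvv _))).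
  by apply/memv_imgP; exists (1 : A); rewrite ?memvf // lin_homE act1E.
have dimJC : (\dim (J^C)%VS <= t * dim (top_mod A))%N.
  by rewrite dimv_compl dimvf leq_subLR.
rewrite -dimvf -UF mulnA; apply: (leq_trans (dimv_leq_sum _ _ _)).
apply: leq_trans (_ : \dim (J^C)%VS * dim A <= _)%N; last by rewrite leq_mul2r dimJC orbT.
rewrite -[X in (_ <= X * _)%N]card_ord -sum_nat_const; apply: leq_sum => i _.
by rewrite -(dimvf A) limg_dim_leq.
Qed.

Lemma dim_min_res M n t : cspan (hom_bimod M (top_mod A)) n t ->
  (dim (min_res M n) <= t * (dim (top_mod A) * dim A))%N.
Proof. by move/cspan_syz/cspan_cover/dim_le_hom_top. Qed.

Lemma cspan_dim_hom M N : cspan (hom_bimod M N) 0 (dim 'Hom(M, N)).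
Proof.
pose V := [set h : 'Hom(M, N) | is_hom h].
have sV : subspace V by split; [exact: is_hom0|move=> c x y; exact: is_hom_lincomb].
apply: (@spanned_image _ _ _ V [set 0] _ _ (fun h => @cochain0 _ _ M N h)).
- move=> c x y; apply/funext => -[|a s] //; by rewrite [RHS]addr0 [RHS]scaler0.
- by move=> h; exact: cochain0_cocycle.
- by move=> h ->; apply/funext => -[].
- move=> z nz; exists (z [::]); first exact: cocycle0_hom nz.
  have [_ hz _] := nz; rewrite -{1}(cochain0E hz) subrr.
  by case: (ncoboundary_subspace (hom_bimod M N) 0).
- exact: ncoboundary_subspace.
- exact: spanned_vspace.
Qed.

Lemma dim_hom (U V : vectType k) : dim 'Hom(U, V) = (dim U * dim V)%N.
Proof. by []. Qed.

(** The estimate opposite to [dim_min_res]: the [n]-th syzygy is a quotient of [min_res M n], which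
    bounds its maps to the top. *)
Lemma cspan_min_res M n : cspan (hom_bimod M (top_mod A)) n (dim (min_res M n) * dim (top_mod A)).
Proof.
apply/cspan_syz; apply: spanned_leq (cspan_dim_hom _ _).
rewrite dim_hom leq_mul2r; apply/orP; right.
by rewrite -[X in (X <= _)%N]dimvf -cover_surj -[X in (_ <= X)%N]dimvf limg_dim_leq.
Qed.

Lemma vanishes_finite_pd (N : nat) M :
  (forall m, (N < m)%N -> vanishes (hom_bimod M (top_mod A)) m) -> finite_projective_dimension M.
Proof.
move=> van; have [res _ _] := min_res_minimal M.
exists (min_res M), (@min_res_d _ _ M), (cover_map M); split=> //.
exists N => i lt; have /cspan0/dim_min_res := van i lt.
by rewrite mul0n leqn0 => /eqP.
Qed.
End Dimensions.

(** * Duality *)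

Section Dual.
Variables (k : fieldType) (A B : falgType k) (phi : A -> B).
Hypotheses (phi_lin : linear phi) (phi1 : phi 1 = 1).
Hypothesis phiM : forall a b, phi (a * b) = phi b * phi a.
Variable M : fgMod B.

Fact dual_act_subproof a : linear (fun f : 'Hom(M, k^o) => (f \o act M (phi a))%VF).
Proof. by move=> c x y; rewrite comp_lfunDl comp_lfunZl. Qed.
Definition dual_act (a : A) : 'End('Hom(M, k^o)) := lin_hom (dual_act_subproof a).
Lemma dual_actE a (f : 'Hom(M, k^o)) m : dual_act a f m = f (act M (phi a) m).
Proof. by rewrite lin_homE comp_lfunE. Qed.
Fact dual_act_linear : linear dual_act.
Proof.
move=> c a b; apply/lfunP => f; apply/lfunP => m.
rewrite !(add_lfunE, scale_lfunE) !dual_actE phi_lin act_linear.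
by rewrite !(add_lfunE, scale_lfunE) linearP.
Qed.
Fact dual_act1 : dual_act 1 = \1%VF.
Proof. by apply/lfunP => f; apply/lfunP => m; rewrite dual_actE phi1 act1E id_lfunE. Qed.
Fact dual_actM a b : dual_act (a * b) = (dual_act a \o dual_act b)%VF.
Proof.
by apply/lfunP => f; apply/lfunP => m; rewrite comp_lfunE !dual_actE phiM actME.
Qed.
(** The action is pulled back along an anti-homomorphism [phi] rather than taken over the opposite
    algebra, so one construction serves both directions and the double opposite never appears. *)
Definition dual_mod : fgMod A := FgMod dual_act_linear dual_act1 dual_actM.
Lemma dual_modE a (f : dual_mod) m :
  (act dual_mod a f : 'Hom(M, k^o)) m = (f : 'Hom(M, k^o)) (act M (phi a) m).
Proof. exact: dual_actE. Qed.
End Dual.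

Section DualMaps.
Variable k : fieldType.

Lemma linear_form_neq0 (V : vectType k) (v : V) : (forall f : 'Hom(V, k^o), f v = 0) -> v = 0.
Proof.
move=> fv; rewrite (coord_vbasis (memvf v)) big1 // => i _.
have l : linear (coord (vbasis {:V}) i : V -> k^o) by move=> c x y; rewrite linearP.
by have := fv (lin_hom l); rewrite lin_homE => ->; rewrite scale0r.
Qed.

Section Transpose.
Variables (U V : vectType k) (g : 'Hom(U, V)).
Fact transpose_subproof : linear (fun f : 'Hom(V, k^o) => (f \o g)%VF).
Proof. by move=> c x y; rewrite comp_lfunDl comp_lfunZl. Qed.
Definition transpose : 'Hom('Hom(V, k^o), 'Hom(U, k^o)) := lin_hom transpose_subproof.
Lemma transposeE f : transpose f = (f \o g)%VF. Proof. exact: lin_homE. Qed.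
End Transpose.

Section Swap.
Variables (U V : vectType k) (f : 'Hom(U, 'Hom(V, k^o))).
Fact swap_subproof1 v : linear (fun u : U => f u v : k^o).
Proof. by move=> c x y; rewrite linearP add_lfunE scale_lfunE. Qed.
Fact swap_subproof2 : linear (fun v : V => lin_hom (swap_subproof1 v) : 'Hom(U, k^o)).
Proof.
move=> c x y; apply/lfunP => u; rewrite [LHS]lin_homE [RHS]add_lfunE scale_lfunE !lin_homE.
by rewrite linearP.
Qed.
(** The bijection between maps from [U] to the dual of [V] and maps from [V] to the dual of [U]. *)
Definition swap : 'Hom(V, 'Hom(U, k^o)) := lin_hom swap_subproof2.
Lemma swapE v u : swap v u = f u v. Proof. by rewrite !lin_homE. Qed.
End Swap.
End DualMaps.

Section Duality.
Variables (k : fieldType) (A B : falgType k) (phi : A -> B) (psi : B -> A).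
Hypotheses (phi_lin : linear phi) (phi1 : phi 1 = 1).
Hypothesis phiM : forall a b, phi (a * b) = phi b * phi a.
Hypotheses (psi_lin : linear psi) (psi1 : psi 1 = 1).
Hypothesis psiM : forall a b, psi (a * b) = psi b * psi a.
Hypotheses (phiK : cancel phi psi) (psiK : cancel psi phi).

Definition dualA (M : fgMod B) : fgMod A := dual_mod phi_lin phi1 phiM M.
Definition dualB (M : fgMod A) : fgMod B := dual_mod psi_lin psi1 psiM M.

Lemma transposeB_hom (M N : fgMod A) (g : 'Hom(M, N)) :
  is_hom g -> is_hom (transpose g : 'Hom(dualB N, dualB M)).
Proof.
have tE f m : (transpose g f : 'Hom(M, k^o)) m = (f : 'Hom(N, k^o)) (g m).
  by rewrite transposeE comp_lfunE.
move=> hg a f; apply/lfunP => m; rewrite [LHS]tE [RHS]dual_modE [RHS]tE hg.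
exact: (@dual_modE _ _ _ psi psi_lin psi1 psiM N a f).
Qed.
Lemma transposeA_hom (M N : fgMod B) (g : 'Hom(M, N)) :
  is_hom g -> is_hom (transpose g : 'Hom(dualA N, dualA M)).
Proof.
have tE f m : (transpose g f : 'Hom(M, k^o)) m = (f : 'Hom(N, k^o)) (g m).
  by rewrite transposeE comp_lfunE.
move=> hg a f; apply/lfunP => m; rewrite [LHS]tE [RHS]dual_modE [RHS]tE hg.
exact: (@dual_modE _ _ _ phi phi_lin phi1 phiM N a f).
Qed.

(** Under [swap], extending a map into the dual of [P] along an injection becomes lifting a map from
    [P] along the transposed surjection. *)
Lemma dualB_injective (P : fgMod A) : projective P -> injective_mod (dualB P).
Proof.
move=> pP X Y g f hg ig hf.
pose f' : 'Hom(P, dualA X) := swap (f : 'Hom(X, 'Hom(P, k^o))).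
have hf' : is_hom f'.
  move=> a p; apply/lfunP => x; rewrite [RHS]dual_modE !swapE hf.
  by rewrite [RHS]dual_modE phiK.
have [|h hh hE] := pP _ _ (transpose g : 'Hom(dualA Y, dualA X)) f' (transposeA_hom hg) _ hf'.
  apply: limg_full => u; exists ((u : 'Hom(X, k^o)) \o g^-1)%VF.
  apply/lfunP => x; rewrite transposeE !comp_lfunE.
  by rewrite lker0_lfunK //; apply/eqP.
pose h' : 'Hom(Y, dualB P) := swap (h : 'Hom(P, 'Hom(Y, k^o))).
exists h'.
  move=> b y; apply/lfunP => p; rewrite [RHS]dual_modE !swapE hh.
  by rewrite [RHS]dual_modE psiK.
apply/lfunP => x; apply/lfunP => p; rewrite comp_lfunE swapE.
have /lfunP/(_ p) := hE; rewrite comp_lfunE => /lfunP/(_ x).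
by rewrite transposeE comp_lfunE swapE.
Qed.

(** Stated for [Y] merely isomorphic to the dual of [M], so that it applies to a module and its
    double dual. *)
Lemma proj_dim_le_dual_inj_dim_le n (M : fgMod A) (Y : fgMod B) (t : 'Hom(Y, dualB M)) :
  is_hom t -> lker t = 0%VS -> limg t = fullv -> proj_dim_le n M -> inj_dim_le n Y.
Proof.
elim: n M Y t => [|n IH] M Y t ht kt st /=.
  move=> d0; rewrite -dimvf; apply/eqP; rewrite dimv_eq0; apply/eqP/vspaceP => y.
  rewrite memvf memv0; apply/esym/eqP/(lker0P t).1 => //.
  by apply/lfunP => m; rewrite (dim0_eq0 m d0) !linear0.
move=> [P [K [E [pP pK]]]].
pose i : 'Hom(Y, dualB P) := (transpose (ms_p E) \o t)%VF.
pose q : 'Hom(dualB P, dualB K) := transpose (ms_i E).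
have hi : is_hom i.
  apply: (@is_hom_comp _ _ Y (dualB M) (dualB P)) => //.
  exact/transposeB_hom/ms_hp.
have hq : is_hom q by apply: transposeB_hom; exact: ms_hi.
have iE y p : (i y : 'Hom(P, k^o)) p = (t y : 'Hom(M, k^o)) (ms_p E p).
  by rewrite /i comp_lfunE transposeE comp_lfunE.
have qE (f : dualB P) x : (q f : 'Hom(K, k^o)) x = (f : 'Hom(P, k^o)) (ms_i E x).
  by rewrite transposeE comp_lfunE.
have ses : mod_ses Y (dualB P) (dualB K).
  apply: (@ModSes _ _ Y (dualB P) (dualB K) i q) => //.
  - apply/(lker0P i) => y iy; apply: (lker0P t).1 => //.
    apply/lfunP => m; have [p <-] := limg_fullP (ms_surj E) m.
    by rewrite -iE iy !zero_lfunE.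
  - apply/vspaceP => f; apply/memv_imgP/idP => [[y _ ->]|].
      rewrite memv_ker; apply/eqP/lfunP => x; rewrite qE iE zero_lfunE.
      by have /lfunP/(_ x) := ms_pi E; rewrite comp_lfunE zero_lfunE => ->; rewrite linear0.
    rewrite memv_ker => /eqP qf.
    have [y yE] := limg_fullP st ((f : 'Hom(P, k^o)) \o ms_s E)%VF.
    exists y; first exact: memvf.
    apply/lfunP => p; rewrite iE yE comp_lfunE.
    have /lfunP/(_ p) := ms_split E; rewrite add_lfunE !comp_lfunE id_lfunE => {1}<-.
    by rewrite linearD /= -qE qf zero_lfunE add0r.
  - apply: limg_full => f; exists ((f : 'Hom(K, k^o)) \o ms_r E)%VF.
    apply/lfunP => x; rewrite qE comp_lfunE.
    by have /lfunP/(_ x) := ms_ri E; rewrite comp_lfunE id_lfunE => ->.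
exists (dualB P), (dualB K), ses; split; first exact: dualB_injective.
apply: (IH K (dualB K) \1%VF) => //; first exact: is_hom_id.
- by apply/lker0P => x; rewrite id_lfunE.
- by apply: limg_full => x; exists x; rewrite id_lfunE.
Qed.

Lemma proj_dim_le_dualA_inj_dim_le n (Y : fgMod B) : proj_dim_le n (dualA Y) -> inj_dim_le n Y.
Proof.
pose t : 'Hom(Y, dualB (dualA Y)) := swap (\1%VF : 'Hom(dualA Y, 'Hom(Y, k^o))).
have tE y (f : dualA Y) : (t y : 'Hom(dualA Y, k^o)) f = (f : 'Hom(Y, k^o)) y.
  by rewrite swapE id_lfunE.
have kt : lker t = 0%VS.
  apply/lker0P => y ty; apply: linear_form_neq0 => f.
  by rewrite -(tE y f) ty zero_lfunE.
apply: (@proj_dim_le_dual_inj_dim_le n (dualA Y) Y t) => //.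
  move=> b y; apply/lfunP => f; rewrite [RHS]dual_modE !tE.
  by rewrite [RHS]dual_modE psiK.
apply/eqP; rewrite eqEdim subvf /= limg_dim_eq ?kt ?capv0 // !dimvf.
by rewrite !dim_hom /dim /= !muln1.
Qed.
End Duality.

Lemma regular_projective (k : fieldType) (A : falgType k) : projective (regular_mod A).
Proof.
move=> X Y g f hg sg hf; pose x := (g^-1)%VF (f (1 : A)).
exists (lin_hom (act_lin x)); 
  first by move=> a m; rewrite regular_actE [LHS]lin_homE [in RHS]lin_homE actME.
apply/lfunP => a; rewrite comp_lfunE lin_homE hg limg_lfunVK ?sg ?memvf //.
by rewrite -hf regular_actE mulr1.
Qed.

Section Opposite.
Variables (k : fieldType) (A : falgType k).

Let phi : A -> A^c := id.
Let psi : A^c -> A := id.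
Let phi_lin : linear phi. Proof. by []. Qed.
Let psi_lin : linear psi. Proof. by []. Qed.
Let phi1 : phi 1 = 1. Proof. by []. Qed.
Let psi1 : psi 1 = 1. Proof. by []. Qed.
Let phiM a b : phi (a * b) = phi b * phi a. Proof. by []. Qed.
Let psiM a b : psi (a * b) = psi b * psi a. Proof. by []. Qed.

(* The witness is the injective cogenerator D(A) = Hom_k(A, k). *)
Lemma opposite_regular_dual : exists M : fgMod A,
  injective_mod M /\ forall n, proj_dim_le n M -> inj_dim_le n (regular_mod (A^c)%type).
Proof.
exists (dualA phi_lin phi1 phiM (regular_mod (A^c)%type)); split.
  apply: (@dualB_injective k (A^c)%type A psi phi psi_lin psi1 psiM) => //.
  exact: regular_projective.
by move=> n; apply: (@proj_dim_le_dualA_inj_dim_le k A (A^c)%type phi psi phi_lin phi1 phiM).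
Qed.
End Opposite.

(** * Left and right action of Hochschild cohomology *)

Section LeftRight.
Variables (k : fieldType) (A : falgType k).
Implicit Types M N : fgMod A.

Lemma cup_homog (B1 B2 B3 : bimod A) (p : pairing B1 B2 B3) m n f g :
  homogeneous m f -> homogeneous n g -> homogeneous (m + n) (cup p f g).
Proof.
move=> hf hg s ns; rewrite /cup big1 // => i _.
have le_i : (i <= size s)%N by rewrite -ltnS.
have [E|ne] := eqVneq (i : nat) m; last first.
  by rewrite hf ?pair0l // size_takel.
rewrite hg ?pair0r // size_drop; apply: contra ns => /eqP <-.
by rewrite -E subnKC.
Qed.

Section Act.
Variables (m : nat) (x : seq A -> regular_bimod A).
Hypothesis nx : ncocycle m x.

Definition right_act M N (z : seq A -> hom_bimod M N) : seq A -> hom_bimod M N :=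
  cup (comp_pairing M M N) z (tensor_cochain M x).
Definition left_act M N (z : seq A -> hom_bimod M N) : seq A -> hom_bimod M N :=
  cup (comp_pairing M N N) (tensor_cochain N x) z.

Let cx : is_cochain x.
Proof. by have [mx hx _] := nx; split=> //; exact: homog_bounded hx. Qed.

Lemma tensor_homog M : homogeneous m (tensor_cochain M x).
Proof.
have [_ hx _] := nx; move=> s ns; rewrite /tensor_cochain hx //.
exact: (linear_zeroE (@act_linear _ _ M)).
Qed.
Lemma diff_tensor0 M : diff (tensor_cochain M x) = 0.
Proof.
have [_ _ dx] := nx; rewrite diff_tensor dx; apply/funext => s.
exact: (linear_zeroE (@act_linear _ _ M)).
Qed.

Lemma right_act_cochain M N n (z : seq A -> hom_bimod M N) :
  multilinear z -> homogeneous n z ->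
  multilinear (right_act z) /\ homogeneous (n + m) (right_act z).
Proof.
move=> mz hz; split; last by apply: cup_homog => //; exact: tensor_homog.
have [//] : is_cochain (right_act z).
apply: is_cochain_cup; last exact: is_cochain_tensor.
by split=> //; exact: homog_bounded hz.
Qed.
Lemma left_act_cochain M N n (z : seq A -> hom_bimod M N) :
  multilinear z -> homogeneous n z ->
  multilinear (left_act z) /\ homogeneous (n + m) (left_act z).
Proof.
move=> mz hz; split; last by rewrite addnC; apply: cup_homog => //; exact: tensor_homog.
have [//] : is_cochain (left_act z).
apply: is_cochain_cup; first exact: is_cochain_tensor.
by split=> //; exact: homog_bounded hz.
Qed.

Lemma diff_right_act M N (z : seq A -> hom_bimod M N) : diff (right_act z) = right_act (diff z).
Proof. by rewrite leibniz diff_tensor0 cup0r addr0. Qed.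
Lemma diff_left_act M N (z : seq A -> hom_bimod M N) :
  diff (left_act z) = (-1) ^+ m *: left_act (diff z).
Proof.
rewrite leibniz diff_tensor0 cup0l add0r.
have -> : twist (tensor_cochain N x) = (-1) ^+ m *: tensor_cochain N x + 0.
  apply/funext => s; rewrite addr0 [RHS](_ : _ = (-1) ^+ m *: tensor_cochain N x s) //.
  rewrite /twist; have [->//|ne] := eqVneq (size s) m.
  by rewrite tensor_homog // !scaler0.
by rewrite cup_lincombl cup0l addr0.
Qed.

Lemma pre_right_act M' M N (f : 'Hom(M', M)) (hf : is_hom f) (z : seq A -> hom_bimod M N) :
  pre_hom N hf \o right_act z = right_act (pre_hom N hf \o z).
Proof.
apply/funext => s; rewrite /= /right_act /cup.
rewrite (big_morph (fun g : hom_bimod M N => (g \o f)%VF : hom_bimod M' N)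
  (linear_addE (bfun_lin (pre_hom N hf))) (linear_zeroE (bfun_lin (pre_hom N hf)))).
apply: eq_bigr => i _; rewrite /= /tensor_cochain -!comp_lfunA; congr (_ \o _)%VF.
by rewrite is_hom_lfun.
Qed.
Lemma pre_left_act M' M N (f : 'Hom(M', M)) (hf : is_hom f) (z : seq A -> hom_bimod M N) :
  pre_hom N hf \o left_act z = left_act (pre_hom N hf \o z).
Proof.
apply/funext => s; rewrite /= /left_act /cup.
rewrite (big_morph (fun g : hom_bimod M N => (g \o f)%VF : hom_bimod M' N)
  (linear_addE (bfun_lin (pre_hom N hf))) (linear_zeroE (bfun_lin (pre_hom N hf)))).
by apply: eq_bigr => i _; rewrite /= -!comp_lfunA.
Qed.
Lemma post_right_act M N N' (f : 'Hom(N, N')) (hf : is_hom f) (z : seq A -> hom_bimod M N) :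
  post_hom M hf \o right_act z = right_act (post_hom M hf \o z).
Proof.
apply/funext => s; rewrite /= /right_act /cup.
rewrite (big_morph (fun g : hom_bimod M N => (f \o g)%VF : hom_bimod M N')
  (linear_addE (bfun_lin (post_hom M hf))) (linear_zeroE (bfun_lin (post_hom M hf)))).
by apply: eq_bigr => i _; rewrite /= !comp_lfunA.
Qed.

(** In degree 0 [z] is a module homomorphism and commutes with the action of the values of [x]. *)
Lemma left_right_act0 M N (z : seq A -> hom_bimod M N) : ncocycle 0 z ->
  right_act z = left_act z.
Proof.
move=> nz; have hz := cocycle0_hom nz; have [_ z0 _] := nz.
apply/funext => s; rewrite /right_act /left_act /cup.
rewrite big_ord_recl big_ord_recr /= take0 drop0 take_size drop_size.
rewrite !big1 ?addr0 ?add0r.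
- by rewrite /tensor_cochain is_hom_lfun.
- move=> i _; rewrite z0 ?comp_lfun0r // size_drop -lt0n subn_gt0 //.
- move=> i _; rewrite z0 ?comp_lfun0l // size_takel // /bump leq0n.
Qed.

(* Graded commutativity of the two actions, by dimension shifting in the degree
   of [z] along 0 -> K -> P -> M -> 0 with P projective. *)
Lemma left_right_act n M N (z : seq A -> hom_bimod M N) : ncocycle n z ->
  exists2 e : k, e != 0 & exists2 w, multilinear w &
    right_act z = e *: left_act z + diff w.
Proof.
elim: n M z => [|n IH] M z nz.
  exists 1; first exact: oner_neq0.
  exists 0; first exact: multilinear0.
  by rewrite diff0 addr0 scale1r left_right_act0.
pose ses := hom_ses_l (cover_ses M) N.
have van : vanishes (hom_bimod (cover_mod M) N) n.+1.
  by apply: projective_vanishes; exact: cover_projective.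
have [u [mu hu zE]] := van _ (ncocycle_comp (ses_i ses) nz).
have npu : ncocycle n (ses_p ses \o u).
  split; [exact: (multilinear_comp (bfun_lin _))|exact: (homog_comp (bfun_lin _))|].
  by rewrite diff_comp -zE; apply/funext => t; exact: (ses_pi ses).
have [e e0 [w mw puE]] := IH _ _ npu.
(* Each shift contributes the sign with which [left_act] commutes with [diff]. *)
exists (e * (-1) ^+ m); first by rewrite mulf_neq0 // expf_neq0 // oppr_eq0 oner_neq0.
have ls := ses_s_lin ses; have lr := ses_r_lin ses.
(* The defect in degree [n], lifted to the projective cover. It is killed by the projection, so it
   comes from a cochain on [M], whose differential is the defect for [z]. *)
pose D := right_act u + ((- e) *: left_act u + -1 *: diff (ses_s ses \o w)).
have pD t : ses_p ses (D t) = 0.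
  have lp := bfun_lin (ses_p ses).
  have -> : D t = right_act u t + ((- e) *: left_act u t + -1 *: diff (ses_s ses \o w) t) by [].
  rewrite (linear_addE lp) lp (linear_scaleE lp).
  have -> : ses_p ses (right_act u t) = right_act (ses_p ses \o u) t.
    exact: (congr1 (fun h => h t) (pre_right_act (ms_hi (cover_ses M)) u)).
  have -> : ses_p ses (left_act u t) = left_act (ses_p ses \o u) t.
    exact: (congr1 (fun h => h t) (pre_left_act (ms_hi (cover_ses M)) u)).
  have -> : ses_p ses (diff (ses_s ses \o w) t) = diff w t by exact: ses_p_diff_s.
  rewrite puE [X in X + _](_ : _ = e *: left_act (ses_p ses \o u) t + diff w t) //.
  by rewrite scaleNr scaleN1r addrACA subrr add0r subrr.
have [mru hru] := right_act_cochain mu hu; have [mlu hlu] := left_act_cochain mu hu.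
have mD : multilinear D.
  rewrite /D -[right_act u]scale1r; apply: multilinear_sub => //.
  apply: multilinear_sub => //.
  rewrite -[X in multilinear X]addr0; apply: multilinear_sub; last exact: multilinear0.
  apply: diff_multilinear; exact: (multilinear_comp ls).
exists (ses_r ses \o D); first exact: (multilinear_comp lr).
have iE : ses_i ses \o (ses_r ses \o D) = D by apply/funext => t; exact: (ses_ker (E := ses)).
have H : ses_i ses \o diff (ses_r ses \o D) =
    right_act (ses_i ses \o z) - (e * (-1) ^+ m) *: left_act (ses_i ses \o z).
  rewrite -diff_comp iE /D diffD diff_linear diffZ diff_diff scaler0 addr0.
  by rewrite diff_right_act diff_left_act scalerA mulNr scaleNr -zE.
have -> : right_act z = (e * (-1) ^+ m) *: left_act z +
   (right_act z - (e * (-1) ^+ m) *: left_act z) by rewrite addrC subrK.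
congr (_ + _); apply/funext => t.
apply/eqP; rewrite -subr_eq0; apply/eqP; apply: (ses_i_inj (E := ses)).
have li := bfun_lin (ses_i ses).
rewrite addrC -scaleN1r li scaleN1r.
have -> : ses_i ses (diff (ses_r ses \o D) t) =
   right_act (ses_i ses \o z) t - (e * (-1) ^+ m) *: left_act (ses_i ses \o z) t.
  exact: (congr1 (fun h => h t) H).
have -> : (right_act z - (e * (-1) ^+ m) *: left_act z) t =
   (- (e * (-1) ^+ m)) *: left_act z t + right_act z t.
  by rewrite scaleNr addrC.
rewrite li.
have -> : ses_i ses (right_act z t) = right_act (ses_i ses \o z) t.
  exact: (congr1 (fun h => h t) (pre_right_act (ms_hp (cover_ses M)) z)).
have -> : ses_i ses (left_act z t) = left_act (ses_i ses \o z) t.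
  exact: (congr1 (fun h => h t) (pre_left_act (ms_hp (cover_ses M)) z)).
by rewrite scaleNr [X in _ + X]addrC addNr.
Qed.
End Act.
End LeftRight.

(** * Ext as a module over Hochschild cohomology *)

Section ExtAction.
Variables (k : fieldType) (A : falgType k).
Implicit Types M N : fgMod A.

Definition HH_grading : grading (HH A) := coh_grading (regular_bimod A).
Definition Ext_grading M N : grading (Ext M N) := coh_grading (hom_bimod M N).

Lemma coh_scaleE (B : bimod A) c (z : Zcoc B) : c *: cls z = cls (c *: z).
Proof. by rewrite clsZ. Qed.

Lemma in_degree_ncocycle (B : bimod A) n (x : coh B) : in_degree n x ->
  exists2 z : Zcoc B, ncocycle n z & x = cls z.
Proof.
by move=> [z hz ->]; exists z => //; have [[mz _] dz] := cocycleP z.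
Qed.

Lemma hcup_deg (B1 B2 B3 : bimod A) (p : pairing B1 B2 B3) m n x y :
  deg (coh_grading B1) m x -> deg (coh_grading B2) n y ->
  deg (coh_grading B3) (m + n) (hcup p x y).
Proof.
move=> /in_degreeP[z hz ->] /in_degreeP[w hw ->]; rewrite hcup_cls.
by apply: deg_cls; exact: cup_homog.
Qed.

Lemma HH_mul_deg m n x y :
  deg HH_grading m x -> deg HH_grading n y -> deg HH_grading (m + n) (x * y).
Proof. exact: hcup_deg. Qed.

Lemma HH_one_deg : deg HH_grading 0 1.
Proof. by apply: deg_cls => -[]. Qed.

Lemma tensor_linear M : linear (tensor M).
Proof.
move=> c x y; rewrite -(clsK x) -(clsK y).
rewrite [c *: cls _]coh_scaleE -clsD !tensor_cls [c *: cls _]coh_scaleE -clsD.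
congr cls; apply: val_inj; exact: tensor_lincomb.
Qed.
Lemma tensor_deg M m x : deg HH_grading m x -> deg (Ext_grading M M) m (tensor M x).
Proof.
move=> /in_degreeP[z hz ->]; rewrite tensor_cls; apply: deg_cls => s ns.
by rewrite /= /tensor_cochain hz //; exact: (linear_zeroE (@act_linear _ _ M)).
Qed.

Lemma Ext_act_lin M N x : linear (@Ext_act k A M N x).
Proof.
move=> c e f; rewrite /Ext_act /yoneda hcupDl; congr (_ + _); exact: hcupZl.
Qed.
Lemma Ext_act_linl M N (e : Ext M N) : linear (fun x => Ext_act x e).
Proof.
move=> c x y; rewrite /Ext_act tensor_linear /yoneda hcupDr; congr (_ + _).
exact: hcupZr.
Qed.
Lemma Ext_act_deg M N m n x (e : Ext M N) : deg HH_grading m x ->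
  deg (Ext_grading M N) n e -> deg (Ext_grading M N) (m + n) (Ext_act x e).
Proof. by move=> dx de; rewrite addnC; apply: hcup_deg => //; exact: tensor_deg. Qed.

Lemma Ext_act_cls M N (x : Zcoc (regular_bimod A)) (e : Zcoc (hom_bimod M N)) :
  Ext_act (cls x : HH A) (cls e) = cls (zcup (comp_pairing M M N) e (ztensor M x)).
Proof. by rewrite /Ext_act tensor_cls; exact: hcup_cls. Qed.

Lemma Ext_act1 M N (e : Ext M N) : Ext_act 1 e = e.
Proof.
rewrite -(clsK e) [1](_ : _ = cls (MkZcoc (one_cocycle A))) // Ext_act_cls.
congr cls; apply: val_inj; apply/funext => s; rewrite /= /cup.
rewrite big_ord_recr /= take_size drop_size /tensor_cochain /= act1 comp_lfun1r.
rewrite big1 ?add0r // => i _; rewrite /one_cochain.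
case E : (drop i s) => [|b t].
  have := congr1 size E; rewrite size_drop /= => /eqP; rewrite subn_eq0.
  by rewrite leqNgt ltn_ord.
by rewrite (linear_zeroE (@act_linear _ _ M)) comp_lfun0r.
Qed.

Lemma pre_hom_act M' M N (f : 'Hom(M', M)) (hf : is_hom f) x (e : Ext M N) :
  coh_map (pre_hom N hf) (Ext_act x e) = Ext_act x (coh_map (pre_hom N hf) e : Ext M' N).
Proof.
rewrite -(clsK x) -(clsK e) Ext_act_cls !coh_map_cls Ext_act_cls.
congr cls; apply: val_inj; exact: pre_right_act.
Qed.
Lemma post_hom_act M N N' (f : 'Hom(N, N')) (hf : is_hom f) x (e : Ext M N) :
  coh_map (post_hom M hf) (Ext_act x e) = Ext_act x (coh_map (post_hom M hf) e : Ext M N').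
Proof.
rewrite -(clsK x) -(clsK e) Ext_act_cls !coh_map_cls Ext_act_cls.
congr cls; apply: val_inj; exact: post_right_act.
Qed.

(* Up to a unit of k, [x] acts on [e] as the product of [tensor N x] with [e]. *)
Lemma tensor0_Ext_act M N m n x (e : Ext M N) :
  deg HH_grading m x -> deg (Ext_grading M N) n e -> tensor N x = 0 -> Ext_act x e = 0.
Proof.
move=> /in_degreeP/in_degree_ncocycle[zx nx ->] /in_degreeP/in_degree_ncocycle[z nz ->] tx.
have [c c0 [w mw E]] := left_right_act nx nz; rewrite Ext_act_cls.
have left0 : hcup (comp_pairing M N N) (tensor N (cls zx : HH A)) (cls z) = 0.
  by rewrite tx -[0](cls0 (hom_bimod N N)) hcup_cls -cls0; congr cls; apply: val_inj; exact: cup0l.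
rewrite tensor_cls hcup_cls -cls0 in left0.
move/clsE/asboolP: left0 => [u [mu bu] uE].
rewrite -cls0; apply/clsE/asboolP.
have [mz hz _] := nz.
have hdw : homogeneous (n + m) (diff w).
  have [_ hr] := right_act_cochain nx mz hz; have [_ hl] := left_act_cochain nx mz hz.
  have -> : diff w = (- c) *: left_act zx z + right_act zx z by rewrite E scaleNr addKr.
  exact: homog_sub.
(* [w] is only multilinear; truncation makes it bounded without changing its differential. If
   [n + m] is 0, that differential is zero, so the truncated predecessor does no harm. *)
have dw : diff (trunc (n + m).-1 w) = diff w.
  rewrite diff_trunc; case: (n + m)%N hdw => [|l] hdw; last by rewrite trunc_id.
  have -> : diff w = 0 by apply/funext => -[|a t] //; rewrite hdw.
  exact: (linear_zeroE (@trunc_lin _ _ _ _)).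
exists (c *: u + trunc (n + m).-1 w).
  apply: is_cochain_submod; first by split.
  split; first exact: trunc_multilinear.
  exact: homog_bounded (@trunc_homog _ _ _ _ _).
rewrite diff_linear -uE dw.
transitivity (right_act zx z); first by apply/funext => s; exact: subr0.
rewrite E; congr (c *: _ + _); apply/funext => s; exact/esym/subr0.
Qed.

(** * Finite generation of Ext for all pairs of modules *)

Section FinitelyGenerated.
Variable H : set (HH A).
Hypotheses (grH : graded_subalgebra H) (comH : commutative_on H) (noethH : noetherian H).

Lemma H_subspace : subspace H.
Proof.
have [H1 Hl _ _] := grH; split=> //.
by have := Hl (-1) _ _ H1 H1; rewrite scaleN1r addNr.
Qed.
Lemma H_gpr n x : H x -> H (HH_grading n x).
Proof.
have [_ _ _ Hg] := grH => /Hg[N [y [yP ->]]]; rewrite gpr_big.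
apply: (@subspace_sum _ _ _ H_subspace N (fun i => HH_grading n (y i))) => i _.
have [Hy /in_degreeP dy] := yP i; rewrite (gpr_deg _ dy).
by case: ifP => // _; exact: H_subspace.1.
Qed.

Lemma Ext_generatedP M N : Ext_finitely_generated H M N <->
  exists r e, generated H (@Ext_act k A M N) setT r e.
Proof.
split=> [[s gen]|[r [e gen]]].
  exists (size s), (fun i => s`_i) => x _; have [c Hc xE] := gen x.
  by exists c.
exists (mkseq e r) => x; have [//|c [Hc xE]] := gen x; exists c => //.
rewrite size_mkseq xE; apply: eq_bigr => i _; by rewrite nth_mkseq.
Qed.

Lemma Ext_generated_exact M N (M1 N1 M2 N2 : fgMod A)
  (f : Ext M1 N1 -> Ext M N) (g : Ext M N -> Ext M2 N2) :
  {morph f : x y / x + y} -> {morph g : x y / x + y} ->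
  (forall x e, f (Ext_act x e) = Ext_act x (f e)) ->
  (forall x e, g (Ext_act x e) = Ext_act x (g e)) ->
  (forall e, g e = 0 -> exists y, e = f y) ->
  Ext_finitely_generated H M1 N1 -> Ext_finitely_generated H M2 N2 ->
  Ext_finitely_generated H M N.
Proof.
move=> fD gD fa ga ex /Ext_generatedP[r1 [e1 gen1]] /Ext_generatedP[r2 [e2 gen2]].
apply/Ext_generatedP; have sH := H_subspace; have [H1 _ HM _] := grH.
have Hm1 : H (-1) by rewrite -scaleN1r; exact: subspaceZ.
apply: (generated_exact _ _ _ _ _ _ _ _ _ _ fD gD fa ga ex gen2 gen1) => //.
- exact: sH.1.
- by move=> x y; exact: subspaceD.
- by move=> x; exact: (linear_addE (@Ext_act_lin _ _ x)).
- by move=> x y e; exact: (linear_addE (Ext_act_linl e)).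
- exact: Ext_act1.
- by move=> x y e; exact: Ext_actM.
Qed.

Lemma Ext_generated_zero M N : (forall e : Ext M N, e = 0) -> Ext_finitely_generated H M N.
Proof.
move=> E0; exists [::] => e; exists (fun=> 1); first by case: grH.
by rewrite (E0 e) big_ord0.
Qed.

Lemma Ext_generated_image M N M1 N1 (f : Ext M1 N1 -> Ext M N) :
  {morph f : x y / x + y} -> (forall x e, f (Ext_act x e) = Ext_act x (f e)) ->
  (forall e, exists y, e = f y) ->
  Ext_finitely_generated H M1 N1 -> Ext_finitely_generated H M N.
Proof.
move=> fD fa sf [s gen]; have f0 : f 0 = 0 by apply: (addrI (f 0)); rewrite -fD !addr0.
exists (map f s) => e; have [y ->] := sf e; have [c Hc ->] := gen y; exists c => //.
rewrite size_map (big_morph f fD f0); apply: eq_bigr => i _.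
by rewrite fa (nth_map 0).
Qed.

Lemma Ext_zero_l M N : dim M = 0%N -> forall e : Ext M N, e = 0.
Proof.
move=> d0 e; rewrite -(clsK e) -cls0; congr cls; apply: val_inj; apply/funext => s.
by apply/lfunP => x; rewrite (dim0_eq0 x d0) !linear0.
Qed.
Lemma Ext_zero_r M N : dim N = 0%N -> forall e : Ext M N, e = 0.
Proof.
move=> d0 e; rewrite -(clsK e) -cls0; congr cls; apply: val_inj; apply/funext => s.
by apply/lfunP => x; exact: etrans (dim0_eq0 _ d0) (esym (dim0_eq0 _ d0)).
Qed.

Lemma coh_map_inv (B1 B2 : bimod A) (f : bimod_hom B1 B2) (g : bimod_hom B2 B1) :
  (forall x, f (g x) = x) -> forall e, e = coh_map f (coh_map g e).
Proof.
move=> fg e; rewrite -(clsK e) !coh_map_cls; congr cls; apply: val_inj.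
by apply/funext => s /=; rewrite fg.
Qed.

Hypothesis fgH : Ext_finitely_generated H (top_mod A) (top_mod A).

Lemma Ext_generated_l N : Ext_finitely_generated H (top_mod A) N ->
  forall M, Ext_finitely_generated H M N.
Proof.
move=> gen; apply: fgMod_ind => [M d0|S simS|M1 M2 M3 E gen1 gen3].
- by apply: Ext_generated_zero; exact: Ext_zero_l.
- have [j [q [hj hq qj]]] := simple_retract simS.
  apply: (@Ext_generated_image _ _ _ _ (coh_map (pre_hom N hj))) gen.
  + exact: coh_mapD.
  + by move=> x e; exact: pre_hom_act.
  move=> e; exists (coh_map (pre_hom N hq) e); apply: coh_map_inv => x /=.
  by rewrite -comp_lfunA qj comp_lfun1r.
apply: (@Ext_generated_exact M2 N M3 N M1 N (coh_map (pre_hom N (ms_hp E)))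
  (coh_map (pre_hom N (ms_hi E)))) => //.
- exact: coh_mapD.
- exact: coh_mapD.
- by move=> x e; exact: pre_hom_act.
- by move=> x e; exact: pre_hom_act.
- exact: (coh_exact (E := hom_ses_l E N)).
Qed.

Lemma Ext_generated_r M : Ext_finitely_generated H M (top_mod A) ->
  forall N, Ext_finitely_generated H M N.
Proof.
move=> gen; apply: fgMod_ind => [N d0|S simS|M1 M2 M3 E gen1 gen3].
- by apply: Ext_generated_zero; exact: Ext_zero_r.
- have [j [q [hj hq qj]]] := simple_retract simS.
  apply: (@Ext_generated_image _ _ _ _ (coh_map (post_hom M hq))) gen.
  + exact: coh_mapD.
  + by move=> x e; exact: post_hom_act.
  move=> e; exists (coh_map (post_hom M hj) e); apply: coh_map_inv => x /=.
  by rewrite comp_lfunA qj comp_lfun1l.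
apply: (@Ext_generated_exact M M2 M M1 M M3 (coh_map (post_hom M (ms_hi E)))
  (coh_map (post_hom M (ms_hp E)))) => //.
- exact: coh_mapD.
- exact: coh_mapD.
- by move=> x e; exact: post_hom_act.
- by move=> x e; exact: post_hom_act.
- exact: (coh_exact (E := hom_ses_r E M)).
Qed.

Lemma Ext_generated M N : Ext_finitely_generated H M N.
Proof. exact/Ext_generated_r/Ext_generated_l. Qed.
End FinitelyGenerated.
End ExtAction.

(** * The centre of an indecomposable algebra *)

Section Centre.
Variables (k : fieldType) (A : falgType k).

Definition central (c : A) := forall a, a * c = c * a.

Lemma central_subspace : subspace [set c : A | central c].
Proof.
split=> [a|c x y cx cy a] /=; first by rewrite mulr0 mul0r.
by rewrite mulrDr mulrDl -scalerAr -scalerAl cx cy.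
Qed.

Definition central_cochain (c : A) (s : seq A) : regular_bimod A :=
  if s is [::] then c else 0.
Lemma central_cochain_cocycle c : central c -> ncocycle 0 (central_cochain c).
Proof.
move=> cc; split.
- by move=> [|b s1] s2 d x y /=; rewrite ?scaler0 ?addr0.
- by case.
apply/funext => -[|a [|b t]] //.
  by rewrite diff_sing /= cc subrr.
rewrite /= mulr0 mul0r scaler0 addr0 add0r.
by rewrite big1 // => i _; rewrite /merge; case: (i : nat) => [|j] /=; rewrite scaler0.
Qed.
Lemma cocycle_central (z : seq A -> regular_bimod A) : ncocycle 0 z ->
  central (z [::] : A) /\ z = central_cochain (z [::]).
Proof.
move=> [_ z0 dz]; split=> [a|]; last by apply/funext => -[|a s] //=; rewrite z0.
by have := congr1 (fun f => f [:: a]) dz; rewrite diff_sing => /eqP; rewrite subr_eq0 => /eqP.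
Qed.
Definition central_class c (cc : central c) : HH A :=
  cls (MkZcoc (ncocycle_cocycle (central_cochain_cocycle cc))).

Lemma in_degree0_central (x : HH A) : in_degree 0 x ->
  exists c (cc : central c), x = central_class cc.
Proof.
move=> /in_degree_ncocycle[z nz ->]; have [cc zE] := cocycle_central nz.
by exists (z [::]), cc; congr cls; apply: val_inj.
Qed.
Lemma central_class_degree c (cc : central c) : in_degree 0 (central_class cc).
Proof. by exists (MkZcoc (ncocycle_cocycle (central_cochain_cocycle cc))) => // -[]. Qed.

Lemma central_class_mul c d (cc : central c) (cd : central d) (ccd : central (c * d)) :
  central_class cc * central_class cd = central_class ccd.
Proof.
rewrite [LHS](hcup_cls (mul_pairing A)); congr cls; apply: val_inj.
apply/funext => -[|a s]; first by rewrite /= cup_nil.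
rewrite /= /cup big1 // => i _; case: (i : nat) => [|j] /=.
  by rewrite mulr0.
by rewrite mul0r.
Qed.
Lemma central_class1 (c1 : central 1) : central_class c1 = 1.
Proof. by congr cls; apply: val_inj; apply/funext => -[]. Qed.
Lemma central_class0 c (cc : central c) : c = 0 -> central_class cc = 0.
Proof.
by move=> c0; rewrite -cls0; congr cls; apply: val_inj; apply/funext => -[].
Qed.
Lemma central1 : central 1. Proof. by move=> a; rewrite mulr1 mul1r. Qed.
Lemma centralM c d : central c -> central d -> central (c * d).
Proof. by move=> cc cd a; rewrite mulrA cc -mulrA cd mulrA. Qed.
Lemma centralX c n : central c -> central (c ^+ n).
Proof.
by move=> cc; elim: n => [|n IH]; rewrite ?exprS; [exact: central1|exact: centralM].
Qed.
Lemma central_class_eq c d (cc : central c) (cd : central d) :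
  c = d -> central_class cc = central_class cd.
Proof. by move=> E; subst d; congr cls; apply: val_inj. Qed.
Lemma central_class_exp c (cc : central c) n (cn : central (c ^+ n)) :
  central_class cc ^+ n = central_class cn.
Proof.
elim: n cn => [|n IH] cn; first by rewrite expr0 central_class1.
have cM := centralM cc (centralX n cc).
rewrite exprS (IH (centralX n cc)) (central_class_mul _ _ cM).
by apply: central_class_eq; rewrite exprS.
Qed.

(* Fitting's lemma for multiplication by a central element. *)
Lemma central_nilpotent_or_unit (indecA : indecomposable_algebra A) c : central c ->
  (exists n, c ^+ n = 0) \/ exists2 d, central d & c * d = 1.
Proof.
move=> cc; pose f n : 'End(A) := amull (c ^+ n).
have fE n x : f n x = c ^+ n * x by rewrite lfunE.
(* A kernel of maximal dimension among positive powers of [c] does not grow any further; a positive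
   exponent leaves a factor [c] to split off in the unit case. *)
have bd : exists n, `[< exists m, \dim (lker (f m.+1)) = n >].
  by exists (\dim (lker (f 1%N))); apply/asboolP; exists 0%N.
have le_dim N : `[< exists m, \dim (lker (f m.+1)) = N >] -> (N <= dim A)%N.
  by move=> /asboolP[m <-]; rewrite -(dimvf A) dimvS ?subvf.
have [N /asboolP[m <-] maxm] := ex_maxnP bd le_dim.
pose n := m.+1; pose K := lker (f n).
have kK x : c ^+ n * (c ^+ n * x) = 0 -> c ^+ n * x = 0.
  rewrite mulrA -exprD => h.
  have sub : (K <= lker (f (n + n)%N))%VS.
    apply/subvP => y; rewrite !memv_ker !fE => /eqP yK.
    by rewrite exprD -mulrA yK mulr0.
  have /eqP E : K == lker (f (n + n)%N).
    rewrite eqEdim sub; apply: maxm; apply/asboolP; exists (m + n)%N.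
    by rewrite -addSn.
  by apply/eqP; rewrite -fE -memv_ker -/K E memv_ker fE h.
have [idl idr] : (forall (U : {vspace A}), (forall a x, x \in U -> a * x \in U) -> (fullv * U <= U)%VS) /\
    (forall (U : {vspace A}), (forall a x, x \in U -> x * a \in U) -> (U * fullv <= U)%VS).
  by split=> U hU; apply/prodvP => a b; [move=> _; exact: hU|move=> Ua _; exact: hU].
have cn := centralX n cc.
(* Image and kernel of a stable power are two-sided ideals with direct sum [A], so one of them is
   zero. *)
have [||||| |E|E] := indecA (limg (f n)) K.
- apply: idl => a x /memv_imgP[y _ ->]; apply/memv_imgP; exists (a * y); first exact: memvf.
  by rewrite !fE mulrA cn -mulrA.
- apply: idr => a x /memv_imgP[y _ ->]; apply/memv_imgP; exists (y * a); first exact: memvf.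
  by rewrite !fE mulrA.
- apply: idl => a x; rewrite !memv_ker !fE => /eqP h.
  by rewrite mulrA -cn -mulrA h mulr0.
- by apply: idr => a x; rewrite !memv_ker !fE => /eqP h; rewrite mulrA h mul0r.
- apply/eqP; rewrite eqEdim subvf /= dimv_disjoint_sum; last first.
    apply/eqP; rewrite -subv0; apply/subvP => x; rewrite memv_cap => /andP[/memv_imgP[y _ ->]].
    by rewrite memv_ker memv0 !fE => /eqP/kK ->.
  by rewrite addnC -(limg_ker_dim (f n) fullv) capfv.
- apply/eqP; rewrite -subv0; apply/subvP => x; rewrite memv_cap => /andP[/memv_imgP[y _ ->]].
  by rewrite memv_ker memv0 !fE => /eqP/kK ->.
- left; exists n; apply/eqP; rewrite -memv0 -E; apply/memv_imgP.
  by exists 1; rewrite ?memvf // fE mulr1.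
right.
have : 1 \in limg (f n).
  have -> : limg (f n) = fullv; last exact: memvf.
  by apply/eqP; rewrite eqEdim subvf /= limg_dim_eq // -/K E capv0.
case/memv_imgP => d _; rewrite fE => /esym dE.
have cd : central d.
  move=> a; have dE' : d * c ^+ n = 1 by rewrite -dE -cn.
  by rewrite -[LHS]mul1r -dE' -mulrA [c ^+ n * _]mulrA -cn -[a * _ * d]mulrA dE mulr1.
exists (c ^+ m * d); first by apply: centralM => //; exact: centralX.
by rewrite mulrA -exprS.
Qed.
End Centre.

(** * Proof of the theorem *)

Import Order.TTheory Num.Theory.

(** For positive [n], multiplying by [n] turns the integer exponent [d - 1] into the natural [d],
    and a real constant can be rounded up. *)
Lemma growth_leP (R : realType) u d : growth_le R u d <-> growth u d.
Proof.
have E (n : nat) : (0 < n)%N -> n%:R ^ (d%:Z - 1) * n%:R = n%:R ^+ d :> R.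
  move=> n0; have nz : n%:R != 0 :> R by rewrite pnatr_eq0 -lt0n.
  by rewrite -[X in _ * X]expr1z -expfzDr // subrK.
split=> [[a [N leN]]|[a [N leN]]].
  exists (Num.truncn `|a|).+1, N.+1 => n lt; have n0 : (0 < n)%N by apply: leq_trans lt.
  rewrite -(ler_nat R) !natrM natrX.
  apply: le_trans (ler_wpM2r (ler0n R n) (leN _ (ltnW lt))) _.
  rewrite -mulrA E // ler_wpM2r ?exprn_ge0 ?ler0n //.
  by apply: le_trans (ler_norm a) _; apply: ltW; exact: truncnS_gt.
exists a%:R, N.+1 => n lt; have n0 : (0 < n)%N by apply: leq_trans lt.
have n0' : 0 < n%:R :> R by rewrite ltr0n.
rewrite -(ler_pM2r n0') -mulrA E // -natrM -natrX -natrM ler_nat.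
exact/leN/ltnW.
Qed.

Section Assembly.
Variables (k : closedFieldType) (A : falgType k).
Hypothesis indecA : indecomposable_algebra A.
Implicit Types M N : fgMod A.
Variable H : set (HH A).
Hypotheses (grH : graded_subalgebra H) (comH : commutative_on H) (noethH : noetherian H).
Hypothesis H0 : forall x : HH A, in_degree 0 x -> H x.
Hypothesis fgH : Ext_finitely_generated H (top_mod A) (top_mod A).

Let G := HH_grading A.
Let H1 : H 1. Proof. by case: grH. Qed.
Let sH : subspace H := H_subspace grH.
Let HM x y : H x -> H y -> H (x * y). Proof. by case: grH => _ _ h _; exact: h. Qed.
Let HG n x : H x -> H (G n x) := @H_gpr _ _ _ grH n x.

(** In degree 0 [H] is the centre of [A], of dimension at most [dim A]. *)
Lemma spanned_deg0 : exists t, spanned (H `&` deg G 0) [set 0] t.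
Proof.
have -> : H `&` deg G 0 = deg G 0.
  by apply/seteqP; split=> [x []|x dx] //; split=> //; apply: H0; exact/in_degreeP.
exists (dim A); apply/cspan_coh.
apply: (@spanned_image _ _ _ [set c : A | central c] [set 0] _ _ (@central_cochain _ A)).
- by move=> c x y; apply/funext => -[|a s] //; rewrite [RHS]addr0 [RHS]scaler0.
- by move=> c; exact: central_cochain_cocycle.
- by move=> c ->; apply/funext => -[].
- move=> z nz; have [cc zE] := cocycle_central nz; exists (z [::]) => //.
  by rewrite -zE subrr; case: (ncoboundary_subspace (regular_bimod A) 0).
- exact: ncoboundary_subspace.
- exact/spanned_vspace/central_subspace.
Qed.

Lemma Ext_commute M N x y (e : Ext M N) : H x -> H y ->
  Ext_act x (Ext_act y e) = Ext_act y (Ext_act x e).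
Proof. by move=> Hx Hy; rewrite -!Ext_actM comH. Qed.

Lemma annihilator_graded M N : graded_ideal G H (annihilator H M N).
Proof.
apply: (@ann_graded _ _ G H sH HM HG _ (Ext_grading M N) (@Ext_act k A M N)).
- exact: Ext_act_lin.
- exact: Ext_act_linl.
- exact: Ext_act_deg.
- exact: Ext_actM.
Qed.

Lemma annihilator1_vanishes M N : annihilator H M N 1 -> forall n, vanishes (hom_bimod M N) n.
Proof.
by move=> [_ e0] n; apply/vanishesP => e _; rewrite -[e]Ext_act1 e0.
Qed.

Lemma codim_growth_Ext M N d : codim_growth G H (annihilator H M N) d ->
  exists v, (forall n, cspan (hom_bimod M N) n (v n)) /\ growth v d.
Proof.
have /(Ext_generatedP H)[r [e gen]] := Ext_generated grH comH noethH fgH M N.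
move=> cg.
have [v [sp gr]] : exists v,
    (forall n, spanned (deg (Ext_grading M N) n) [set 0] (v n)) /\ growth v d.
  exact: (codim_growth_module sH HG (@Ext_act_lin _ _ M N) (@Ext_act_linl _ _ M N)
     (@Ext_act_deg _ _ M N) gen).
by exists v; split=> // n; exact/cspan_coh.
Qed.

Lemma codim_growth0_vanishes M N : codim_growth G H (annihilator H M N) 0 ->
  exists n0, forall n, (n0 < n)%N -> vanishes (hom_bimod M N) n.
Proof.
move=> /codim_growth_Ext[v [sp /growth0P[n0 v0]]]; exists n0 => n lt.
by apply/cspan0; rewrite -(v0 n (ltnW lt)).
Qed.

(** If the elements of large degree annihilate Ext, the quotient of [H] by the annihilator lives in
    finitely many degrees, and so does Ext, being finitely generated over it. *)
Lemma killed_vanishes M N n0 :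
  (forall n x, (n0 <= n)%N -> H x -> deg G n x -> forall e : Ext M N, Ext_act x e = 0) ->
  exists n1, forall n, (n1 < n)%N -> vanishes (hom_bimod M N) n.
Proof.
move=> kill; apply: codim_growth0_vanishes.
have [idI _] := annihilator_graded M N.
have /choice[t tP] n := spanned_deg_mod sH HM HG noethH (@HH_mul_deg _ A) spanned_deg0 n idI.
exists (fun n => if (n0 <= n)%N then 0%N else t n); split.
  move=> n; case: leqP => // le; apply/spanned0P; first by case: (deg_subspaceS G sH n).
  by move=> x [Hx dx]; split=> // e; exact: kill dx e.
by apply/growth0P; exists n0 => n ->.
Qed.

Lemma Ext_act_homog0 (M N : fgMod A) (x : HH A) :
  (forall n (e : Ext M N), deg (Ext_grading M N) n e -> Ext_act x e = 0) ->
  forall e : Ext M N, Ext_act x e = 0.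
Proof.
move=> h e; have [N0 [-> _]] := gpr_sum (Ext_grading M N) e.
have lx := @Ext_act_lin _ _ M N x.
rewrite (big_morph _ (linear_addE lx) (linear_zeroE lx)).
by rewrite big1 // => i _; apply: h; exact: deg_gpr.
Qed.

Lemma vanishes_deg0 (M N : fgMod A) n (e : Ext M N) : vanishes (hom_bimod M N) n ->
  deg (Ext_grading M N) n e -> e = 0.
Proof. by move/vanishesP; apply. Qed.

(** In large degree [tensor M x] is zero. It multiplies Ext of the top into [M] from the target
    side, while [Ext_act] multiplies from the source side; [tensor0_Ext_act] passes from one to the
    other. *)
Lemma proj_dim_le_finite_id n M : proj_dim_le n M -> finite_injective_dimension M.
Proof.
move=> pM; apply/finite_idP.
have [n1 van] : exists n1, forall m, (n1 < m)%N -> vanishes (hom_bimod (top_mod A) M) m.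
  apply: (@killed_vanishes _ _ n) => m x le Hx dx; apply: Ext_act_homog0 => i e de.
  apply: (tensor0_Ext_act dx de); apply: vanishes_deg0 (tensor_deg M dx).
  exact: proj_dim_le_vanishes pM le.
by exists n1.+1; exact: vanishes_inj_dim_le.
Qed.

(** On Ext of [M] into the top, [Ext_act x] is multiplication by [tensor M x], which vanishes in
    large degree. *)
Lemma finite_id_pd M : finite_injective_dimension M -> finite_projective_dimension M.
Proof.
move=> /finite_idP[n iM].
have [n1 van] : exists n1, forall m, (n1 < m)%N -> vanishes (hom_bimod M (top_mod A)) m.
  apply: (@killed_vanishes _ _ n) => m x le Hx dx e.
  have t0 : tensor M x = 0.
    by apply: vanishes_deg0 (tensor_deg M dx); exact: inj_dim_le_vanishes iM le.
  have /(linear_zeroE) := tensor_linear M.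
  rewrite /Ext_act t0 => _.
  by apply: (addrI (yoneda e 0)); rewrite -/(yoneda e 0) /yoneda -hcupDr !addr0.
exact: vanishes_finite_pd van.
Qed.

Lemma finite_pd_id M : finite_projective_dimension M <-> finite_injective_dimension M.
Proof. by split=> [/finite_pdP[n /proj_dim_le_finite_id]|/finite_id_pd]. Qed.

Lemma gorenstein_A : gorenstein A.
Proof.
split.
  apply: (@proj_dim_le_finite_id 1); pose id1 : 'Hom(regular_mod A, regular_mod A) := \1%VF.
  have s1 : limg id1 = fullv by apply: limg_full => x; exists x; rewrite id_lfunE.
  exists (regular_mod A), _, (ker_ses (@is_hom_id _ _ (regular_mod A)) s1).
  split; first exact: regular_projective.
  transitivity (\dim (lker id1)) => //.
  apply/eqP; rewrite dimv_eq0; apply/eqP/lker0P => x.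
  by rewrite id_lfunE.
(* The right regular module is handled through its dual [M]: [M] is injective, hence of finite
   projective dimension, and a projective resolution of [M] dualizes back. *)
have [M [iM dM]] := opposite_regular_dual A; apply/finite_idP.
have /finite_id_pd/finite_pdP[n /dM iA] : finite_injective_dimension M; last by exists n.
apply/finite_idP; exists 1%N; have k1 : lker (\1%VF : 'Hom(M, M)) = 0%VS.
  by apply/lker0P => x; rewrite id_lfunE.
exists M, _, (coker_ses (@is_hom_id _ _ M) k1); split=> //.
have := ms_dim (coker_ses (@is_hom_id _ _ M) k1).
by move/eqP; rewrite -{1}[dim M]addn0 eqn_add2l => /eqP.
Qed.

(** A nonzero module has a nonzero map to the top, so Ext is nonzero in degree 0. *)
Lemma annihilator_proper M : dim M <> 0%N -> ~ annihilator H M (top_mod A) 1.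
Proof.
move=> d0 /annihilator1_vanishes/(_ 0%N) van.
have s0 : is_submod (0%VS : {vspace M}).
  by move=> a x; rewrite !memv0 => /eqP ->; rewrite linear0.
have n0 : (0%VS : {vspace M}) <> fullv by move=> E; apply: d0; rewrite -dimvf -E dimv0.
have [h [hh _ nh]] := hom_to_top s0 n0.
have := van _ (cochain0_cocycle hh) => /(congr1 (fun z => z [::])) /= h0.
by apply: nh; rewrite h0; apply: vspace_full => x; rewrite memv_ker zero_lfunE.
Qed.

Lemma annihilator_chain_growth M : dim M <> 0%N ->
  exists d, chain_growth G H (annihilator H M (top_mod A)) d.
Proof.
move=> d0; apply: exists_chain_growth => //.
- exact: HH_mul_deg.
- exact: HH_one_deg.
- exact: spanned_deg0.
- exact: annihilator_graded.
- exact: annihilator_proper.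
Qed.

Lemma chain_le_growth M m p u b : prime_chain H (annihilator H M (top_mod A)) m p ->
  (forall n, cspan (hom_bimod M (top_mod A)) n (u n)) -> growth u b -> (m <= b)%N.
Proof.
have /(Ext_generatedP H)[r [e gen]] := Ext_generated grH comH noethH fgH M (top_mod A).
move=> ch sp.
apply: (chain_length_le_growth H1 sH HM comH (@HH_mul_deg _ A) (@HH_one_deg _ A)
  (@Ext_act_lin _ _ M (top_mod A)) (@Ext_act_linl _ _ M (top_mod A))
  (@Ext_act_deg _ _ M (top_mod A)) (@Ext_commute M (top_mod A)) gen ch).
by move=> n; exact/cspan_coh.
Qed.

(** The same [d] is the length of a chain and an exponent of growth. As growth it bounds every other
    chain and, by [dim_min_res], the resolution. Conversely, by [cspan_min_res], any growth exponent
    of the resolution is at least the length of the chain. *)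
Lemma dim_complexity (R : realType) M : exists d, variety_dim_eq H M d /\ complexity_eq R M d.
Proof.
pose C := (dim (top_mod A) * dim A)%N.
have [d0|/eqP d0] := eqVneq (dim M) 0%N.
  exists 0%N; rewrite /variety_dim_eq d0; split=> //.
  exists (min_res M), (@min_res_d _ _ M), (cover_map M); split; first exact: min_res_minimal.
  split=> //; apply/growth_leP/growth0P; exists 0%N => n _.
  have /cspan0/dim_min_res := @vanishes_zero_l _ _ M (top_mod A) n d0.
  by rewrite mul0n leqn0 => /eqP.
have [d [cg [p ch] _]] := annihilator_chain_growth d0.
have [v [sp gr]] := codim_growth_Ext cg.
exists d; split.
  rewrite /variety_dim_eq; move/eqP/negPf: d0 => ->; split; first by exists p.
  by move=> n q chq; exact: chain_le_growth chq sp gr.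
exists (min_res M), (@min_res_d _ _ M), (cover_map M); split; first exact: min_res_minimal.
split.
  apply/growth_leP; apply: growth_le_trans (growth_scale C gr); exists 0%N => n _.
  by rewrite mulnC; exact: dim_min_res.
move=> b /growth_leP grb.
apply: chain_le_growth ch (fun n => cspan_min_res M n) _.
apply: growth_le_trans (growth_scale (dim (top_mod A)) grb); exists 0%N => n _.
by rewrite mulnC.
Qed.

Lemma H_pos_deg e x : (0 < e)%N -> H x -> deg G e x -> H_pos H x.
Proof.
(* The index [i] of [H_pos] carries degree [i + 1], so [x] is placed at the predecessor of its
   degree. *)
case: e => // e _ Hx dx; exists e.+1, (fun i => if i == e then x else 0); split.
  move=> i; case: eqP => [->|_]; first by split=> //; exact/in_degreeP.
  by split; [exact: sH.1|apply/in_degreeP; case: (deg_subspace G i.+1)].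
by rewrite big_ord_recr /= eqxx big1 ?add0r // => i _; rewrite ltn_eqF.
Qed.

(** * The degree zero part of [H] and the points of the variety *)

Let Hd0 := H_deg0 H.
Let Hd0_sub x y : Hd0 x -> Hd0 y -> Hd0 (x + y).
Proof.
move=> [Hx /in_degreeP dx] [Hy /in_degreeP dy]; split; first exact: subspaceD.
by apply/in_degreeP; apply: (subspaceD (deg_subspace G 0)).
Qed.
Let Hd0_mul x y : Hd0 x -> Hd0 y -> Hd0 (x * y).
Proof.
move=> [Hx /in_degreeP dx] [Hy /in_degreeP dy]; split; first exact: HM.
by apply/in_degreeP; exact: (HH_mul_deg dx dy).
Qed.
Let Hd0_1 : Hd0 1. Proof. by split=> //; apply/in_degreeP; exact: HH_one_deg. Qed.
Let Hd0_0 : Hd0 0.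
Proof. by split; [exact: sH.1|apply/in_degreeP; case: (deg_subspace G 0)]. Qed.
Let Hd0_comm : commutative_on Hd0. Proof. by move=> x y [Hx _] [Hy _]; exact: comH. Qed.

Lemma deg0_nilpotent_or_unit x : Hd0 x ->
  (exists n, x ^+ n = 0) \/ exists2 y, Hd0 y & x * y = 1.
Proof.
move=> [Hx /in_degree0_central[c [cc ->]]].
have [[n cn]|[d cd cE]] := central_nilpotent_or_unit indecA cc; [left|right].
  by exists n; rewrite (central_class_exp _ (centralX n cc)) central_class0.
have dd := central_class_degree cd.
exists (central_class cd); first by split=> //; exact: H0.
rewrite (central_class_mul _ _ (centralM cc cd)) -(central_class1 (@central1 _ A)).
exact: central_class_eq.
Qed.

(** A unit in the radical would put 1 into a maximal ideal. *)
Lemma radical_deg0_nilpotent x : jacobson_radical Hd0 x -> exists n, x ^+ n = 0.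
Proof.
move=> [Hx Jx]; have [//|[y Hy xy]] := deg0_nilpotent_or_unit Hx.
have id0 : left_ideal Hd0 [set 0].
  split=> //; first by move=> z ->.
    by move=> z w -> ->; rewrite addr0.
  by move=> a z _ ->; rewrite mulr0.
have [m [maxm _]] : exists m, maximal_left_ideal Hd0 m /\ [set 0] `<=` m.
  by apply: exists_maximal_ideal => //= /eqP; rewrite oner_eq0.
have [idm /(ideal_proper Hd0_1 idm) nm1 _] := maxm.
by case: nm1; rewrite -xy Hd0_comm //; case: idm => _ _ _; apply=> //; exact: Jx.
Qed.

Lemma nilpotent_radical_deg0 x n : Hd0 x -> x ^+ n = 0 -> jacobson_radical Hd0 x.
Proof.
move=> Hx xn; split=> // I maxI.
apply: (maximal_ideal_pow Hd0_1 Hd0_0 Hd0_sub Hd0_mul Hd0_comm maxI Hx (n := n)).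
by rewrite xn; case: maxI => -[].
Qed.

(* A maximal ideal containing all elements of large degree contains all those
   of positive degree, which are nilpotent modulo it. *)
Lemma maximal_ideal_m_gr m n0 : maximal_left_ideal H m ->
  (forall n x, (n0 <= n)%N -> H x -> deg G n x -> m x) -> m = m_gr H.
Proof.
move=> maxm big; have [idm /(ideal_proper H1 idm) nm1 _] := maxm.
have [mS m0 mD mM] := idm; have sm := ideal_subspace H1 sH idm.
have mpow x n : H x -> m (x ^+ n) -> m x.
  apply: (maximal_ideal_pow H1 sH.1 _ HM comH maxm) => y z; exact: subspaceD.
have HX x n : H x -> H (x ^+ n) by move=> Hx; exact: (S_pow H1 HM).
have pos x : H_pos H x -> m x.
  move=> [n [y [yP ->]]]; apply: (subspace_sum sm) => i _.
  have [Hy /in_degreeP dy] := yP i; apply: (mpow _ n0 Hy).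
  (* The power [n0] of an element of degree [i + 1] has degree at least [n0], where everything lies
     in [m]. *)
  apply: (big (n0 * i.+1)%N); [by rewrite leq_pmulr|exact: HX|].
  elim: (n0) => [|l IH]; first by rewrite expr0; exact: HH_one_deg.
  by rewrite exprS mulSn; exact: (HH_mul_deg dy IH).
apply/seteqP; split=> [h mh|_ [y [z [Jy Hz ->]]]]; last first.
  apply: mD; last exact: pos.
  have [n yn] := radical_deg0_nilpotent Jy; have [[Hy _] _] := Jy.
  by apply: (mpow _ n Hy); rewrite yn.
have Hh : H h by exact: mS.
have [N hE] := gpr_sum_ge G h.
have hE1 := hE N.+1 (leqnSn N); rewrite big_ord_recl /= in hE1.
pose z := \sum_(i < N) G i.+1 h.
have Hz : H_pos H z.
  exists N, (fun i => G i.+1 h); split=> // i; split; first exact: HG.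
  by apply/in_degreeP; exact: deg_gpr.
have mh0 : m (G 0%N h).
  have -> : G 0%N h = h - z by rewrite {2}hE1 addrK.
  by apply: (subspaceB sm) => //; exact: pos.
have Hh0 : Hd0 (G 0%N h) by split; [exact: HG|apply/in_degreeP; exact: deg_gpr].
exists (G 0%N h), z; split=> //.
(* The degree 0 component of [h] lies in the proper ideal [m], so it is not a unit; being nilpotent,
   it is in the radical. *)
have [[n hn]|[y [Hy _] hy]] := deg0_nilpotent_or_unit Hh0.
  exact: nilpotent_radical_deg0 hn.
by case: nm1; rewrite -hy comH //; [apply: mM|exact: HG].
Qed.

Lemma trivial_variety_finite_pd M : trivial_variety H M <-> finite_projective_dimension M.
Proof.
split=> [triv|/finite_pdP[n pM] m [maxm annm]]; last first.
  apply: (@maximal_ideal_m_gr m n) => // i x le Hx dx; apply: annm; split=> // e.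
  have t0 : tensor M x = 0.
    by apply: vanishes_deg0 (tensor_deg M dx); exact: proj_dim_le_vanishes pM le.
  rewrite /Ext_act t0.
  by apply: (addrI (yoneda e 0)); rewrite /yoneda -hcupDr !addr0.
have [d0|/eqP d0] := eqVneq (dim M) 0%N.
  by apply: (@vanishes_finite_pd _ _ 0%N) => m _; exact: vanishes_zero_l.
(* For [d = 0] Ext into the top vanishes in large degree and the minimal resolution stops; for
   [d > 0] the non-nilpotent [x] contradicts triviality. *)
have [d [cg _ pow]] := annihilator_chain_growth d0; case: d cg pow => [|d] cg pow.
  by have [n1 van] := codim_growth0_vanishes cg; exact: vanishes_finite_pd van.
have [//|e [x [e0 Hx dx nx]]] := pow; exfalso.
have [m [maxm annm m1x]] := maximal_avoiding_graded H1 sH HM comH (@HH_mul_deg _ A)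
  (@HH_one_deg _ A) (annihilator_graded M (top_mod A)) (annihilator_proper d0) e0 Hx dx nx.
have mE : m = m_gr H by exact: triv.
have [idm /(ideal_proper H1 idm) nm1 _] := maxm; apply: nm1.
(* The ideal would contain [1 - x] by construction and [x] because it equals [m_gr], hence 1. *)
rewrite -(subrK x 1); case: (idm) => _ _ mD _; apply: mD => //.
rewrite mE; exists 0, x; split; last by rewrite add0r.
  by apply: (@nilpotent_radical_deg0 0 1) => //; rewrite expr1.
exact: H_pos_deg e0 Hx dx.
Qed.
End Assembly.

Theorem theorem1p5 (R : realType) (k : closedFieldType) (A : falgType k)
    (indecA : indecomposable_algebra A)
    (H : set (HH A))
    (grH : graded_subalgebra H)
    (comH : commutative_on H)
    (noethH : noetherian H)
    (H0 : forall x : HH A, in_degree 0 x -> H x)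
    (fgH : Ext_finitely_generated H (top_mod A) (top_mod A)) :
  [/\ gorenstein A,
      forall M : fgMod A,
        (trivial_variety H M <-> finite_projective_dimension M) /\
        (finite_projective_dimension M <-> finite_injective_dimension M)
    & forall M : fgMod A, exists d : nat,
        variety_dim_eq H M d /\ complexity_eq R M d].
Proof.
split.
- exact: (gorenstein_A grH).
- by move=> M; split; [exact: trivial_variety_finite_pd|exact: (finite_pd_id grH)].
- by move=> M; exact: dim_complexity.
Qed.
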